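(* Let $M$ be an expansion $0\to A^*\xrightarrow{\iota}B\xrightarrow{\nu}C^*\to0$ of a pure short exact sequence of Abelian structures expanded by $\Phi$, with $\Phi$ a fundamental system for $B$ (see context). Let $\Gamma\subseteq\Delta\subseteq M^{eq}$ with $\Gamma=\mathrm{dcl}^{eq}(\Gamma)$, $\Delta=\mathrm{dcl}^{eq}(\Delta)$, where $M$ is $|\Delta|^+$-saturated and strongly $|\Delta|^+$-homogeneous, and let $u$ be a finite tuple of $M$. Assume: (H1) for every $\phi\in\Phi$, each coset in $C/\phi(C)$ belonging to $\mathrm{acl}^{eq}(\Gamma)$ belongs to $\Gamma$; (H2) $\Delta=\mathrm{dcl}^{eq}(A^*(\Delta)\cup B(\Delta)\cup C^*(\Delta))$; (H3) $\Gamma=\mathrm{dcl}^{eq}(A^*(\Gamma)\cup B(\Gamma)\cup C^*(\Gamma))$, and for every $\phi\in\Phi$ and every coset $X\in C/\phi(C)$ belonging to $\Gamma$, there is $\beta\in B(\Gamma)$ with $\nu(\beta)\in X$. Let $U$ be the substructure of $M$ generated by $u$ and $A^*(\Gamma)\cup B(\Gamma)\cup C^*(\Gamma)$. Then $\mathrm{tp}(U/\Delta)$ does not divide over $\Gamma$ if and only if, in the reduct $A^*(M)$, $\mathrm{tp}(A^*(U)/A^*(\Delta))$ does not divide over $A^*(\Gamma)$ and, in the reduct $C^*(M)$, $\mathrm{tp}(C^*(U)/C^*(\Delta))$ does not divide over $C^*(\Gamma)$.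
   Context: Fix a multi-sorted language $\mathcal{L}$. p.p.-formulas are the formulas in the closure of parameter-free atomic formulas under finite conjunction and existential quantification. An Abelian structure is an $\mathcal{L}$-structure such that each sort expands an Abelian group, each parameter-free term is a group homomorphism, and each p.p.-formula $\phi(x_{s_1},\dots,x_{s_n})$ defines a subgroup of the product of the corresponding sorts. For an Abelian structure $A$, $A/\phi(A)$ denotes the quotient of that product by $\phi(A)$. A fundamental system for $B$ is a set $\Phi$ of p.p.-formulas such that, modulo the theory of $B$, every p.p.-formula is equivalent to a finite conjunction of formulas $\phi(t(x))$ with $\phi\in\Phi$ and $t$ a tuple of parameter-free terms. An embedding $\iota:A\to B$ is pure if $\iota^{-1}(\phi(B))=\phi(A)$ for every p.p.-formula $\phi$. A pure short exact sequence expanded by $\Phi$ consists of Abelian structures $A,B,C$ on disjoint copies of $\mathcal{L}$, a pure embedding $\iota:A\to B$, a surjective morphism $\nu:B\to C$ with $\mathrm{Im}(\iota)=\mathrm{Ker}(\nu)$ on each sort and $\nu^{-1}(\phi(C))=\phi(B)+\iota(A)$ for all p.p. $\phi$, and for each $\phi\in\Phi$ the sort $A/\phi(A)$, the quotient map $\pi_\phi:A\to A/\phi(A)$, and the map $\rho_\phi:B\to A/\phi(A)$ which is $0$ outside $\phi(B)+\iota(A)$ and on $\phi(B)+\iota(A)$ is the homomorphism $\phi(B)+\iota(A)\to(\phi(B)+\iota(A))/\phi(B)\simeq A/\phi(A)$. $A^*$ is an arbitrary expansion of $A$ together with the sorts $A/\phi(A)$ and maps $\pi_\phi$, in a language $\mathcal{L}_A$;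 $C^*$ is an arbitrary expansion of $C$, in a language $\mathcal{L}_C$. $M$ is the resulting expansion of the sequence (its language contains $\mathcal{L}_A$, the language of $B$, $\mathcal{L}_C$, $\iota$, $\nu$ and all $\rho_\phi$). For $D\subseteq M^{eq}$, $A^*(D),B(D),C^*(D)$ are the sets of elements of $D$ in the sorts of $A^*$ (including the sorts $A/\phi(A)$), $B$, $C^*$. $A^*(M)$ and $C^*(M)$ are regarded as an $\mathcal{L}_A$-structure and an $\mathcal{L}_C$-structure. A formula divides over $\Gamma$ if for some $\Gamma$-indiscernible sequence of conjugates of its parameters, starting with the original, the corresponding formulas are jointly inconsistent; a type divides over $\Gamma$ if it implies a formula that does. *)

(* Defs.v *)
From mathcomp Require Import all_boot.
From mathcomp Require Import boolp classical_sets cardinality.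
Set Implicit Arguments.
Unset Strict Implicit.
Unset Printing Implicit Defensive.

Local Open Scope classical_set_scope.

(** * Finite contexts

   A context is a finite family of sorts, used both as the arity of a symbol
   and as the list of free variables of a formula.  The index set is presented
   as a finite sum of one-point sets instead of as 'I_n, so that concatenation
   of contexts and transport along a map of sorts hold definitionally for
   tuples. *)

Inductive ishape := Sh0 | Sh1 | ShU of ishape & ishape.

Fixpoint pos (a : ishape) : Type :=
  match a with
  | Sh0 => void
  | Sh1 => unit
  | ShU b c => (pos b + pos c)%type
  end.

Record ctx (S : Type) := Ctx { shp : ishape; srt :> pos shp -> S }.

Definition ctx_const S (a : ishape) (s : S) : ctx S := Ctx (fun _ : pos a => s).

Definition ctx_cat S (w v : ctx S) : ctx S :=
  @Ctx S (ShU (shp w) (shp v))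
    (fun p => match p with inl i => w i | inr j => v j end).

Definition ctx_cons S (s : S) (w : ctx S) : ctx S := ctx_cat (ctx_const Sh1 s) w.

Definition ctx_map S S' (h : S -> S') (w : ctx S) : ctx S' :=
  Ctx (fun i : pos (shp w) => h (w i)).

(* [ctx_pow w n] is n+1 copies of [w]. *)
Fixpoint ctx_pow S (w : ctx S) (n : nat) : ctx S :=
  match n with 0 => w | n'.+1 => ctx_cat w (ctx_pow w n') end.

(* The product of the sorts listed in [w]. *)
Definition env S (car : S -> Type) (w : ctx S) := forall i : pos (shp w), car (w i).

Definition ecat S (car : S -> Type) (w v : ctx S) (a : env car w) (b : env car v) :
    env car (ctx_cat w v) :=
  fun p => match p with inl i => a i | inr j => b j end.

Definition econs S (car : S -> Type) (s : S) (w : ctx S) (x : car s) (b : env car w) :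
    env car (ctx_cons s w) :=
  @ecat _ car (ctx_const Sh1 s) w (fun _ => x) b.

Fixpoint epow S (car : S -> Type) (w : ctx S) (b : nat -> env car w) (n : nat) :
    env car (ctx_pow w n) :=
  match n return env car (ctx_pow w n) with
  | 0 => b 0
  | n'.+1 => ecat (b 0) (@epow S car w (fun k => b k.+1) n')
  end.

Definition emap S (car car' : S -> Type) (f : forall s, car s -> car' s) (w : ctx S)
    (a : env car w) : env car' w := fun i => f (w i) (a i).

(** * Multi-sorted first-order logic *)

Record lang := Lang {
  sorts : Type;
  fsym : ctx sorts -> sorts -> Type;
  rsym : ctx sorts -> Type }.

Inductive term (L : lang) (w : ctx (sorts L)) : sorts L -> Type :=
| Tvar (i : pos (shp w)) : term w (w i)
| Tapp u s (f : fsym u s) (t : forall i : pos (shp u), term w (u i)) : term w s.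

Inductive fm (L : lang) : ctx (sorts L) -> Type :=
| Feq w s (t t' : term w s) : fm w
| Frel w u (r : rsym u) (t : forall i : pos (shp u), term w (u i)) : fm w
| Fand w (p q : fm w) : fm w
| Fnot w (p : fm w) : fm w
| Fex w s (p : fm (ctx_cons s w)) : fm w.

Record structure (L : lang) := Structure {
  car : sorts L -> Type;
  fint : forall u s, fsym u s -> env car u -> car s;
  rint : forall u, rsym u -> env car u -> Prop }.

Notation tup M := (env (car M)).

Fixpoint eval L (M : structure L) (w : ctx (sorts L)) (e : tup M w) s
    (t : term w s) : car M s :=
  match t in term _ s return car M s with
  | Tvar i => e i
  | Tapp _ _ f t => fint f (fun i => eval e (t i))
  end.

Fixpoint sat L (M : structure L) (w : ctx (sorts L)) (p : fm w) : tup M w -> Prop :=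
  match p in fm w return tup M w -> Prop with
  | Feq _ _ t t' => fun e => eval e t = eval e t'
  | Frel _ _ r t => fun e => rint r (fun i => eval e (t i))
  | Fand _ p q => fun e => sat p e /\ sat q e
  | Fnot _ p => fun e => ~ sat p e
  | Fex _ s p => fun e => exists x : car M s, sat p (econs x e)
  end.

(** An inclusion of languages and the corresponding reduct. *)
Record lmap (L L' : lang) := LMap {
  lsort :> sorts L -> sorts L';
  lfunc : forall u s, fsym u s -> fsym (ctx_map lsort u) (lsort s);
  lrel : forall u, rsym u -> rsym (ctx_map lsort u) }.

Definition reduct L L' (h : lmap L L') (M : structure L') : structure L :=
  @Structure L (fun s => car M (h s))
    (fun u s f a => @fint _ M (ctx_map h u) (h s) (lfunc h f) a)
    (fun u r a => @rint _ M (ctx_map h u) (lrel h r) a).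

Definition lcomp L1 L2 L3 (h : lmap L1 L2) (k : lmap L2 L3) : lmap L1 L3 :=
  @LMap L1 L3 (fun s => k (h s))
    (fun u s f => @lfunc _ _ k (ctx_map h u) (h s) (lfunc h f))
    (fun u r => @lrel _ _ k (ctx_map h u) (lrel h r)).

(** New sorts, function symbols and relation symbols added to a language. *)
Record ext (L : lang) := Ext {
  xsort : Type;
  xfunc : ctx (sorts L + xsort) -> sorts L + xsort -> Type;
  xrel : ctx (sorts L + xsort) -> Type }.

Section Expand.
Context (L : lang) (X : ext L).

Inductive exp_func : ctx (sorts L + xsort X) -> sorts L + xsort X -> Type :=
| Efunc u s (f : fsym u s) : exp_func (ctx_map inl u) (inl s)
| Exfunc u s (f : xfunc u s) : exp_func u s.

Inductive exp_rel : ctx (sorts L + xsort X) -> Type :=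
| Erel u (r : rsym u) : exp_rel (ctx_map inl u)
| Exrel u (r : xrel u) : exp_rel u.

Definition expand : lang := @Lang (sorts L + xsort X) exp_func exp_rel.

Definition expand_incl : lmap L expand := @LMap L expand inl Efunc Erel.
End Expand.

(** * Elements and parameter sets *)

Definition elt L (M : structure L) : Type := {s : sorts L & car M s}.

Definition Elt L (M : structure L) s (x : car M s) : elt M := existT _ s x.

Definition coords L (M : structure L) (w : ctx (sorts L)) (a : tup M w) : set (elt M) :=
  range (fun i => Elt (a i)).

Definition red_elt L L' (h : lmap L L') (M : structure L') (x : elt (reduct h M)) : elt M :=
  @Elt _ M (h (projT1 x)) (projT2 x).

Definition func_closed L (M : structure L) (V : set (elt M)) : Prop :=
  forall u s (f : fsym u s) (a : tup M u), coords a `<=` V -> V (Elt (fint f a)).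

Definition generated L (M : structure L) (X : set (elt M)) : set (elt M) :=
  smallest (@func_closed L M) X.

Definition dcl L (M : structure L) (P : set (elt M)) : set (elt M) :=
  [set x | exists w (c : tup M w) (p : fm (ctx_cons (projT1 x) w)),
     coords c `<=` P /\ forall y, sat p (econs y c) <-> y = projT2 x].

Definition acl L (M : structure L) (P : set (elt M)) : set (elt M) :=
  [set x | exists w (c : tup M w) (p : fm (ctx_cons (projT1 x) w)),
     [/\ coords c `<=` P, sat p (econs (projT2 x) c) &
         finite_set [set y | sat p (econs y c)]]].

(** * Types and dividing *)

(* A formula in the variables [w], with the parameters [ppar] substituted for
   the variables [pvar]. *)
Record pfm L (M : structure L) (w : ctx (sorts L)) := Pfm {
  pvar : ctx (sorts L);
  pfml : fm (ctx_cat w pvar);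
  ppar : tup M pvar }.
Arguments ppar {L M w} p.

Definition psat L (M : structure L) (w : ctx (sorts L)) (p : pfm M w) (x : tup M w) :=
  sat (pfml p) (ecat x (ppar p)).

Definition pover L (M : structure L) (P : set (elt M)) (w : ctx (sorts L)) (p : pfm M w) :=
  coords (ppar p) `<=` P.

Definition tp L (M : structure L) (w : ctx (sorts L)) (u : tup M w) (P : set (elt M)) :
    set (pfm M w) :=
  [set p | pover P p /\ psat p u].

(* Consistency with the elementary diagram of [M]. *)
Definition consistent L (M : structure L) (w : ctx (sorts L)) (q : set (pfm M w)) : Prop :=
  forall n (p : 'I_n -> pfm M w), (forall i, q (p i)) ->
  exists x, forall i, psat (p i) x.

(* Implication modulo the elementary diagram of [M]. *)
Definition entails L (M : structure L) (w : ctx (sorts L)) (q : set (pfm M w)) (r : pfm M w) :=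
  exists n (p : 'I_n -> pfm M w),
    (forall i, q (p i)) /\ forall x, (forall i, psat (p i) x) -> psat r x.

Definition indiscernible L (M : structure L) (P : set (elt M)) (w : ctx (sorts L))
    (b : nat -> tup M w) : Prop :=
  forall n v (p : fm (ctx_cat (ctx_pow w n) v)) (c : tup M v), coords c `<=` P ->
  forall i j : nat -> nat, {homo i : x y / (x < y)%N} -> {homo j : x y / (x < y)%N} ->
    sat p (ecat (@epow _ (car M) w (b \o i) n) c) <-> sat p (ecat (@epow _ (car M) w (b \o j) n) c).

(* The terms of an indiscernible sequence over [P] all have the same type over
   [P], so those of [b] are conjugates of [b 0] over [P]. *)
Definition fm_divides L (M : structure L) (P : set (elt M)) (w : ctx (sorts L)) (p : pfm M w) :=
  exists b : nat -> tup M (pvar p),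
    [/\ b 0 = ppar p, indiscernible P b &
        ~ consistent (range (fun k => Pfm (pfml p) (b k)))].

Definition tp_divides L (M : structure L) (P : set (elt M)) (w : ctx (sorts L))
    (q : set (pfm M w)) :=
  exists p, entails q p /\ fm_divides P p.

(* Dividing over [P] of the type over [Q] of a possibly infinite set [U]: a
   formula implied by tp(U/Q), and the finitely many formulas of tp(U/Q) that
   imply it, only involve the variables of some finite tuple of [U]. *)
Definition set_tp_divides L (M : structure L) (U Q P : set (elt M)) :=
  exists w (u : tup M w), coords u `<=` U /\ tp_divides P (tp u Q).

(** * Saturation and homogeneity

   |K|^+-saturation and strong |K|^+-homogeneity: a set has cardinality less
   than |K|^+ when it injects into K.  Parameter sets consist of real elements. *)

Definition succ_saturated T (K : set T) L (M : structure L) : Prop :=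
  forall (P : set (elt M)), (P #<= K)%card ->
  forall w (q : set (pfm M w)), q `<=` @pover _ M P w -> consistent q ->
  exists x, forall p, q p -> psat p x.

Definition automorphism L (M : structure L) (f : forall s, car M s -> car M s) : Prop :=
  [/\ forall s, bijective (f s),
      forall u s (g : fsym u s) (a : tup M u), f s (fint g a) = fint g (emap f a) &
      forall u (r : rsym u) (a : tup M u), rint r (emap f a) <-> rint r a].

(* Elementarity of the partial map obtained by restricting [f] to [P]. *)
Definition elementary_on L (M : structure L) (P : set (elt M))
    (f : forall s, car M s -> car M s) : Prop :=
  forall w (a : tup M w) (p : fm w), coords a `<=` P ->
    sat p (emap f a) <-> sat p a.

Definition succ_strongly_homogeneous T (K : set T) L (M : structure L) : Prop :=
  forall (P : set (elt M)) (f : forall s, car M s -> car M s), (P #<= K)%card ->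
  elementary_on P f ->
  exists g, automorphism g /\ forall s (x : car M s), P (Elt x) -> g s x = f s x.

(** * Imaginaries *)

(* A 0-definable equivalence relation on a product of sorts.  It is identified
   with its graph: two formulas defining the same relation give one sort. *)
Record eqrel L (M : structure L) := EqRel {
  eqctx : ctx (sorts L);
  eqr :> tup M eqctx -> tup M eqctx -> Prop;
  eqr_refl : forall x, eqr x x;
  eqr_sym : forall x y, eqr x y -> eqr y x;
  eqr_trans : forall x y z, eqr x y -> eqr y z -> eqr x z;
  eqr_def : exists p : fm (ctx_cat eqctx eqctx), forall x y, eqr x y <-> sat p (ecat x y) }.

Definition eqclass L (M : structure L) (E : eqrel M) : Type :=
  {X : set (tup M (eqctx E)) | exists x, X = [set y | E x y]}.

Definition class_of L (M : structure L) (E : eqrel M) (x : tup M (eqctx E)) : eqclass E :=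
  exist _ [set y | E x y] (ex_intro _ x erefl).

Inductive proj_func L (M : structure L) :
    ctx (sorts L + eqrel M) -> sorts L + eqrel M -> Type :=
| Proj (E : eqrel M) : proj_func (ctx_map inl (eqctx E)) (inr E).

(* The language of M^eq: the real sorts, and one sort and one projection for
   each 0-definable equivalence relation. *)
Definition Leq L (M : structure L) : lang :=
  expand (@Ext L (eqrel M) (@proj_func L M) (fun _ => void)).

Definition eq_car L (M : structure L) (s : sorts (Leq M)) : Type :=
  match s with inl s => car M s | inr E => eqclass E end.

Definition proj_int L (M : structure L) u s (f : proj_func u s) :
    env (@eq_car L M) u -> eq_car s :=
  match f in proj_func u s return env (@eq_car L M) u -> eq_car s with
  | Proj E => fun a => class_of a
  end.

Definition eq_fint L (M : structure L) u s (f : @fsym (Leq M) u s) :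
    env (@eq_car L M) u -> eq_car s :=
  match f in exp_func u s return env (@eq_car L M) u -> eq_car s with
  | Efunc u s f => fun a => @fint _ M u s f a
  | Exfunc _ _ f => fun a => proj_int f a
  end.

Definition eq_rint L (M : structure L) u (r : @rsym (Leq M) u) :
    env (@eq_car L M) u -> Prop :=
  match r in exp_rel u return env (@eq_car L M) u -> Prop with
  | Erel u r => fun a => @rint _ M u r a
  | Exrel _ r => match r with end
  end.

Definition Meq L (M : structure L) : structure (Leq M) :=
  @Structure (Leq M) (@eq_car L M) (@eq_fint L M) (@eq_rint L M).

Definition real_elt L (M : structure L) (x : elt M) : elt (Meq M) :=
  @Elt _ (Meq M) (inl (projT1 x)) (projT2 x).

(** * Abelian structures *)

(* A language with distinguished symbols for a group law on each sort. *)
Record ablang := AbLang {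
  ab_lang :> lang;
  sy_add : forall s : sorts ab_lang, fsym (ctx_const (ShU Sh1 Sh1) s) s;
  sy_zero : forall s : sorts ab_lang, fsym (ctx_const Sh0 s) s;
  sy_opp : forall s : sorts ab_lang, fsym (ctx_const Sh1 s) s }.

Definition gadd (L : ablang) (M : structure L) s (x y : car M s) : car M s :=
  fint (sy_add s) (fun p => match p with inl _ => x | inr _ => y end).

Definition gzero (L : ablang) (M : structure L) s : car M s :=
  fint (sy_zero s) (fun p : void => match p with end).

Definition gopp (L : ablang) (M : structure L) s (x : car M s) : car M s :=
  fint (sy_opp s) (fun _ => x).

Definition eadd (L : ablang) (M : structure L) w (a b : tup M w) : tup M w :=
  fun i => gadd (a i) (b i).
Definition ezero (L : ablang) (M : structure L) w : tup M w :=
  fun i => gzero M (w i).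
Arguments ezero {L} M w.
Definition eopp (L : ablang) (M : structure L) w (a : tup M w) : tup M w :=
  fun i => gopp (a i).
Definition esub (L : ablang) (M : structure L) w (a b : tup M w) : tup M w :=
  eadd a (eopp b).

Fixpoint pp L (w : ctx (sorts L)) (p : fm w) : bool :=
  match p with
  | Feq _ _ _ _ | Frel _ _ _ _ => true
  | Fand _ p q => pp p && pp q
  | Fnot _ _ => false
  | Fex _ _ p => pp p
  end.

Record ppfm (L : lang) := PPfm {
  pp_ctx : ctx (sorts L);
  pp_fm :> fm pp_ctx;
  pp_fmP : pp pp_fm }.

Record abelian (L : ablang) (M : structure L) : Prop := Abelian {
  ab_addA : forall s, associative (@gadd L M s);
  ab_addC : forall s, commutative (@gadd L M s);
  ab_add0 : forall s, left_id (gzero M s) (@gadd L M s);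
  ab_addN : forall s, left_inverse (gzero M s) (@gopp L M s) (@gadd L M s);
  ab_term : forall w s (t : term w s) (a b : tup M w),
    eval (eadd a b) t = gadd (eval a t) (eval b t);
  ab_pp0 : forall p : ppfm L, sat p (ezero M (pp_ctx p));
  ab_ppB : forall (p : ppfm L) (a b : tup M (pp_ctx p)),
    sat p a -> sat p b -> sat p (esub a b) }.

Definition fundamental_system (L : ablang) (Phi : set (ppfm L)) (B : structure L) : Prop :=
  forall q : ppfm L,
  exists n (p : 'I_n -> ppfm L)
    (t : forall i (j : pos (shp (pp_ctx (p i)))), term (pp_ctx q) (pp_ctx (p i) j)),
    (forall i, Phi (p i)) /\
    forall x : tup B (pp_ctx q),
      sat q x <-> forall i, sat (p i) (fun j => eval x (t i j)).

(** * Expanded pure short exact sequences *)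

Inductive quo_func (L : ablang) (Phi : set (ppfm L)) :
    ctx (sorts L + {p | Phi p}) -> sorts L + {p | Phi p} -> Type :=
| SyPi (p : {p | Phi p}) : quo_func (ctx_map inl (pp_ctx (sval p))) (inr p).

(* The language of A together with the sorts A/phi(A) and the quotient maps. *)
Definition quo_ext (L : ablang) (Phi : set (ppfm L)) : ext L :=
  @Ext L {p | Phi p} (@quo_func L Phi) (fun _ => void).
Definition Lquo (L : ablang) (Phi : set (ppfm L)) : lang := expand (quo_ext Phi).

Section Sequence.
(* [XA] and [XC] are the arbitrary additional symbols, and possibly new sorts,
   of A^* and C^*. *)
Context (L : ablang) (Phi : set (ppfm L)) (XA : ext (Lquo Phi)) (XC : ext L).

Definition LA : lang := expand XA.
Definition LC : lang := expand XC.

Definition sort_A (s : sorts L) : sorts LA := inl (inl s).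
Definition sort_quo (p : {p | Phi p}) : sorts LA := inl (inr p).
Definition sort_C (s : sorts L) : sorts LC := inl s.

Inductive seq_sort := InA of sorts LA | InB of sorts L | InC of sorts LC.

Inductive seq_func : ctx seq_sort -> seq_sort -> Type :=
| FA u s (f : @fsym LA u s) : seq_func (ctx_map InA u) (InA s)
| FB u s (f : @fsym L u s) : seq_func (ctx_map InB u) (InB s)
| FC u s (f : @fsym LC u s) : seq_func (ctx_map InC u) (InC s)
| SyIota s : seq_func (ctx_const Sh1 (InA (sort_A s))) (InB s)
| SyNu s : seq_func (ctx_const Sh1 (InB s)) (InC (sort_C s))
| SyRho p : seq_func (ctx_map InB (pp_ctx (sval p))) (InA (sort_quo p)).

Inductive seq_rel : ctx seq_sort -> Type :=
| RA u (r : @rsym LA u) : seq_rel (ctx_map InA u)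
| RB u (r : @rsym L u) : seq_rel (ctx_map InB u)
| RC u (r : @rsym LC u) : seq_rel (ctx_map InC u).

Definition Lseq : lang := Lang seq_func seq_rel.

Definition inclA : lmap LA Lseq := @LMap LA Lseq InA FA RA.
Definition inclB : lmap L Lseq := @LMap L Lseq InB FB RB.
Definition inclC : lmap LC Lseq := @LMap LC Lseq InC FC RC.
Definition inclA0 : lmap L LA := lcomp (expand_incl _) (expand_incl XA).
Definition inclC0 : lmap L LC := expand_incl XC.

Context (M : structure Lseq).

Definition strA' : structure LA := reduct inclA M.
Definition strC' : structure LC := reduct inclC M.
Definition strA : structure L := reduct (lcomp inclA0 inclA) M.
Definition strB : structure L := reduct inclB M.
Definition strC : structure L := reduct (lcomp inclC0 inclC) M.

Definition iota_map s (a : car strA s) : car strB s :=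
  @fint _ M _ _ (SyIota s) (fun _ => a).
Definition nu_map s (b : car strB s) : car strC s :=
  @fint _ M _ _ (SyNu s) (fun _ => b).
Definition pi_map (p : {p | Phi p}) (a : tup strA (pp_ctx (sval p))) :
    car strA' (sort_quo p) :=
  @fint _ strA' (ctx_map sort_A (pp_ctx (sval p))) _
    (@Efunc _ XA (ctx_map inl (pp_ctx (sval p))) _ (@Exfunc _ (quo_ext Phi) _ _ (SyPi p))) a.
Definition rho_map (p : {p | Phi p}) (b : tup strB (pp_ctx (sval p))) :
    car strA' (sort_quo p) :=
  @fint _ M _ _ (SyRho p) b.

(* [b] belongs to phi(B) + iota(A). *)
Definition in_pp_iota w (p : fm w) (b : tup strB w) : Prop :=
  exists b0 (a : tup strA w), sat p b0 /\ b = eadd b0 (emap iota_map a).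

Record expanded_pure_ses : Prop := ExpandedPureSES {
  ses_abA : abelian strA;
  ses_abB : abelian strB;
  ses_abC : abelian strC;
  ses_iota_inj : forall s, injective (@iota_map s);
  ses_iota_fun : forall u s (f : fsym u s) (a : tup strA u),
    iota_map (fint f a) = fint f (emap iota_map a);
  ses_iota_rel : forall u (r : rsym u) (a : tup strA u),
    rint r (emap iota_map a) <-> rint r a;
  ses_iota_pure : forall (p : ppfm L) (a : tup strA (pp_ctx p)),
    sat p (emap iota_map a) <-> sat p a;
  ses_nu_fun : forall u s (f : fsym u s) (b : tup strB u),
    nu_map (fint f b) = fint f (emap nu_map b);
  ses_nu_rel : forall u (r : rsym u) (b : tup strB u),
    rint r b -> rint r (emap nu_map b);
  ses_nu_surj : forall s (c : car strC s), exists b, nu_map b = c;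
  ses_exact : forall s (b : car strB s), (exists a, iota_map a = b) <-> nu_map b = gzero strC s;
  ses_nu_pp : forall (p : ppfm L) (b : tup strB (pp_ctx p)),
    sat p (emap nu_map b) <-> in_pp_iota p b;
  (* the sort [sort_quo p], with [pi_map p], is the quotient A/phi(A) *)
  ses_pi_surj : forall p (q : car strA' (sort_quo p)), exists a, pi_map a = q;
  ses_pi_ker : forall p (a a' : tup strA (pp_ctx (sval p))),
    @pi_map p a = pi_map a' <-> sat (sval p) (esub a a');
  ses_rho_in : forall p (b : tup strB (pp_ctx (sval p))) a,
    sat (sval p) b -> @rho_map p (eadd b (emap iota_map a)) = pi_map a;
  ses_rho_out : forall p (b : tup strB (pp_ctx (sval p))),
    ~ in_pp_iota (sval p) b -> @rho_map p b = pi_map (ezero strA (pp_ctx (sval p))) }.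

(** The sets A^*(D), B(D), C^*(D), for a set D of elements of M^eq. *)
Definition part L0 (h : lmap L0 Lseq) (D : set (elt (Meq M))) : set (elt (reduct h M)) :=
  [set x | D (real_elt (red_elt x))].

Definition partA (D : set (elt (Meq M))) : set (elt strA') := @part LA inclA D.
Definition partB (D : set (elt (Meq M))) : set (elt strB) := @part L inclB D.
Definition partC (D : set (elt (Meq M))) : set (elt strC') := @part LC inclC D.

Definition parts (D : set (elt (Meq M))) : set (elt M) :=
  (@red_elt _ _ inclA M @` partA D) `|` (@red_elt _ _ inclB M @` partB D)
    `|` (@red_elt _ _ inclC M @` partC D).
End Sequence.

(** * The sorts C/phi(C) of M^eq *)

Fixpoint tsub L (w w' : ctx (sorts L)) (t : forall i : pos (shp w), term w' (w i)) s
    (r : term w s) : term w' s :=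
  match r in term _ s return term w' s with
  | Tvar i => t i
  | Tapp _ _ f r => Tapp f (fun i => tsub t (r i))
  end.

Fixpoint tinst L L' (h : lmap L L') (w : ctx (sorts L)) (w' : ctx (sorts L'))
    (t : forall i : pos (shp w), term w' (h (w i))) s (r : term w s) : term w' (h s) :=
  match r in term _ s return term w' (h s) with
  | Tvar i => t i
  | Tapp u s f r => @Tapp _ _ (ctx_map h u) _ (lfunc h f) (fun i => tinst t (r i))
  end.

Lemma eval_tsub L (M : structure L) w w' (t : forall i : pos (shp w), term w' (w i)) s
    (r : term w s) (e : tup M w') :
  eval e (tsub t r) = eval (fun i => eval e (t i)) r.
Proof.
elim: r => //= u s0 f r IH; congr (fint f _).
by apply: functional_extensionality_dep => i; exact: IH.
Qed.

Lemma eval_tinst L L' (h : lmap L L') (M : structure L') w w'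
    (t : forall i : pos (shp w), term w' (h (w i))) s (r : term w s) (e : tup M w') :
  eval e (tinst t r) = @eval _ (reduct h M) w (fun i => eval e (t i)) s r.
Proof.
elim: r => //= u s0 f r IH; congr (fint _ _).
by apply: functional_extensionality_dep => i; exact: IH.
Qed.

(* Preimages under tuples of terms of a set definable in a reduct of M are
   definable in M. *)
Lemma definable_inst L L' (h : lmap L L') (M : structure L') w (p : fm w) :
  forall w' (t : forall i : pos (shp w), term w' (h (w i))),
  exists q : fm w', forall e : tup M w',
    sat q e <-> @sat _ (reduct h M) w p (fun i => eval e (t i)).
Proof.
elim: p => {w} [w s r r'|w u r a|w p IHp q IHq|w p IHp|w s p IHp] w' t.
- by exists (Feq (tinst t r) (tinst t r')) => e /=; rewrite !eval_tinst.
- exists (@Frel _ w' (ctx_map h u) (lrel h r) (fun i => tinst t (a i))) => e /=.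
  suff -> : (fun i => eval e (tinst t (a i))) =
            (fun i => @eval _ (reduct h M) w (fun i => eval e (t i)) _ (a i)) by [].
  by apply: functional_extensionality_dep => i; exact: eval_tinst.
- by have [[p' Hp] [q' Hq]] := (IHp w' t, IHq w' t); exists (Fand p' q') => e /=;
    rewrite Hp Hq.
- by have [p' Hp] := IHp w' t; exists (Fnot p') => e /=; rewrite Hp.
- pose w1 := ctx_cons (h s) w'.
  pose wk (i : pos (shp w')) : term w1 (w' i) := @Tvar _ w1 (inr i).
  pose t1 (i : pos (shp (ctx_cons s w))) : term w1 (h (ctx_cons s w i)) :=
    match i return term w1 (h (ctx_cons s w i)) with
    | inl k => @Tvar _ w1 (inl k)
    | inr j => tsub wk (t j)
    end.
  have [p' Hp] := IHp w1 t1; exists (Fex p') => e /=.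
  suff E (x : car M (h s)) : (fun i => eval (econs x e) (t1 i)) =
      @econs _ (car (reduct h M)) s w x (fun i => eval e (t i)).
    split=> -[x]; first by rewrite Hp E => Hx; exists x.
    by rewrite -E => Hx; exists x; rewrite Hp.
  apply: functional_extensionality_dep => -[k|j] //=.
  by rewrite eval_tsub.
Qed.

Section Cosets.
Context (L : ablang) (L' : lang) (h : lmap L L') (M : structure L').
Context (abM : abelian (reduct h M)) (p : ppfm L).

Let N := reduct h M.
Let w := pp_ctx p.

Definition same_coset (x y : tup N w) : Prop := sat p (esub x y).

Let esubK (x y z : tup N w) : esub (esub x y) (esub z y) = esub x z.
Proof.
have [aA aC a0 aN _ _ _] := abM.
apply: functional_extensionality_dep => i; rewrite /esub /eadd /eopp.
have ar s (a : car N s) : gadd a (gzero N s) = a by rewrite aC a0.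
have an s (a : car N s) : gadd a (gopp a) = gzero N s by rewrite aC aN.
have uniq s (a b : car N s) : gadd a b = gzero N s -> b = gopp a.
  by move=> ab; rewrite -[LHS]a0 -(aN _ a) -aA ab ar.
have -> : gopp (gadd (z i) (gopp (y i))) = gadd (y i) (gopp (z i)).
  by symmetry; apply: uniq; rewrite -aA (aA _ (gopp (y i))) aN a0 an.
by rewrite -aA (aA _ (gopp (y i))) aN a0.
Qed.

Lemma same_coset_refl x : same_coset x x.
Proof.
have [_ aC _ aN _ p0 _] := abM; rewrite /same_coset.
suff -> : esub x x = ezero N w by exact: p0.
by apply: functional_extensionality_dep => i; rewrite /esub /eadd /eopp aC aN.
Qed.

Lemma same_coset_sym x y : same_coset x y -> same_coset y x.
Proof.
move=> xy; rewrite /same_coset -(esubK y y x).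
exact: (ab_ppB abM (same_coset_refl y) xy).
Qed.

Lemma same_coset_trans x y z : same_coset x y -> same_coset y z -> same_coset x z.
Proof.
move=> xy /same_coset_sym zy; rewrite /same_coset -(esubK x y z).
exact: (ab_ppB abM xy zy).
Qed.

Lemma same_coset_def :
  exists q : fm (ctx_cat (ctx_map h w) (ctx_map h w)),
  forall x y : tup M (ctx_map h w), same_coset x y <-> sat q (ecat x y).
Proof.
pose ww := ctx_cat (ctx_map h w) (ctx_map h w).
pose v (i : pos (shp w)) : term ww (h (w i)) := @Tvar _ ww (inl i).
pose v' (i : pos (shp w)) : term ww (h (w i)) := @Tvar _ ww (inr i).
pose no (i : pos (shp w)) : term ww (h (w i)) :=
  @Tapp _ ww (ctx_map h (ctx_const Sh1 (w i))) _ (lfunc h (sy_opp (w i))) (fun _ => v' i).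
pose t (i : pos (shp w)) : term ww (h (w i)) :=
  @Tapp _ ww (ctx_map h (ctx_const (ShU Sh1 Sh1) (w i))) _ (lfunc h (sy_add (w i)))
    (fun k => match k with inl _ => v i | inr _ => no i end).
have [q Hq] := definable_inst M p t; exists q => x y; rewrite Hq /same_coset.
suff -> : (fun i => eval (ecat x y) (t i)) = @esub _ N w x y by [].
apply: functional_extensionality_dep => i /=.
rewrite /esub /eadd /gadd /=; congr (fint _ _).
by apply: functional_extensionality_dep => -[k|k].
Qed.

Definition coset_rel : eqrel M :=
  @EqRel _ M (ctx_map h w) same_coset
    same_coset_refl same_coset_sym same_coset_trans same_coset_def.
End Cosets.

(* The equivalence relation whose sort in M^eq is C/phi(C). *)
Definition C_coset (L : ablang) (Phi : set (ppfm L)) (XA : ext (Lquo Phi)) (XC : ext L)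
    (M : structure (Lseq XA XC)) (HM : expanded_pure_ses M) (p : ppfm L) : eqrel M :=
  @coset_rel L _ (lcomp (inclC0 XC) (inclC XA XC)) M (ses_abC HM) p.

(* Main.v *)
Require Import Defs.
From Stdlib Require List.
From mathcomp Require Import all_boot.
From mathcomp Require Import boolp classical_sets functions cardinality filter.
Set Implicit Arguments.
Unset Strict Implicit.
Unset Printing Implicit Defensive.
Local Open Scope classical_set_scope.
Local Open Scope card_scope.

(* Quantifier elimination: a formula of M is a finite disjunction of conjunctions of an
   A^*-formula in the A^*-variables and the terms rho_phi(t(x_B)), and of a C^*-formula in the
   C^*-variables and nu(x_B).  Hence the structure induced on A^* and C^* by Gamma is the one
   given by A^*(Gamma) and C^*(Gamma), and a dividing formula of A^* or C^* divides in M.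

   Conversely, a formula implied by tp(U/Delta) that divides yields a Gamma-indiscernible
   sequence (d_k) of real tuples starting in Delta and a formula P(x, d_0) of the type such that
   the P(x, d_k) are inconsistent.  Eliminate quantifiers in P.  If nu t(u, d_0) lies in
   phi(C), with t(x, y) = t_1(x) + t_2(y), then the coset of nu t_1(u) is also that of
   - nu t_2(d_0); as the type in C^* does not divide, this coset is algebraic over Gamma, so
   that it contains nu(beta) for some beta in B(Gamma), and
   rho t(u, d_0) = rho(t_1(u) - beta) + rho(beta + t_2(d_0)).  Thus P(x, d_k) follows from a
   formula of A^* and a formula of C^* with parameters forming indiscernible sequences, plus the
   relation between rho(t_1(x_B) - beta) and nu(x_B), which splits by quantifier elimination
   again.  Since neither type divides, the two families are consistent, a contradiction. *)

(** * Definability *)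

(** The map [rho] is additive only on phi(B)+iota(A), so a value rho t(x, d) ties variables to
    parameters, and only a representative over Gamma unties them. Lying in Gamma serves three times:
    rho(t_1(u) - beta) has to belong to A^*(U), rho(beta + t_2(d_0)) to A^*(Delta), and translating
    by beta has to keep the parameter sequences indiscernible over Gamma. The solutions in A^* and
    in C^* come from two independent hypotheses; the condition for gluing them into one element of B
    involves beta but not d_k, so one gluing serves all k.

    A dividing formula of M^eq may have imaginary parameters e_k, while quantifier elimination
    speaks of real tuples. Real d_k are first chosen with P(x, d_k) implying the formula at e_k, and
    only then made indiscernible. Compactness and extraction add countably many parameters to Gamma;
    this stays within the size of Delta because a definably closed subset of M^eq is infinite.
    Formulas are handled as predicates up to equivalence, which spares the syntax of connectives and
    substitutions. *)

Notation fext := functional_extensionality_dep.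

Section Tuples.
Context (S : Type).

Definition lpart (car : S -> Type) (w v : ctx S) (e : env car (ctx_cat w v)) : env car w :=
  fun i => e (inl i).
Definition rpart (car : S -> Type) (w v : ctx S) (e : env car (ctx_cat w v)) : env car v :=
  fun i => e (inr i).

Lemma ecat_parts (car : S -> Type) (w v : ctx S) (e : env car (ctx_cat w v)) :
  ecat (lpart e) (rpart e) = e.
Proof. by apply: fext => -[]. Qed.

Lemma emap_ecat (car car' : S -> Type) (f : forall s, car s -> car' s) (w v : ctx S)
    (a : env car w) (b : env car v) : emap f (ecat a b) = ecat (emap f a) (emap f b).
Proof. by apply: fext => -[]. Qed.

(** A position of [w] with its sort as an index: renaming variables between contexts then needs no
    cast along an equality of sorts. *)
Inductive varof (w : ctx S) : S -> Type := Var i : varof w (w i).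

Definition vget (car : S -> Type) (w : ctx S) (e : env car w) s (x : varof w s) : car s :=
  match x in varof _ s return car s with Var i => e i end.

Definition vmap (w v : ctx S) (h : forall i, varof v (w i)) s (x : varof w s) : varof v s :=
  match x in varof _ s return varof v s with Var i => h i end.

Lemma vget_vmap (car : S -> Type) (w v : ctx S) (h : forall i, varof v (w i)) s
    (x : varof w s) (e : env car v) :
  vget e (vmap h x) = vget (fun i => vget e (h i)) x.
Proof. by case: x. Qed.

(** Packs the contexts [W j] into one, with variables [x j k] chosen before the tuples, so that one
    quantifier block can range over a whole family. The last clause says that the packed tuple has
    no coordinate from elsewhere, which keeps it inside a given parameter set. *)
Lemma family_ctx (a : ishape) (W : pos a -> ctx S) :
  exists (V : ctx S) (x : forall j k, varof V (W j k)),
  forall (car : S -> Type) (fam : forall j, env car (W j)), exists e : env car V,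
    (forall j k, vget e (x j k) = fam j k) /\
    (forall i, exists j k, existT car (V i) (e i) = existT car (W j k) (fam j k)).
Proof.
elim: a W => [||b IHb c IHc] W.
- exists (@Ctx S Sh0 (fun i : void => match i with end)), (fun j : void => match j with end).
  by move=> car fam; exists (fun i : void => match i with end); split=> -[].
- exists (W tt), (fun j => match j return forall k, varof (W tt) (W j k) with tt => fun k => Var (w := W tt) k end).
  by move=> car fam; exists (fam tt); split=> [[] k|i] //; exists tt, i.
- have [V1 [x1 H1]] := IHb (fun j => W (inl j)).
  have [V2 [x2 H2]] := IHc (fun j => W (inr j)).
  exists (ctx_cat V1 V2), (fun j => match j return forall k, varof (ctx_cat V1 V2) (W j k) with
    | inl j => fun k => vmap (fun i => Var (w := ctx_cat V1 V2) (inl i)) (x1 j k)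
    | inr j => fun k => vmap (fun i => Var (w := ctx_cat V1 V2) (inr i)) (x2 j k) end).
  move=> car fam; have [e1 [E1 F1]] := H1 car (fun j => fam (inl j)).
  have [e2 [E2 F2]] := H2 car (fun j => fam (inr j)).
  exists (ecat e1 e2); split=> [[j|j] k|[i|i]].
  + by rewrite vget_vmap -E1.
  + by rewrite vget_vmap -E2.
  + by have [j [k E]] := F1 i; exists (inl j), k.
  + by have [j [k E]] := F2 i; exists (inr j), k.
Qed.

End Tuples.

Section Formulas.
Context (L : lang).

Definition tvar (w : ctx (sorts L)) s (x : varof w s) : term w s :=
  match x in varof _ s return term w s with Var i => Tvar i end.

Lemma eval_tvar (N : structure L) w s (x : varof w s) (e : tup N w) :
  eval e (tvar x) = vget e x.
Proof. by case: x. Qed.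

(** The formula [q] is chosen before the structure [N]: later a single p.p.-formula has to be read
    both in B and in C. *)
Lemma fm_subst w (p : fm w) w' (t : forall i : pos (shp w), @term L w' (w i)) :
  exists q : fm w', pp q = pp p /\
    forall (N : structure L) e, sat (M := N) q e <-> sat p (fun i => eval e (t i)).
Proof.
elim: p w' t => {w} [w s r r'|w u r a|w p IHp q IHq|w p IHp|w s p IHp] w' t.
- by exists (Feq (tsub t r) (tsub t r')); split=> //= N e; rewrite !eval_tsub.
- exists (Frel r (fun i => tsub t (a i))); split=> //= N e.
  suff -> : (fun i => eval e (tsub t (a i))) =
            (fun i => eval (fun i => eval e (t i)) (a i)) by [].
  by apply: fext => i; exact: eval_tsub.
- have [[p' [Pp Hp]] [q' [Pq Hq]]] := (IHp w' t, IHq w' t).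
  by exists (Fand p' q'); split=> [|N e] /=; rewrite ?Pp ?Pq ?Hp ?Hq.
- by have [p' [Pp Hp]] := IHp w' t; exists (Fnot p'); split=> // N e /=; rewrite Hp.
- pose w1 := ctx_cons s w'.
  pose wk (i : pos (shp w')) : term w1 (w' i) := @Tvar _ w1 (inr i).
  pose t1 (i : pos (shp (ctx_cons s w))) : term w1 (ctx_cons s w i) :=
    match i return term w1 (ctx_cons s w i) with
    | inl k => @Tvar _ w1 (inl k)
    | inr j => tsub wk (t j)
    end.
  have [p' [Pp Hp]] := IHp w1 t1; exists (Fex p'); split=> // N e /=.
  suff E (x : car N s) : (fun i => eval (econs x e) (t1 i)) =
      econs x (fun i => eval e (t i)).
    split=> -[x]; first by rewrite Hp E => Hx; exists x.
    by rewrite -E => Hx; exists x; rewrite Hp.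
  by apply: fext => -[k|j] //=; rewrite eval_tsub.
Qed.

Lemma fm_exs v w (p : @fm L (ctx_cat v w)) :
  exists q : fm w, pp q = pp p /\
    forall (N : structure L) e, sat (M := N) q e <-> exists y : tup N v, sat p (ecat y e).
Proof.
case: v p => a; elim: a w => [||b IHb c IHc] w f p.
- have [q [Pq Hq]] := fm_subst p (w' := w)
    (fun i => match i with inl k => match k with end | inr k => Tvar k end).
  exists q; split=> // N e; rewrite Hq; split=> [H|[y H]].
    exists (fun k : void => match k with end); move: H; congr (sat p _).
    by apply: fext => -[[]|i].
  by move: H; congr (sat p _); apply: fext => -[[]|i].
- have [q [Pq Hq]] := fm_subst p (w' := ctx_cons (f tt) w)
    (fun i => match i with inl tt => @Tvar _ (ctx_cons (f tt) w) (inl tt)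
              | inr k => @Tvar _ (ctx_cons (f tt) w) (inr k) end).
  exists (Fex q); split=> //= N e; split=> [[x]|[y H]].
    rewrite Hq => H; exists (fun i : unit => match i with tt => x end).
    by move: H; congr (sat p _); apply: fext => -[[]|i].
  exists (y tt); rewrite Hq; move: H; congr (sat p _).
  by apply: fext => -[[]|i].
- pose v1 := Ctx (shp := b) (fun i => f (inl i)).
  pose v2 := Ctx (shp := c) (fun i => f (inr i)).
  have [q [Pq Hq]] := fm_subst p (w' := ctx_cat v1 (ctx_cat v2 w))
    (fun i => match i with
     | inl (inl k) => @Tvar _ (ctx_cat v1 (ctx_cat v2 w)) (inl k)
     | inl (inr k) => @Tvar _ (ctx_cat v1 (ctx_cat v2 w)) (inr (inl k))
     | inr k => @Tvar _ (ctx_cat v1 (ctx_cat v2 w)) (inr (inr k)) end).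
  have [q1 [Pq1 Hq1]] := IHb _ _ q; have [q2 [Pq2 Hq2]] := IHc _ _ q1.
  exists q2; split=> [|N e]; first by rewrite Pq2 Pq1.
  rewrite Hq2; split=> [[y2]|[y H]].
    rewrite Hq1 => -[y1]; rewrite Hq => H.
    exists (fun i => match i with inl k => y1 k | inr k => y2 k end).
    by move: H; congr (sat p _); apply: fext => -[[i|i]|i].
  exists (fun i => y (inr i)); rewrite Hq1; exists (fun i => y (inl i)).
  by rewrite Hq; move: H; congr (sat p _); apply: fext => -[[i|i]|i].
Qed.

(** A language without sorts may have no formula at all. Any given formula excludes this, by
    yielding a sort or a relation symbol without arguments; in the end the dividing formula supplies
    it. *)
Lemma fm_inhabited w w' : @fm L w -> inhabited (@fm L w').
Proof.
have [[s _]|nos] := pselect (exists s : sorts L, True).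
  by move=> _; constructor; apply: (@Fex _ _ s);
    apply: (Feq (@Tvar _ (ctx_cons s w') (inl tt)) (@Tvar _ (ctx_cons s w') (inl tt))).
have nos' (s : sorts L) : False by apply: nos; exists s.
elim=> [v s|v u r _|//|//|v s]; do ?by case: (nos' s).
by constructor; apply: (Frel r) => i; case: (nos' (u i)).
Qed.

End Formulas.

Definition term_fun L (M : structure L) w s (f : tup M w -> car M s) : Prop :=
  exists t : term w s, forall e, f e = eval e t.

(* Solves a goal [term_fun (fun e => e _)], for a variable that is obtained from
   the position [p] of a factor of the context. *)
Ltac variable_path p n :=
  first [ match goal with |- @term_fun ?L _ ?w _ _ => by exists (@Tvar L w p) end
        | match n with S ?m =>
            first [ let q := uconstr:(inl p) in variable_path q m
                  | let q := uconstr:(inr p) in variable_path q m ] end ].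
Ltac variable := let i := fresh "i" in move=> i; variable_path i 5.

Section Definability.
Context (L : lang) (M : structure L).

(* The second case is not superfluous: a language with no sorts and no 0-ary
   relations has no formulas at all. *)
Definition dfn w (P : tup M w -> Prop) : Prop :=
  (exists p : fm w, forall e, sat p e <-> P e) \/ (exists b : Prop, forall e, P e <-> b).

Lemma dfn_ext w (P Q : tup M w -> Prop) : (forall e, P e <-> Q e) -> dfn Q -> dfn P.
Proof.
move=> PQ [[p Hp]|[b Hb]]; [left; exists p|right; exists b] => e.
  by rewrite Hp PQ.
by rewrite PQ.
Qed.

Lemma dfn_sat w (p : fm w) : dfn (sat (M := M) p).
Proof. by left; exists p. Qed.

Lemma dfn_const w (b : Prop) : dfn (fun _ : tup M w => b).
Proof. by right; exists b. Qed.

Lemma dfn_not w (P : tup M w -> Prop) : dfn P -> dfn (fun e => ~ P e).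
Proof.
case=> [[p Hp]|[b Hb]]; [left; exists (Fnot p)|right; exists (~ b)] => e /=.
  by rewrite Hp.
by rewrite Hb.
Qed.

Lemma dfn_and w (P Q : tup M w -> Prop) : dfn P -> dfn Q -> dfn (fun e => P e /\ Q e).
Proof.
move=> dP dQ; case: (dP) => [[p Hp]|[b Hb]]; case: (dQ) => [[q Hq]|[c Hc]].
- by left; exists (Fand p q) => e /=; rewrite Hp Hq.
- have [cT|cF] := pselect c.
    by apply: dfn_ext dP => e; rewrite Hc; split=> [[]|].
  by right; exists False => e; rewrite Hc; split=> [[]|].
- have [bT|bF] := pselect b.
    by apply: dfn_ext dQ => e; rewrite Hb; split=> [[]|].
  by right; exists False => e; rewrite Hb; split=> [[]|].
- by right; exists (b /\ c) => e; rewrite Hb Hc.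
Qed.

Lemma dfn_or w (P Q : tup M w -> Prop) : dfn P -> dfn Q -> dfn (fun e => P e \/ Q e).
Proof.
move=> dP dQ; apply: dfn_ext (dfn_not (dfn_and (dfn_not dP) (dfn_not dQ))) => e.
rewrite not_andE !notE; tauto.
Qed.

Lemma dfn_impl w (P Q : tup M w -> Prop) : dfn P -> dfn Q -> dfn (fun e => P e -> Q e).
Proof.
move=> dP dQ; apply: dfn_ext (dfn_or (dfn_not dP) dQ) => e.
by split=> [PQ|[//|//]]; have [p|np] := pselect (P e); [right; apply: PQ|left].
Qed.

Lemma dfn_forall_pos a w (P : pos a -> tup M w -> Prop) :
  (forall j, dfn (P j)) -> dfn (fun e => forall j, P j e).
Proof.
elim: a P => [||b IHb c IHc] P dP.
- by right; exists True => e; split=> // _ [].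
- by apply: dfn_ext (dP tt) => e; split=> [|? []].
- have d1 := IHb _ (fun j => dP (inl j)); have d2 := IHc _ (fun j => dP (inr j)).
  by apply: dfn_ext (dfn_and d1 d2) => e; split=> [H|[H1 H2] []] //.
Qed.

Lemma term_fun_vget w s (x : varof w s) : term_fun (fun e : tup M w => vget e x).
Proof. by exists (tvar x) => e; rewrite eval_tvar. Qed.

Lemma term_fun_app w u s (f : Defs.fsym u s) (g : tup M w -> tup M u) :
  (forall i, term_fun (fun e => g e i)) -> term_fun (fun e => fint f (g e)).
Proof.
move=> tg; exists (Tapp f (fun i => projT1 (cid (tg i)))) => e /=; congr (fint f _).
by apply: fext => i; exact: (projT2 (cid (tg i))).
Qed.

Lemma term_fun_comp w u s (t : tup M u -> car M s) (g : tup M w -> tup M u) :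
  term_fun t -> (forall i, term_fun (fun e => g e i)) -> term_fun (fun e => t (g e)).
Proof.
move=> [t' tE] tg; exists (tsub (fun i => projT1 (cid (tg i))) t') => e.
rewrite tE eval_tsub; congr (eval _ t').
by apply: fext => i; exact: (projT2 (cid (tg i))).
Qed.

Lemma term_fun_eval w u s (t : term u s) (g : tup M w -> tup M u) :
  (forall i, term_fun (fun e => g e i)) -> term_fun (fun e => eval (g e) t).
Proof. by apply: (@term_fun_comp _ _ _ (fun e => eval e t)); exists t. Qed.

Lemma dfn_comp w u (P : tup M u -> Prop) (g : tup M w -> tup M u) :
  dfn P -> (forall i, term_fun (fun e => g e i)) -> dfn (fun e => P (g e)).
Proof.
move=> [[p Hp]|[b Hb]] tg; last by right; exists b => e; rewrite Hb.
have [q [_ Hq]] := fm_subst p (fun i => projT1 (cid (tg i))).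
left; exists q => e; rewrite Hq -Hp.
suff -> : (fun i => eval e (projT1 (cid (tg i)))) = g e by [].
by apply: fext => i; rewrite -(projT2 (cid (tg i))).
Qed.

Lemma dfn_eq w s (f g : tup M w -> car M s) :
  term_fun f -> term_fun g -> dfn (fun e => f e = g e).
Proof. by move=> [t Ht] [t' Ht']; left; exists (Feq t t') => e /=; rewrite Ht Ht'. Qed.

Lemma dfn_ex w v (P : tup M v -> tup M w -> Prop) :
  dfn (fun e : tup M (ctx_cat v w) => P (lpart e) (rpart e)) ->
  dfn (fun e => exists y, P y e).
Proof.
case=> [[p Hp]|[b Hb]].
  have [q [_ Hq]] := fm_exs p; left; exists q => e; rewrite Hq.
  by split=> -[y]; [rewrite Hp|move=> H]; exists y => //; rewrite Hp.
right; exists (inhabited (tup M v) /\ b) => e; split=> [[y Py]|[[y] bT]].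
  by split; [constructor|apply/(Hb (ecat y e))].
by exists y; apply/(Hb (ecat y e)).
Qed.

Lemma dfn_all w v (P : tup M v -> tup M w -> Prop) :
  dfn (fun e : tup M (ctx_cat v w) => P (lpart e) (rpart e)) ->
  dfn (fun e => forall y, P y e).
Proof.
move=> dP; apply: dfn_ext (dfn_not (dfn_ex (P := fun y e => ~ P y e) (dfn_not dP))) => e.
by split=> [H [y] //|H y]; apply: contrapT => nP; apply: H; exists y.
Qed.

(** Definability is asked after every substitution of term functions, because [P] takes a family of
    tuples and not a tuple of one context; this form also survives nesting, as in [dfn_qsum]. *)
Lemma dfn_ex_family w a (W : pos a -> ctx (sorts L))
    (P : (forall j, tup M (W j)) -> tup M w -> Prop) :
  (forall v (f : tup M v -> forall j, tup M (W j)) (g : tup M v -> tup M w),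
    (forall j k, term_fun (fun e => f e j k)) -> (forall i, term_fun (fun e => g e i)) ->
    dfn (fun e => P (f e) (g e))) ->
  dfn (fun e => exists y, P y e).
Proof.
move=> dP; have [V [x Hx]] := family_ctx W.
apply: (@dfn_ext _ _ (fun e => exists z : tup M V, P (fun j k => vget z (x j k)) e)).
  move=> e; split=> [[y Py]|[z Pz]]; last by eexists; exact: Pz.
  have [z [zE _]] := Hx _ y; exists z; suff -> : (fun j k => vget z (x j k)) = y by [].
  by apply: fext => j; apply: fext => k; rewrite zE.
apply: (@dfn_ex w V (fun z => P (fun j k => vget z (x j k)))).
apply: (dP _ (fun e j k => vget (lpart e) (x j k)) (@rpart _ _ _ _)) => [j k|i].
  apply: (@term_fun_comp _ _ _ (fun z : tup M V => vget z (x j k))) ; last by variable.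
  exact: term_fun_vget.
by move: i; variable.
Qed.

Lemma dfn_fm w (P : tup M w -> Prop) :
  inhabited (@fm L w) -> dfn P -> exists p : fm w, forall e, sat p e <-> P e.
Proof.
move=> [q] [//|[b Hb]]; have [bT|bF] := pselect b.
  by exists (Fnot (Fand q (Fnot q))) => e /=; rewrite Hb; split=> // _ [].
by exists (Fand q (Fnot q)) => e /=; rewrite Hb; split=> // -[].
Qed.

End Definability.

Lemma dfn_reduct L L' (h : lmap L L') (M : structure L') w (P : tup (reduct h M) w -> Prop)
    w' (g : tup M w' -> tup (reduct h M) w) :
  dfn P -> (forall i, @term_fun _ M w' (h (w i)) (fun e => g e i)) ->
  dfn (fun e => P (g e)).
Proof.
move=> [[p Hp]|[b Hb]] tg; last by right; exists b => e; rewrite Hb.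
have [q Hq] := definable_inst M p (fun i => projT1 (cid (tg i))).
left; exists q => e; rewrite Hq -Hp.
suff -> : (fun i => eval e (projT1 (cid (tg i)))) = g e by [].
by apply: fext => i; exact/esym/(projT2 (cid (tg i))).
Qed.

Lemma term_fun_reduct L L' (h : lmap L L') (M : structure L') w s
    (f : tup (reduct h M) w -> car (reduct h M) s) w' (g : tup M w' -> tup (reduct h M) w) :
  term_fun f -> (forall i, @term_fun _ M w' (h (w i)) (fun e => g e i)) ->
  @term_fun _ M w' (h s) (fun e => f (g e)).
Proof.
move=> [t tE] tg; exists (tinst (fun i => projT1 (cid (tg i))) t) => e.
rewrite tE eval_tinst.
suff -> : g e = fun i => eval e (projT1 (cid (tg i))) by [].
by apply: fext => i; exact: (projT2 (cid (tg i))).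
Qed.

(** * Definability over a set of parameters *)

Section DefinableOver.
Context (L : lang) (M : structure L).

Definition pdf (S : set (elt M)) w (D : tup M w -> Prop) : Prop :=
  exists v (c : tup M v) (Q : tup M (ctx_cat w v) -> Prop),
    [/\ coords c `<=` S, dfn Q & forall x, D x <-> Q (ecat x c)].

Lemma coordsS w (c : tup M w) (S : set (elt M)) :
  coords c `<=` S <-> forall i, S (Elt (c i)).
Proof. by split=> [H i|H _ [i _ <-] //]; apply: H; exists i. Qed.

Lemma pdf_mono (S T : set (elt M)) w (D : tup M w -> Prop) :
  S `<=` T -> pdf S D -> pdf T D.
Proof. by move=> ST [v [c [Q [cS dQ E]]]]; exists v, c, Q; split=> // x /cS /ST. Qed.

Lemma pdf_ext (S : set (elt M)) w (D E : tup M w -> Prop) :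
  (forall x, D x <-> E x) -> pdf S E -> pdf S D.
Proof. by move=> DE [v [c [Q [cS dQ H]]]]; exists v, c, Q; split=> // x; rewrite DE. Qed.

Lemma pdf_dfn (S : set (elt M)) w (D : tup M w -> Prop) : dfn D -> pdf S D.
Proof.
move=> dD; exists (@Ctx _ Sh0 (fun i : void => match i with end)).
exists (fun i : void => match i with end), (fun e => D (lpart e)); split=> //.
  by move=> _ [[]].
by apply: dfn_comp dD _; variable.
Qed.

Lemma pdf_inst (S : set (elt M)) w v (D : tup M (ctx_cat w v) -> Prop) (c : tup M v) :
  pdf S D -> coords c `<=` S -> pdf S (fun x => D (ecat x c)).
Proof.
move=> [u [d [Q [dS dQ E]]]] cS; exists (ctx_cat v u), (ecat c d).
exists (fun e => Q (ecat (ecat (lpart e) (lpart (rpart e))) (rpart (rpart e)))); split=> //.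
  by apply/coordsS => -[i|i]; [apply/(coordsS c S).1|apply/(coordsS d S).1].
by apply: dfn_comp dQ _ => -[[]|]; variable.
Qed.

Lemma pdf_not (S : set (elt M)) w (D : tup M w -> Prop) :
  pdf S D -> pdf S (fun x => ~ D x).
Proof.
move=> [u [d [Q [dS dQ E]]]]; exists u, d, (fun e => ~ Q e); split=> //.
  exact: dfn_not.
by move=> x; rewrite E.
Qed.

Lemma pdf_and (S : set (elt M)) w (D E : tup M w -> Prop) :
  pdf S D -> pdf S E -> pdf S (fun x => D x /\ E x).
Proof.
move=> [u [d [Q [dS dQ HD]]]] [v [c [R [cS dR HE]]]].
exists (ctx_cat u v), (ecat d c).
exists (fun e => Q (ecat (lpart e) (lpart (rpart e))) /\
                 R (ecat (lpart e) (rpart (rpart e)))); split.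
- by apply/coordsS => -[i|i]; [apply/(coordsS d S).1|apply/(coordsS c S).1].
- by apply: dfn_and; [apply: dfn_comp dQ _|apply: dfn_comp dR _] => -[]; variable.
- by move=> x; rewrite HD HE.
Qed.

Lemma pdf_comp (S : set (elt M)) w u (D : tup M u -> Prop) (g : tup M w -> tup M u) :
  pdf S D -> (forall i, term_fun (fun e => g e i)) -> pdf S (fun x => D (g x)).
Proof.
move=> [v [c [Q [cS dQ H]]]] tg.
exists v, c, (fun e => Q (ecat (g (lpart e)) (rpart e))); split=> //.
apply: dfn_comp dQ _ => -[i|]; last by variable.
by apply: (@term_fun_comp _ _ _ _ _ (fun e => g e i)); last by variable.
Qed.

Lemma pdf_ex (S : set (elt M)) w v (P : tup M v -> tup M w -> Prop) :
  pdf S (fun e : tup M (ctx_cat v w) => P (lpart e) (rpart e)) ->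
  pdf S (fun e => exists y, P y e).
Proof.
move=> [u [c [Q [cS dQ H]]]].
exists u, c, (fun e => exists y, Q (ecat (ecat y (lpart e)) (rpart e))); split=> //.
  apply: dfn_ex; apply: dfn_comp dQ _ => -[[]|]; variable.
by move=> x; split=> -[y Hy]; exists y; move: Hy; rewrite -(H (ecat y x)).
Qed.

Lemma pdf_all (S : set (elt M)) w v (P : tup M v -> tup M w -> Prop) :
  pdf S (fun e : tup M (ctx_cat v w) => P (lpart e) (rpart e)) ->
  pdf S (fun e => forall y, P y e).
Proof.
move=> dP.
apply: (pdf_ext (E := fun e => ~ exists y, ~ P y e)) => [e|].
  by split=> [H [y] //|H y]; apply: contrapT => nP; apply: H; exists y.
exact/pdf_not/(@pdf_ex _ _ _ (fun y e => ~ P y e))/pdf_not.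
Qed.

Lemma pdf_impl (S : set (elt M)) w (D E : tup M w -> Prop) :
  pdf S D -> pdf S E -> pdf S (fun x => D x -> E x).
Proof.
move=> dD dE; apply: (pdf_ext (E := fun x => ~ (D x /\ ~ E x))) => [x|].
  by split=> [H [/H]//|H d]; apply: contrapT => ne; apply: H.
exact/pdf_not/pdf_and/pdf_not.
Qed.

Lemma pdf_forall_pos (S : set (elt M)) a w (P : pos a -> tup M w -> Prop) :
  (forall j, pdf S (P j)) -> pdf S (fun e => forall j, P j e).
Proof.
elim: a P => [||b IHb c IHc] P dP.
- by apply: pdf_dfn; right; exists True => e; split=> // _ [].
- by apply: pdf_ext (dP tt) => e; split=> [|? []].
- have d1 := IHb _ (fun j => dP (inl j)); have d2 := IHc _ (fun j => dP (inr j)).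
  by apply: pdf_ext (pdf_and d1 d2) => e; split=> [H|[H1 H2] []].
Qed.

Lemma pdf_forall_ord (S : set (elt M)) n w (P : 'I_n -> tup M w -> Prop) :
  (forall j, pdf S (P j)) -> pdf S (fun e => forall j, P j e).
Proof.
elim: n P => [|n IHn] P dP.
  by apply: pdf_dfn; right; exists True => e; split=> // _ [].
have := pdf_and (dP ord0) (IHn _ (fun j => dP (lift ord0 j))).
apply: pdf_ext => e; split=> [H|[H0 H] j]; first by split.
by case: (unliftP ord0 j) => [k ->|->].
Qed.

Lemma psat_pdf (S : set (elt M)) w (p : pfm M w) : pover S p -> pdf S (psat p).
Proof. by move=> pS; exists (pvar p), (ppar p), (sat (pfml p)); split=> //; exact: dfn_sat. Qed.

Lemma pdf_pfm (S : set (elt M)) w (D : tup M w -> Prop) :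
  (forall v, inhabited (@fm L v)) -> pdf S D ->
  exists p : pfm M w, pover S p /\ forall x, psat p x <-> D x.
Proof.
move=> inh [v [c [Q [cS dQ H]]]]; have [q Hq] := dfn_fm (inh _) dQ.
by exists (Pfm q c); split=> // x; rewrite H -Hq.
Qed.

Lemma pdf_dcl (S : set (elt M)) w (D : tup M w -> Prop) : pdf (dcl S) D -> pdf S D.
Proof.
move=> [v [c [Q [/coordsS cS dQ H]]]].
pose V i := projT1 (cid (cS i)); pose d i : tup M (V i) := projT1 (cid (projT2 (cid (cS i)))).
pose p i := projT1 (cid (projT2 (cid (projT2 (cid (cS i)))))).
have [dS pE] : (forall i, coords (d i) `<=` S) /\
    (forall i y, sat (p i) (econs y (d i)) <-> y = c i).
  by split=> i; case: (projT2 (cid (projT2 (cid (projT2 (cid (cS i))))))).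
have [W [x Hx]] := family_ctx V; have [e [eE eV]] := Hx _ d.
(* The parameters [c] become variables [y], each pinned down by the formula that defines [c i] over
   [S]; the parameters of these formulas are packed into [e]. *)
exists W, e, (fun z => exists y : tup M v, Q (ecat (lpart z) y) /\
  forall i, sat (p i) (econs (y i) (fun k => vget (rpart z) (x i k)))); split.
- apply/coordsS => i; have [j [k E]] := eV i.
  by rewrite /Elt E; exact: (coordsS (d j) S).1 (dS j) k.
- apply: (@dfn_ex _ _ _ _ (fun y z => Q (ecat (lpart z) y) /\
    forall i, sat (p i) (econs (y i) (fun k => vget (rpart z) (x i k))))).
  apply: dfn_and; first by apply: dfn_comp dQ _ => -[]; variable.
  apply: dfn_forall_pos => i.
  apply: (@dfn_comp _ _ _ _ _ (fun e => econs _ _)); first exact: dfn_sat.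
  case=> k /=; first by move: i; variable.
  apply: (@term_fun_comp _ _ _ _ _ (fun z : tup M W => vget z (x i k))) ; last by variable.
  exact: term_fun_vget.
- have dE i : (fun k => vget e (x i k)) = d i by apply: fext => k; exact: eE.
  move=> y; rewrite H; split=> [Qc|[z [Qz zE]]].
    by exists c; split=> // i; rewrite /= /rpart /= dE pE.
  suff <- : z = c by [].
  by apply: fext => i; apply/pE; rewrite -dE; exact: zE.
Qed.

End DefinableOver.

Definition evals L (N : structure L) (w v : ctx (sorts L))
    (t : forall k : pos (shp v), term w (v k)) (e : tup N w) : tup N v :=
  fun k => eval e (t k).

(** * Abelian structures and exact sequences *)

Section Groups.
Context (L : ablang) (N : structure L) (abN : abelian N).

Section Laws.
Context (w : ctx (sorts L)).
Implicit Types x y z : tup N w.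

Lemma eaddA x y z : eadd x (eadd y z) = eadd (eadd x y) z.
Proof. by apply: fext => i; exact: ab_addA. Qed.

Lemma eaddC x y : eadd x y = eadd y x.
Proof. by apply: fext => i; exact: ab_addC. Qed.

Lemma eadd0e x : eadd (ezero N w) x = x.
Proof. by apply: fext => i; exact: ab_add0. Qed.

Lemma eadde0 x : eadd x (ezero N w) = x.
Proof. by rewrite eaddC eadd0e. Qed.

Lemma eaddNe x : eadd (eopp x) x = ezero N w.
Proof. by apply: fext => i; exact: ab_addN. Qed.

Lemma esubxx x : esub x x = ezero N w.
Proof. by rewrite /esub eaddC eaddNe. Qed.

Lemma eaddK x y : esub (eadd x y) y = x.
Proof. by rewrite /esub -eaddA -/(esub y y) esubxx eadde0. Qed.

Lemma esubK x y : eadd (esub x y) y = x.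
Proof. by rewrite /esub -eaddA eaddNe eadde0. Qed.

Lemma eaddI x y z : eadd x z = eadd y z -> x = y.
Proof. by move=> /(congr1 (fun t => esub t z)); rewrite !eaddK. Qed.

Lemma eoppK x : eopp (eopp x) = x.
Proof. by apply: (@eaddI _ _ (eopp x)); rewrite eaddNe eaddC eaddNe. Qed.

Lemma eaddACA x y z t : eadd (eadd x y) (eadd z t) = eadd (eadd x z) (eadd y t).
Proof. by rewrite -eaddA (eaddA y z) (eaddC y z) -eaddA eaddA. Qed.

Lemma eoppD x y : eopp (eadd x y) = eadd (eopp x) (eopp y).
Proof.
apply: (@eaddI _ _ (eadd x y)).
by rewrite eaddNe eaddACA !eaddNe eadd0e.
Qed.

Lemma esube0 x : esub x (ezero N w) = x.
Proof. by rewrite -[RHS](esubK x (ezero N w)) eadde0. Qed.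

Lemma esubDD x y z t : esub (eadd x y) (eadd z t) = eadd (esub x z) (esub y t).
Proof. by rewrite /esub eoppD eaddACA. Qed.

Lemma esub_trans x y z : eadd (esub x y) (esub y z) = esub x z.
Proof. by apply: (@eaddI _ _ z); rewrite -eaddA !esubK. Qed.

End Laws.

Lemma evals_add w v (t : forall k : pos (shp v), term w (v k)) (x y : tup N w) :
  evals t (eadd x y) = eadd (evals t x) (evals t y).
Proof. by apply: fext => k; exact: ab_term. Qed.

Lemma evals0 w v (t : forall k : pos (shp v), term w (v k)) :
  evals t (ezero N w) = ezero N v.
Proof.
apply: (@eaddI _ _ _ (evals t (ezero N w))).
by rewrite -evals_add !eadd0e.
Qed.

Lemma evals_opp w v (t : forall k : pos (shp v), term w (v k)) (x : tup N w) :
  evals t (eopp x) = eopp (evals t x).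
Proof.
by apply: (@eaddI _ _ _ (evals t x)); rewrite -evals_add !eaddNe evals0.
Qed.

Lemma evals_sub w v (t : forall k : pos (shp v), term w (v k)) (x y : tup N w) :
  evals t (esub x y) = esub (evals t x) (evals t y).
Proof. by rewrite /esub evals_add evals_opp. Qed.

Lemma ecat_zero w v (x : tup N w) (y : tup N v) :
  ecat x y = eadd (ecat x (ezero N v)) (ecat (ezero N w) y).
Proof.
apply: fext => -[i|i]; rewrite /eadd /=; first by rewrite (ab_addC abN) (ab_add0 abN).
by rewrite (ab_add0 abN).
Qed.

Variable p : ppfm L.
Implicit Types x y : tup N (pp_ctx p).

Lemma pp_opp x : sat p x -> sat p (eopp x).
Proof. by move=> px; rewrite -[eopp x]eadd0e; apply: (ab_ppB abN _ px); exact: ab_pp0. Qed.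

Lemma pp_add x y : sat p x -> sat p y -> sat p (eadd x y).
Proof. by move=> px /pp_opp py; rewrite -[y]eoppK; exact: (ab_ppB abN px py). Qed.

Lemma pp_addr x y : sat p y -> sat p (eadd x y) <-> sat p x.
Proof.
move=> py; split=> [pxy|px]; last exact: pp_add.
by rewrite -(eaddK x y); exact: (ab_ppB abN).
Qed.

End Groups.

Section Homs.
Context (L : ablang) (N N' : structure L) (abN : abelian N) (abN' : abelian N').
Context (f : forall s, car N s -> car N' s).
Hypothesis fint_f : forall u s (g : Defs.fsym u s) (a : tup N u), f (fint g a) = fint g (emap f a).

Lemma emap_add w (x y : tup N w) : emap f (eadd x y) = eadd (emap f x) (emap f y).
Proof.
apply: fext => i; rewrite /emap /eadd /gadd fint_f; congr (fint _ _).
by apply: fext => -[].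
Qed.

Lemma emap0 w : emap f (ezero N w) = ezero N' w.
Proof.
apply: (eaddI abN' (z := emap f (ezero N w))).
by rewrite -emap_add (eadd0e abN) (eadd0e abN').
Qed.

Lemma emap_opp w (x : tup N w) : emap f (eopp x) = eopp (emap f x).
Proof.
apply: (eaddI abN' (z := emap f x)).
by rewrite -emap_add (eaddNe abN) (eaddNe abN') emap0.
Qed.

Lemma emap_sub w (x y : tup N w) : emap f (esub x y) = esub (emap f x) (emap f y).
Proof. by rewrite /esub emap_add emap_opp. Qed.

Lemma eval_hom w s (t : term w s) (e : tup N w) : f (eval e t) = eval (emap f e) t.
Proof.
elim: t => //= u s0 g t IH; rewrite fint_f; congr (fint _ _).
by apply: fext => i; exact: IH.
Qed.

Lemma emap_evals w v (t : forall k : pos (shp v), term w (v k)) (e : tup N w) :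
  emap f (evals t e) = evals t (emap f e).
Proof. by apply: fext => k; exact: eval_hom. Qed.

End Homs.

Section TermSyntax.
Context (L : ablang) (w : ctx (sorts L)).

Definition tzero s : @term L w s := Tapp (sy_zero s) (fun p : void => match p with end).
Definition tsubtract s (t t' : @term L w s) : @term L w s :=
  Tapp (sy_add s) (fun p => match p with inl _ => t | inr _ => Tapp (sy_opp s) (fun _ => t') end).

Lemma eval_tzero (N : structure L) s (e : tup N w) : eval e (tzero s) = gzero N s.
Proof. by rewrite /gzero /=; congr (fint _ _); apply: fext => -[]. Qed.

Lemma eval_tsubtract (N : structure L) s (t t' : term w s) (e : tup N w) :
  eval e (tsubtract t t') = gadd (eval e t) (gopp (eval e t')).
Proof. by rewrite /gadd /=; congr (fint _ _); apply: fext => -[]. Qed.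

(* [s0] only serves to build a true formula, for the empty conjunction. *)
Lemma pp_conj (s0 : sorts L) (a : ishape) (q : pos a -> @fm L w) (J : pos a -> Prop) :
  (forall j, pp (q j)) ->
  exists q' : fm w, pp q' /\
    forall (N : structure L) e, sat (M := N) q' e <-> forall j, J j -> sat (q j) e.
Proof.
pose true_fm := Feq (tzero s0) (tzero s0).
elim: a q J => [||b IHb c IHc] q J ppq.
- by exists true_fm; split=> // N e; split=> // _ [].
- have [Jt|nJt] := pselect (J tt).
    by exists (q tt); split=> // N e; split=> [? []|H] //; exact: H.
  by exists true_fm; split=> // N e; split=> // _ [].
- have [q1 [P1 H1]] := IHb _ (fun j => J (inl j)) (fun j => ppq (inl j)).
  have [q2 [P2 H2]] := IHc _ (fun j => J (inr j)) (fun j => ppq (inr j)).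
  exists (Fand q1 q2); split=> [|N e] /=; first by rewrite P1.
  rewrite H1 H2; split=> [[? ?] []|H] //.
  by split=> j; exact: (H (_ j)).
Qed.

End TermSyntax.

Section GroupTermFunctions.
Context (L : ablang) (L' : lang) (h : lmap L L') (N : structure L') (v : ctx (sorts L')) (s : sorts L).
Implicit Types f g : tup N v -> car (reduct h N) s.

Lemma term_fun_add f g : @term_fun _ N v (h s) f -> @term_fun _ N v (h s) g ->
  @term_fun _ N v (h s) (fun e => gadd (f e) (g e)).
Proof.
move=> tf tg; apply: (@term_fun_app _ N v (ctx_map h (ctx_const (ShU Sh1 Sh1) s)) _
  (lfunc h (sy_add s)) (fun e p => match p with inl _ => f e | inr _ => g e end)).
by case.
Qed.

Lemma term_fun_opp f : @term_fun _ N v (h s) f -> @term_fun _ N v (h s) (fun e => gopp (f e)).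
Proof.
move=> tf.
exact: (@term_fun_app _ N v (ctx_map h (ctx_const Sh1 s)) _ (lfunc h (sy_opp s)) (fun e _ => f e)).
Qed.

Lemma term_fun_zero : @term_fun _ N v (h s) (fun _ => gzero (reduct h N) s).
Proof.
by apply: (@term_fun_app _ N v (ctx_map h (ctx_const Sh0 s)) _ (lfunc h (sy_zero s))
  (fun _ (p : void) => match p with end)) => -[].
Qed.

End GroupTermFunctions.

Section Sequences.
Context (L : ablang) (Phi : set (ppfm L)) (XA : ext (Lquo Phi)) (XC : ext L).
Context (M : structure (Lseq XA XC)) (HM : expanded_pure_ses M).
Local Notation iota := (@iota_map _ _ _ _ M).
Local Notation nu := (@nu_map _ _ _ _ M).
Local Notation rho := (@rho_map _ _ _ _ M).
Local Notation pi := (@pi_map _ _ _ _ M).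

Lemma nu_iota w (a : tup (strA M) w) : emap nu (emap iota a) = ezero (strC M) w.
Proof. by apply: fext => i; apply/(ses_exact HM); exists (a i). Qed.

Lemma nu_surj w (c : tup (strC M) w) : exists b, emap nu b = c.
Proof.
exists (fun i => projT1 (cid (ses_nu_surj HM (c i)))).
by apply: fext => i; exact: (projT2 (cid (ses_nu_surj HM (c i)))).
Qed.

(** Membership in phi(B) + iota(A) as a congruence modulo phi(B): the class of such an [a] in
    A/phi(A) is what [rho] records. *)
Lemma nu_ppP (p : ppfm L) (b : tup (strB M) (pp_ctx p)) :
  sat (M := strC M) p (emap nu b) <-> exists a, sat p (esub b (emap iota a)).
Proof.
rewrite (ses_nu_pp HM); split=> [[b0 [a [pb0 ->]]]|[a pba]].
  by exists a; rewrite (eaddK (ses_abB HM)).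
by exists (esub b (emap iota a)), a; split; [exact: pba|rewrite (esubK (ses_abB HM))].
Qed.

Variable p : {p | Phi p}.
Implicit Types (b : tup (strB M) (pp_ctx (sval p))) (a : tup (strA M) (pp_ctx (sval p))).

Lemma rho_in b a : sat (sval p) (esub b (emap iota a)) -> rho b = @pi p a.
Proof. by move=> pba; rewrite -(ses_rho_in HM a pba) (esubK (ses_abB HM)). Qed.

(** By purity of iota, two candidates for [a] differ by an element of phi(A) exactly when their
    images differ by one of phi(B). The hypothesis on [nu b] excludes the default value of [rho],
    which carries no information on [b]. *)
Lemma rho_in_iff b a : sat (M := strC M) (sval p) (emap nu b) ->
  rho b = @pi p a <-> sat (sval p) (esub b (emap iota a)).
Proof.
move=> /nu_ppP [a1 pba1]; split=> [|/rho_in //].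
rewrite (rho_in pba1) => /(ses_pi_ker HM)/(ses_iota_pure HM).
rewrite (emap_sub (ses_abA HM) (ses_abB HM) (ses_iota_fun HM)).
by move=> /(pp_add (ses_abB HM) pba1); rewrite (esub_trans (ses_abB HM)).
Qed.

Lemma rho_out b : ~ sat (M := strC M) (sval p) (emap nu b) ->
  rho b = pi (ezero (strA M) (pp_ctx (sval p))).
Proof. by rewrite (ses_nu_pp HM) => /(ses_rho_out HM). Qed.

Lemma rho_add b b' a a' :
  sat (M := strC M) (sval p) (emap nu b) -> sat (M := strC M) (sval p) (emap nu b') ->
  rho b = @pi p a -> rho b' = @pi p a' -> rho (eadd b b') = @pi p (eadd a a').
Proof.
move=> pb pb' /(rho_in_iff _ pb) pba /(rho_in_iff _ pb') pba'; apply: rho_in.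
rewrite (emap_add (ses_iota_fun HM)) (esubDD (ses_abB HM)).
exact: (pp_add (ses_abB HM)).
Qed.

(* With a fundamental system, this reduces every p.p.-formula on B to A^* and C^*. *)
Lemma pp_add_iota b a : sat (sval p) (eadd b (emap iota a)) <->
  sat (M := strC M) (sval p) (emap nu b) /\ rho b = @pi p (eopp a).
Proof.
have -> : eadd b (emap iota a) = esub b (emap iota (eopp a)).
  rewrite (emap_opp (ses_abA HM) (ses_abB HM) (ses_iota_fun HM)).
  by rewrite /esub (eoppK (ses_abB HM)).
split=> [pba|[pb /(rho_in_iff _ pb) //]].
by split; [apply/nu_ppP; exists (eopp a)|exact: rho_in].
Qed.

End Sequences.

(** * Quantifier elimination *)

Section DisjunctiveNormalForm.
Context (X : Type) (A C : (X -> Prop) -> Prop).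

Definition dnf (P : X -> Prop) : Prop :=
  exists l : seq ((X -> Prop) * (X -> Prop)),
    (forall q, List.In q l -> A q.1 /\ C q.2) /\
    forall x, P x <-> exists q, [/\ List.In q l, q.1 x & q.2 x].

Hypothesis A_const : forall b : Prop, A (fun _ => b).
Hypothesis C_const : forall b : Prop, C (fun _ => b).
Hypothesis A_and : forall P Q, A P -> A Q -> A (fun x => P x /\ Q x).
Hypothesis C_and : forall P Q, C P -> C Q -> C (fun x => P x /\ Q x).
Hypothesis A_not : forall P, A P -> A (fun x => ~ P x).
Hypothesis C_not : forall P, C P -> C (fun x => ~ P x).

Lemma dnf_ext P Q : (forall x, P x <-> Q x) -> dnf Q -> dnf P.
Proof. by move=> PQ [l [lAC lE]]; exists l; split=> // x; rewrite PQ. Qed.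

Lemma dnf_AC P Q : A P -> C Q -> dnf (fun x => P x /\ Q x).
Proof.
move=> AP CQ; exists [:: (P, Q)]; split=> [q [<-|[]] //|x].
by split=> [[Px Qx]|[q [[<-|[]]]]] //; exists (P, Q); split=> //; left.
Qed.

Lemma dnf_A P : A P -> dnf P.
Proof. by move=> AP; apply: dnf_ext (dnf_AC AP (C_const True)) => x; tauto. Qed.

Lemma dnf_C P : C P -> dnf P.
Proof. by move=> CP; apply: dnf_ext (dnf_AC (A_const True) CP) => x; tauto. Qed.

Lemma dnf_const b : dnf (fun _ => b).
Proof. exact: dnf_A. Qed.

Lemma dnf_or P Q : dnf P -> dnf Q -> dnf (fun x => P x \/ Q x).
Proof.
move=> [l [lAC lE]] [m [mAC mE]]; exists (l ++ m); split=> [q|x].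
  by move=> /(@List.in_app_or _ _ _ _) [/lAC|/mAC].
rewrite lE mE; split=> [[[q [ql]]|[q [qm]]] q1 q2|[q [/(@List.in_app_or _ _ _ _) [ql|qm]] q1 q2]].
- by exists q; split=> //; apply: List.in_or_app; left.
- by exists q; split=> //; apply: List.in_or_app; right.
- by left; exists q.
- by right; exists q.
Qed.

(** Hides the list of disjuncts: besides constants, only unions and single conjunctions remain to be
    treated. *)
Lemma dnf_ind (K : (X -> Prop) -> Prop) :
  (forall P Q, (forall x, P x <-> Q x) -> K Q -> K P) ->
  (forall b : Prop, K (fun _ => b)) -> (forall P Q, K P -> K Q -> K (fun x => P x \/ Q x)) ->
  (forall P Q, A P -> C Q -> K (fun x => P x /\ Q x)) ->
  forall P, dnf P -> K P.
Proof.
move=> Kext K0 Kor KAC P [l [lAC lE]]; apply: (Kext _ _ lE).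
elim: l lAC {lE} => [|q l IHl] lAC.
  by apply: (Kext _ _ _ (K0 False)) => x; split=> // -[q []].
have [qA qC] := lAC q (or_introl erefl).
apply: (Kext _ _ _ (Kor _ _ (KAC _ _ qA qC) (IHl (fun r rl => lAC r (or_intror rl))))) => x.
split=> [[r [[<-|rl] r1 r2]]|[[q1 q2]|[r [rl r1 r2]]]].
- by left.
- by right; exists r.
- by exists q; split=> //; left.
- by exists r; split=> //; right.
Qed.

Lemma dnf_and P Q : dnf P -> dnf Q -> dnf (fun x => P x /\ Q x).
Proof.
move=> dP dQ; move: P dP; apply: dnf_ind => [P P' PP'|b|P P'|P P' AP CP'].
- by apply: dnf_ext => x; rewrite PP'.
- have [bT|bF] := pselect b; first by apply: dnf_ext dQ => x; tauto.
  by apply: dnf_ext (dnf_const False) => x; tauto.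
- by move=> dP dP'; apply: dnf_ext (dnf_or dP dP') => x; tauto.
move: Q dQ; apply: dnf_ind => [Q Q' QQ'|b|Q Q'|Q Q' AQ CQ'].
- by apply: dnf_ext => x; rewrite QQ'.
- have [bT|bF] := pselect b; first by apply: dnf_ext (dnf_AC AP CP') => x; tauto.
  by apply: dnf_ext (dnf_const False) => x; tauto.
- by move=> dP dP'; apply: dnf_ext (dnf_or dP dP') => x; tauto.
- by apply: dnf_ext (dnf_AC (A_and AP AQ) (C_and CP' CQ')) => x; tauto.
Qed.

Lemma dnf_not P : dnf P -> dnf (fun x => ~ P x).
Proof.
move: P; apply: dnf_ind => [P P' PP'|b|P P' dP dP'|P P' AP CP'].
- by apply: dnf_ext => x; rewrite PP'.
- exact: dnf_const.
- by apply: dnf_ext (dnf_and dP dP') => x; tauto.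
- apply: dnf_ext (dnf_or (dnf_A (A_not AP)) (dnf_C (C_not CP'))) => x.
  by rewrite not_andE.
Qed.

Lemma dnf_forall_pos a (P : pos a -> X -> Prop) :
  (forall j, dnf (P j)) -> dnf (fun x => forall j, P j x).
Proof.
elim: a P => [||b IHb c IHc] P dP.
- by apply: dnf_ext (dnf_const True) => x; split=> // _ [].
- by apply: dnf_ext (dP tt) => e; split=> [|? []].
- have d1 := IHb _ (fun j => dP (inl j)); have d2 := IHc _ (fun j => dP (inr j)).
  by apply: dnf_ext (dnf_and d1 d2) => e; split=> [H|[H1 H2] []].
Qed.

Lemma dnf_forall_ord n (P : 'I_n -> X -> Prop) :
  (forall j, dnf (P j)) -> dnf (fun x => forall j, P j x).
Proof.
elim: n P => [|n IHn] P dP.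
  by apply: dnf_ext (dnf_const True) => x; split=> // _ [].
have := dnf_and (dP ord0) (IHn _ (fun j => dP (lift ord0 j))).
apply: dnf_ext => e; split=> [H|[H0 H] j]; first by split.
by case: (unliftP ord0 j) => [k ->|->].
Qed.

(** A quantifier over the subsets of a finite set is a finite disjunction; it serves to guess for
    which indices [nu] lands in phi(C). *)
Lemma dnf_exists_bool a (P : (pos a -> bool) -> X -> Prop) :
  (forall J, dnf (P J)) -> dnf (fun x => exists J, P J x).
Proof.
elim: a P => [||b IHb c IHc] P dP.
- apply: dnf_ext (dP (fun j : void => match j with end)) => x.
  split=> [[J]|PJ]; last by exists (fun j : void => match j with end).
  by congr P; apply: fext => -[].
- apply: dnf_ext (dnf_or (dP (fun _ => true)) (dP (fun _ => false))) => x.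
  split=> [[J PJ]|[PJ|PJ]]; [|by exists (fun _ => true)|by exists (fun _ => false)].
  case E : (J tt) PJ => PJ; [left|right]; move: PJ; congr P;
    by apply: fext => -[]; rewrite E.
- apply: dnf_ext (IHb (fun J x => exists J', P (fun j => match j with inl j => J j
      | inr j => J' j end) x) (fun J => IHc _ (fun J' => dP _))) => x.
  split=> [[J PJ]|[J [J' PJ]]]; last by eexists; exact: PJ.
  exists (fun j => J (inl j)), (fun j => J (inr j)); move: PJ; congr P.
  by apply: fext => -[].
Qed.

End DisjunctiveNormalForm.

(** Existential quantifiers commute with unions, so one conjunction at a time suffices. The relation
    [r] is arbitrary: it stands for adding a variable in A^*, B or C^*, and also for a substitution
    of terms. *)
Lemma dnf_exists X Y (A C : (X -> Prop) -> Prop) (A' C' : (Y -> Prop) -> Prop)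
    (r : Y -> X -> Prop) (P : X -> Prop) :
  (forall b : Prop, A (fun _ => b)) -> (forall b : Prop, C (fun _ => b)) ->
  (forall PA PC, A PA -> C PC -> dnf A' C' (fun y => exists x, [/\ r y x, PA x & PC x])) ->
  dnf A C P -> dnf A' C' (fun y => exists2 x, r y x & P x).
Proof.
move=> Ac Cc rAC; move: P; apply: dnf_ind => [P P' PP'|b|P P' dP dP'|P P' AP CP'].
- by apply: dnf_ext => y; split=> -[x ryx /PP' Px]; exists x.
- by apply: dnf_ext (rAC _ _ (Ac True) (Cc b)) => y; split=> [[x]|[x []]]; exists x.
- apply: dnf_ext (dnf_or dP dP') => y; split=> [[x ryx [Px|P'x]]|[[x ryx Px]|[x ryx Px]]].
  + by left; exists x.
  + by right; exists x.
  + by exists x => //; left.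
  + by exists x => //; right.
- by apply: dnf_ext (rAC _ _ AP CP') => y; split=> [[x ryx []]|[x [ryx ? ?]]]; exists x.
Qed.

Lemma evals_tsub L (N : structure L) (u w v : ctx (sorts L))
    (t : forall k : pos (shp v), term w (v k)) (r : forall k : pos (shp w), term u (w k))
    (e : tup N u) : evals (fun k => tsub r (t k)) e = evals t (evals r e).
Proof. by apply: fext => k; rewrite /evals eval_tsub. Qed.

(** * Separable predicates and their closure properties *)

Section Split.
Context (L : ablang) (Phi : set (ppfm L)) (XA : ext (Lquo Phi)) (XC : ext L).
Context (M : structure (Lseq XA XC)).
Local Notation iota := (@iota_map _ _ _ _ M).
Local Notation nu := (@nu_map _ _ _ _ M).
Local Notation rho := (@rho_map _ _ _ _ M).
Local Notation pi := (@pi_map _ _ _ _ M).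
Local Notation LA := (LA XA).
Local Notation LC := (LC XC).
Implicit Types (wA : ctx (sorts LA)) (wB : ctx (sorts L)) (wC : ctx (sorts LC)).

Definition triple wA wB wC : Type :=
  (tup (strA' M) wA * tup (strB M) wB * tup (strC' M) wC)%type.

Definition quo_ctx (I : ishape) (phi : pos I -> {p | Phi p}) : ctx (sorts LA) :=
  Ctx (shp := I) (fun j => sort_quo XA (phi j)).

Definition rhos wB (I : ishape) (phi : pos I -> {p | Phi p})
    (t : forall j k, @term L wB (pp_ctx (sval (phi j)) k)) (b : tup (strB M) wB) :
    tup (strA' M) (quo_ctx phi) :=
  fun j => rho (evals (t j) b).

Definition nus wB (b : tup (strB M) wB) : tup (strC' M) (ctx_map inl wB) := emap nu b.

Definition Adef wA wB wC (P : triple wA wB wC -> Prop) : Prop :=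
  exists (I : ishape) (phi : pos I -> {p | Phi p})
    (t : forall j k, @term L wB (pp_ctx (sval (phi j)) k))
    (Q : tup (strA' M) (ctx_cat wA (quo_ctx phi)) -> Prop),
    dfn Q /\ forall x, P x <-> Q (ecat x.1.1 (rhos t x.1.2)).

Definition Cdef wA wB wC (P : triple wA wB wC -> Prop) : Prop :=
  exists Q : tup (strC' M) (ctx_cat wC (ctx_map inl wB)) -> Prop,
    dfn Q /\ forall x, P x <-> Q (ecat x.2 (nus x.1.2)).

Definition separable wA wB wC : (triple wA wB wC -> Prop) -> Prop := dnf (@Adef _ _ _) (@Cdef _ _ _).

Lemma Adef_fst wA wB wC (Q : tup (strA' M) wA -> Prop) :
  dfn Q -> @Adef wA wB wC (fun x => Q x.1.1).
Proof.
move=> dQ; pose phi0 (j : pos Sh0) : {p | Phi p} := match j with end.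
exists Sh0, phi0, (fun j : void => match j with end), (fun e => Q (lpart e)); split=> //.
by apply: dfn_comp dQ _; variable.
Qed.

Lemma Adef_const wA wB wC (b : Prop) : @Adef wA wB wC (fun _ => b).
Proof. exact/Adef_fst/dfn_const. Qed.

Lemma Cdef_const wA wB wC (b : Prop) : @Cdef wA wB wC (fun _ => b).
Proof. by exists (fun _ => b); split=> //; exact: dfn_const. Qed.

Lemma Adef_not wA wB wC (P : triple wA wB wC -> Prop) : Adef P -> Adef (fun x => ~ P x).
Proof.
move=> [I [phi [t [Q [dQ QP]]]]]; exists I, phi, t, (fun e => ~ Q e).
by split=> [|x]; [exact: dfn_not|rewrite QP].
Qed.

Lemma Cdef_not wA wB wC (P : triple wA wB wC -> Prop) : Cdef P -> Cdef (fun x => ~ P x).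
Proof.
move=> [Q [dQ QP]]; exists (fun e => ~ Q e).
by split=> [|x]; [exact: dfn_not|rewrite QP].
Qed.

Lemma Cdef_and wA wB wC (P P' : triple wA wB wC -> Prop) :
  Cdef P -> Cdef P' -> Cdef (fun x => P x /\ P' x).
Proof.
move=> [Q [dQ QP]] [Q' [dQ' QP']]; exists (fun e => Q e /\ Q' e).
by split=> [|x]; [exact: dfn_and|rewrite QP QP'].
Qed.

Lemma Adef_and wA wB wC (P P' : triple wA wB wC -> Prop) :
  Adef P -> Adef P' -> Adef (fun x => P x /\ P' x).
Proof.
move=> [I [phi [t [Q [dQ QP]]]]] [I' [phi' [t' [Q' [dQ' QP']]]]].
pose psi (j : pos (ShU I I')) : {p | Phi p} :=
  match j with inl j => phi j | inr j => phi' j end.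
pose s (j : pos (ShU I I')) : forall k, @term L wB (pp_ctx (sval (psi j)) k) :=
  match j return forall k, @term L wB (pp_ctx (sval (psi j)) k) with
  | inl j => t j | inr j => t' j end.
pose l (e : tup (strA' M) (quo_ctx psi)) : tup (strA' M) (quo_ctx phi) := fun j => e (inl j).
pose r (e : tup (strA' M) (quo_ctx psi)) : tup (strA' M) (quo_ctx phi') := fun j => e (inr j).
exists (ShU I I'), psi, s, (fun e => Q (ecat (lpart e) (l (rpart e))) /\
  Q' (ecat (lpart e) (r (rpart e)))); split=> [|x]; last by rewrite QP QP'.
by apply: dfn_and; [apply: dfn_comp dQ _|apply: dfn_comp dQ' _] => -[]; variable.
Qed.

Section Closure.
Context (wA : ctx (sorts LA)) (wB : ctx (sorts L)) (wC : ctx (sorts LC)).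
Implicit Types P Q : triple wA wB wC -> Prop.

Lemma sep_ext P Q : (forall x, P x <-> Q x) -> separable Q -> separable P.
Proof. exact: dnf_ext. Qed.

Lemma sep_A P : Adef P -> separable P.
Proof. exact: (dnf_A (@Cdef_const _ _ _)). Qed.

Lemma sep_C P : Cdef P -> separable P.
Proof. exact: (dnf_C (@Adef_const _ _ _)). Qed.

Lemma sep_and P Q : separable P -> separable Q -> separable (fun x => P x /\ Q x).
Proof.
by apply: dnf_and; move=> *; do ?[exact: Adef_const|exact: Cdef_const
  |exact: Adef_and|exact: Cdef_and].
Qed.

Lemma sep_not P : separable P -> separable (fun x => ~ P x).
Proof.
by apply: dnf_not; move=> *; do ?[exact: Adef_const|exact: Cdef_const
  |exact: Adef_and|exact: Cdef_and|exact: Adef_not|exact: Cdef_not].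
Qed.

Lemma sep_forall_pos a (P : pos a -> triple wA wB wC -> Prop) :
  (forall j, separable (P j)) -> separable (fun x => forall j, P j x).
Proof.
by apply: dnf_forall_pos; move=> *; do ?[exact: Adef_const|exact: Cdef_const
  |exact: Adef_and|exact: Cdef_and].
Qed.

Lemma sep_forall_ord n (P : 'I_n -> triple wA wB wC -> Prop) :
  (forall j, separable (P j)) -> separable (fun x => forall j, P j x).
Proof.
by apply: dnf_forall_ord; move=> *; do ?[exact: Adef_const|exact: Cdef_const
  |exact: Adef_and|exact: Cdef_and].
Qed.

Lemma sep_exists_bool a (P : (pos a -> bool) -> triple wA wB wC -> Prop) :
  (forall J, separable (P J)) -> separable (fun x => exists J, P J x).
Proof. exact: dnf_exists_bool. Qed.

End Closure.

Lemma sep_exists wA wB wC vA vB vC (r : triple vA vB vC -> triple wA wB wC -> Prop)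
    (P : triple wA wB wC -> Prop) :
  (forall PA PC, Adef PA -> Cdef PC -> separable (fun y => exists x, [/\ r y x, PA x & PC x])) ->
  separable P -> separable (fun y => exists2 x, r y x & P x).
Proof.
by move=> H; apply: dnf_exists => //; move=> *; [exact: Adef_const|exact: Cdef_const].
Qed.

(** The quantified variable occurs neither in the C^*-part of a conjunction nor in the values of
    [rho], so the quantifier moves onto the A^*-formula. *)
Lemma sep_exA wA wB wC v (P : triple (ctx_cat v wA) wB wC -> Prop) : separable P ->
  separable (fun x : triple wA wB wC => exists z : tup (strA' M) v, P (ecat z x.1.1, x.1.2, x.2)).
Proof.
pose r (y : triple wA wB wC) (x : triple (ctx_cat v wA) wB wC) :=
  exists z, x = (ecat z y.1.1, y.1.2, y.2).
move=> sP; apply: (@sep_ext _ _ _ _ (fun y => exists2 x, r y x & P x)).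
  by move=> y; split=> [[z Pz]|[_ [z ->] Pz]]; [eexists; [exists z|]|exists z].
apply: sep_exists sP => PA PC [I [phi [t [Q [dQ QP]]]]] [Q' [dQ' QP']].
apply: (@sep_ext _ _ _ _ (fun y => (exists z, Q (ecat (ecat z y.1.1) (rhos t y.1.2))) /\
    Q' (ecat y.2 (nus y.1.2)))).
  move=> y; split=> [[_ [[z ->] /QP Qz /QP' Q'z]]|[[z Qz] Q'z]]; first by split=> //; exists z.
  by exists (ecat z y.1.1, y.1.2, y.2); split; [exists z|apply/QP|apply/QP'].
apply: sep_and; last by apply: sep_C; exists Q'.
apply: sep_A; exists I, phi, t, (fun e => exists z, Q (ecat (ecat z (lpart e)) (rpart e))).
by split=> //; apply: dfn_ex; apply: dfn_comp dQ _ => -[[]|]; variable.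
Qed.

Lemma sep_exC wA wB wC v (P : triple wA wB (ctx_cat v wC) -> Prop) : separable P ->
  separable (fun x : triple wA wB wC => exists z : tup (strC' M) v, P (x.1, ecat z x.2)).
Proof.
pose r (y : triple wA wB wC) (x : triple wA wB (ctx_cat v wC)) :=
  exists z, x = (y.1, ecat z y.2).
move=> sP; apply: (@sep_ext _ _ _ _ (fun y => exists2 x, r y x & P x)).
  by move=> y; split=> [[z Pz]|[_ [z ->] Pz]]; [eexists; [exists z|]|exists z].
apply: sep_exists sP => PA PC [I [phi [t [Q [dQ QP]]]]] [Q' [dQ' QP']].
apply: (@sep_ext _ _ _ _ (fun y => Q (ecat y.1.1 (rhos t y.1.2)) /\
    exists z, Q' (ecat (ecat z y.2) (nus y.1.2)))).
  move=> y; split=> [[_ [[z ->] /QP Qz /QP' Q'z]]|[Qz [z Q'z]]]; first by split=> //; exists z.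
  by exists (y.1, ecat z y.2); split; [exists z|apply/QP|apply/QP'].
apply: sep_and; first by apply: sep_A; exists I, phi, t, Q.
apply: sep_C; exists (fun e => exists z, Q' (ecat (ecat z (lpart e)) (rpart e))).
by split=> //; apply: dfn_ex; apply: dfn_comp dQ' _ => -[[]|]; variable.
Qed.

End Split.

Section SplitSequence.
Context (L : ablang) (Phi : set (ppfm L)) (XA : ext (Lquo Phi)) (XC : ext L).
Context (M : structure (Lseq XA XC)) (HM : expanded_pure_ses M).
Local Notation iota := (@iota_map _ _ _ _ M).
Local Notation nu := (@nu_map _ _ _ _ M).
Local Notation rho := (@rho_map _ _ _ _ M).
Local Notation pi := (@pi_map _ _ _ _ M).
Local Notation LA := (LA XA).
Local Notation LC := (LC XC).
Implicit Types (wA : ctx (sorts LA)) (wB : ctx (sorts L)) (wC : ctx (sorts LC)).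

Definition evalsC (w v : ctx (sorts L)) (t : forall k : pos (shp v), term w (v k))
    (e : tup (strC' M) (ctx_map inl w)) : tup (strC' M) (ctx_map inl v) :=
  evals (N := strC M) t e.

Lemma nus_evals wB v (t : forall k : pos (shp v), @term L wB (v k)) (b : tup (strB M) wB) :
  nus (evals t b) = evalsC t (nus b).
Proof. exact: (emap_evals (ses_nu_fun HM)). Qed.

Lemma term_fun_C w (v : ctx (sorts LC)) s (t : @term L w s)
    (g : tup (strC' M) v -> tup (strC M) w) :
  (forall i, @term_fun _ (strC' M) v (inl (w i)) (fun e => g e i)) ->
  @term_fun _ (strC' M) v (inl s) (fun e => eval (M := strC M) (g e) t).
Proof.
by apply: (@term_fun_reduct _ _ (inclC0 XC) (strC' M) _ _ (fun e => eval e t)); exists t.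
Qed.

Lemma dfn_C w (v : ctx (sorts LC)) (q : @fm L w) (g : tup (strC' M) v -> tup (strC M) w) :
  (forall i, @term_fun _ (strC' M) v (inl (w i)) (fun e => g e i)) ->
  dfn (fun e => sat (M := strC M) q (g e)).
Proof. by apply: (@dfn_reduct _ _ (inclC0 XC) (strC' M) w (sat q)); exact: dfn_sat. Qed.

Lemma term_fun_A w (v : ctx (sorts LA)) s (t : @term L w s)
    (g : tup (strA' M) v -> tup (strA M) w) :
  (forall i, @term_fun _ (strA' M) v (inl (inl (w i))) (fun e => g e i)) ->
  @term_fun _ (strA' M) v (inl (inl s)) (fun e => eval (M := strA M) (g e) t).
Proof.
by apply: (@term_fun_reduct _ _ (inclA0 XA) (strA' M) _ _ (fun e => eval e t)); exists t.
Qed.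

Lemma term_fun_pi (v : ctx (sorts LA)) (p : {p | Phi p})
    (g : tup (strA' M) v -> tup (strA M) (pp_ctx (sval p))) :
  (forall i, @term_fun _ (strA' M) v (inl (inl (pp_ctx (sval p) i))) (fun e => g e i)) ->
  @term_fun _ (strA' M) v (sort_quo XA p) (fun e => pi (g e)).
Proof.
exact: (@term_fun_app _ (strA' M) v (ctx_map (sort_A XA) (pp_ctx (sval p))) _
  (@Efunc _ XA (ctx_map inl (pp_ctx (sval p))) _
    (@Exfunc _ (quo_ext Phi) _ _ (SyPi p))) g).
Qed.

Lemma sep_subst wA wB wC vA vB vC
    (tA : forall i, @term LA vA (wA i)) (tB : forall i, @term L vB (wB i))
    (tC : forall i, @term LC vC (wC i)) (P : triple M wA wB wC -> Prop) :
  separable P -> separable (fun x : triple M vA vB vC =>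
    P (evals tA x.1.1, evals tB x.1.2, evals tC x.2)).
Proof.
pose g (x : triple M vA vB vC) : triple M wA wB wC :=
  (evals tA x.1.1, evals tB x.1.2, evals tC x.2).
move=> sP; apply: (@sep_ext _ _ _ _ _ _ _ _ _ (fun y => exists2 x, x = g y & P x)).
  by move=> x; split=> [Px|[_ ->]//]; exists (g x).
apply: (sep_exists (r := fun y x => x = g y)) sP.
move=> PA PC [I [phi [t [Q [dQ QP]]]]] [Q' [dQ' QP']].
apply: (@sep_ext _ _ _ _ _ _ _ _ _ (fun y => PA (g y) /\ PC (g y))).
  by move=> y; split=> [[_ [-> ? ?]]|[? ?]] //; exists (g y).
apply: sep_and; [apply: sep_A|apply: sep_C].
- exists I, phi, (fun j k => tsub tB (t j k)), (fun e => Q (ecat (evals tA (lpart e)) (rpart e))).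
  split=> [|x]; last first.
    rewrite QP /=; suff -> : rhos t (evals tB x.1.2) =
      rhos (fun j k => tsub tB (t j k)) x.1.2 :> tup (strA' M) _ by [].
    by apply: fext => j; rewrite /rhos evals_tsub.
  apply: dfn_comp dQ _ => -[i|]; last by variable.
  by apply: term_fun_eval; variable.
- exists (fun e : tup (strC' M) (ctx_cat vC (ctx_map inl vB)) =>
    Q' (ecat (evals tC (lpart e)) (evalsC tB (rpart e)))).
  split=> [|x]; last first.
    by rewrite QP' /= nus_evals.
  apply: dfn_comp dQ' _ => -[i|i]; first by apply: term_fun_eval; variable.
  by apply: term_fun_C; variable.
Qed.

End SplitSequence.

Section Elimination.
Context (L : ablang) (Phi : set (ppfm L)) (XA : ext (Lquo Phi)) (XC : ext L).
Context (M : structure (Lseq XA XC)) (HM : expanded_pure_ses M).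
Context (HPhi : fundamental_system Phi (strB M)).
Local Notation iota := (@iota_map _ _ _ _ M).
Local Notation nu := (@nu_map _ _ _ _ M).
Local Notation rho := (@rho_map _ _ _ _ M).
Local Notation pi := (@pi_map _ _ _ _ M).
Local Notation LA := (LA XA).
Local Notation LC := (LC XC).
Local Notation triple := (triple M).
Implicit Types (wA : ctx (sorts LA)) (wB : ctx (sorts L)) (wC : ctx (sorts LC)).

Definition evalsA wA (w : ctx (sorts L)) (t : forall i, @term LA wA (sort_A XA (w i)))
    (a : tup (strA' M) wA) : tup (strA M) w :=
  fun i => eval (M := strA' M) a (t i).


(** The terms given by the fundamental system are additive, so each of their values is a B-part plus
    the image under iota of an A-part; [pp_add_iota] turns its membership in phi(B) into a condition
    in C^* and an equation in A^*. *)
Lemma sep_pp wA wB wC v1 v2 (q : @fm L (ctx_cat v1 v2))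
    (tB : forall i, @term L wB (v1 i)) (tA : forall i, @term LA wA (sort_A XA (v2 i))) :
  pp q ->
  separable (fun x : triple wA wB wC =>
    sat (M := strB M) q (ecat (evals tB x.1.2) (emap iota (evalsA tA x.1.1)))).
Proof.
move=> ppq; have [n [p [t [pPhi Hp]]]] := HPhi (PPfm ppq).
pose y (x : triple wA wB wC) : tup (strB M) (ctx_cat v1 v2) :=
  ecat (evals tB x.1.2) (emap iota (evalsA tA x.1.1)).
apply: (@sep_ext _ _ _ _ _ _ _ _ _ (fun x => forall i, sat (p i) (evals (t i) (y x)))).
  by move=> x; exact: Hp.
apply: sep_forall_ord => i.
pose phi : {p | Phi p} := exist _ _ (pPhi i).
(* Setting the A-variables to 0 gives the B-part [t']; setting the B-variables to 0 gives the A-part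
   [aa]. *)
pose sB : forall k, @term L wB (ctx_cat v1 v2 k) :=
  fun k => match k with inl k => tB k | inr k => tzero _ _ end.
pose t' k := tsub sB (t i k).
pose aa (a : tup (strA' M) wA) : tup (strA M) (pp_ctx (p i)) :=
  evals (t i) (ecat (ezero (strA M) v1) (evalsA tA a)).
have yE x : evals (t i) (y x) = eadd (evals t' x.1.2) (emap iota (aa x.1.1)).
  rewrite /y (ecat_zero (ses_abB HM)) (evals_add (ses_abB HM)); congr eadd.
    rewrite evals_tsub; congr (evals _ _); apply: fext => -[k|k] //=.
    by rewrite /evals eval_tzero.
  rewrite (emap_evals (ses_iota_fun HM)) emap_ecat.
  by rewrite (emap0 (ses_abA HM) (ses_abB HM) (ses_iota_fun HM)).
apply: (@sep_ext _ _ _ _ _ _ _ _ _ (fun x =>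
  sat (M := strC M) (p i) (emap nu (evals t' x.1.2)) /\
  @rho_map _ _ _ _ M phi (evals t' x.1.2) = @pi_map _ _ _ _ M phi (eopp (aa x.1.1)))).
  by move=> x; rewrite yE; exact: (@pp_add_iota _ _ _ _ _ HM phi).
apply: sep_and; [apply: sep_C|apply: sep_A].
  exists (fun e => sat (M := strC M) (p i) (evalsC t' (rpart e))); split=> [|x].
    by apply: dfn_C => k; apply: term_fun_C; variable.
  by rewrite /= -(nus_evals HM).
exists Sh1, (fun _ => phi), (fun _ => t').
exists (fun e : tup (strA' M) (ctx_cat wA (quo_ctx XA (fun _ : pos Sh1 => phi))) =>
  rpart e tt = @pi_map _ _ _ _ M phi (eopp (aa (lpart e)))); split=> //.
apply: dfn_eq; first by move: tt; variable.
apply: term_fun_pi => k.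
pose op := Tapp (sy_opp (pp_ctx (p i) k)) (fun _ : pos Sh1 => t i k).
apply: (@term_fun_A _ _ _ _ M (ctx_cat v1 v2) _ _ op
  (fun e => ecat (ezero (strA M) v1) (evalsA tA (lpart e)))) => -[j|j].
  exact: (@term_fun_zero _ _ (inclA0 XA) (strA' M)).
by apply: (@term_fun_eval _ (strA' M)); variable.
Qed.

End Elimination.

(** Solvability of a system of congruences in the unknown [y] is a p.p.-condition on its data. The
    right-hand sides have separate variables [z], later filled with elements of iota(A), so that
    [sep_pp] applies. *)
Lemma pp_system (L : ablang) (s : sorts L) (w V : ctx (sorts L)) (I : ishape)
    (phi : pos I -> ppfm L)
    (t : forall j k, @term L (ctx_cons s w) (pp_ctx (phi j) k))
    (x : forall j k, @term L V (pp_ctx (phi j) k)) (J : pos I -> Prop) :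
  exists q : @fm L (ctx_cat w V), pp q /\
    forall (N : structure L) (e : tup N w) (z : tup N V), sat q (ecat e z) <->
      exists y, forall j, J j -> sat (phi j) (esub (evals (t j) (econs y e)) (evals (x j) z)).
Proof.
pose W := ctx_cons s (ctx_cat w V).
pose r1 (k : pos (shp (ctx_cons s w))) : @term L W (ctx_cons s w k) :=
  match k return @term L W (ctx_cons s w k) with
  | inl i => @Tvar L W (inl i) | inr i => @Tvar L W (inr (inl i)) end.
pose r2 (k : pos (shp V)) : @term L W (V k) := @Tvar L W (inr (inr k)).
have H j := fm_subst (phi j) (fun k => tsubtract (tsub r1 (t j k)) (tsub r2 (x j k))).
have [q [ppq Hq]] := pp_conj s J (fun j => etrans (proj1 (projT2 (cid (H j)))) (pp_fmP (phi j))).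
exists (Fex q); split=> // N e z.
have E y j : (fun k => eval (econs y (ecat e z)) (tsubtract (tsub r1 (t j k)) (tsub r2 (x j k))))
    = esub (evals (t j) (econs y e)) (evals (x j) z).
  apply: fext => k; rewrite eval_tsubtract !eval_tsub /esub /eadd /eopp /evals.
  by congr (gadd (eval _ _) _); apply: fext => -[].
by split=> -[y Hy]; exists y; [move/Hq: Hy => Hy|apply/Hq] => j /Hy;
  rewrite (proj2 (projT2 (cid (H j)))) E.
Qed.

(** Two values of [y] that solve the same system of congruences differ by a member of this group,
    since the other variables cancel. *)
Lemma pp_homogeneous_system (L : ablang) (s : sorts L) (w : ctx (sorts L)) (I : ishape)
    (phi : pos I -> ppfm L)
    (t : forall j k, @term L (ctx_cons s w) (pp_ctx (phi j) k)) (J : pos I -> Prop) :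
  exists q : @fm L (ctx_const Sh1 s), pp q /\
    forall (N : structure L) (d : tup N (ctx_const Sh1 s)), sat q d <->
      forall j, J j -> sat (phi j) (evals (t j) (ecat d (ezero N w))).
Proof.
pose W := ctx_const Sh1 s.
pose r (k : pos (shp (ctx_cons s w))) : @term L W (ctx_cons s w k) :=
  match k return @term L W (ctx_cons s w k) with
  | inl i => @Tvar L W i | inr i => tzero W (w i) end.
have H j := fm_subst (phi j) (fun k => tsub r (t j k)).
have [q [ppq Hq]] := pp_conj s J (fun j => etrans (proj1 (projT2 (cid (H j)))) (pp_fmP (phi j))).
exists q; split=> // N d.
have E j : (fun k => eval d (tsub r (t j k))) = evals (t j) (ecat d (ezero N w)).
  apply: fext => k; rewrite eval_tsub.
  suff -> : (fun i => eval d (r i)) = ecat d (ezero N w) by [].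
  by apply: fext => -[i|i]; [|exact: eval_tzero].
by split=> [/Hq Hd|Hd]; [|apply/Hq] => j /Hd; rewrite (proj2 (projT2 (cid (H j)))) E.
Qed.

(** * Existential quantifiers over the sorts of B *)

Section Elimination.
Context (L : ablang) (Phi : set (ppfm L)) (XA : ext (Lquo Phi)) (XC : ext L).
Context (M : structure (Lseq XA XC)) (HM : expanded_pure_ses M).
Context (HPhi : fundamental_system Phi (strB M)).
Local Notation iota := (@iota_map _ _ _ _ M).
Local Notation nu := (@nu_map _ _ _ _ M).
Local Notation rho := (@rho_map _ _ _ _ M).
Local Notation pi := (@pi_map _ _ _ _ M).
Local Notation LA := (LA XA).
Local Notation LC := (LC XC).
Local Notation triple := (triple M).
Implicit Types (wA : ctx (sorts LA)) (wB : ctx (sorts L)) (wC : ctx (sorts LC)).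

(* A solution [y1] of the system of congruences can be moved to one above any [u] that
   satisfies its image in C, since nu maps the homogeneous system of B onto that of C. *)
Lemma lift_solution wB s (I : ishape) (phi : pos I -> {p | Phi p})
    (t : forall j k, @term L (ctx_cons s wB) (pp_ctx (sval (phi j)) k)) (J : pos I -> Prop)
    (al : forall j, tup (strA M) (pp_ctx (sval (phi j))))
    (b : tup (strB M) wB) (u : car (strC M) s) (y1 : car (strB M) s) :
  (forall j, J j -> sat (M := strC M) (sval (phi j)) (evals (t j) (econs u (emap nu b)))) ->
  (forall j, J j -> sat (sval (phi j)) (esub (evals (t j) (econs y1 b)) (emap iota (al j)))) ->
  exists2 y, nu y = u &
    forall j, J j -> sat (sval (phi j)) (esub (evals (t j) (econs y b)) (emap iota (al j))).
Proof.
move=> uJ y1J.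
have [aB aC] := (ses_abB HM, ses_abC HM).
have nuD := emap_add (ses_nu_fun HM).
have nuE := emap_evals (ses_nu_fun HM).
have [q [ppq Hq]] := pp_homogeneous_system t J.
pose cst (N : structure L) (y : car N s) : tup N (ctx_const Sh1 s) := fun _ => y.
have consE (N : structure L) (y : car N s) w (e : tup N w) : econs y e = ecat (cst N y) e by [].
have nucons y : emap nu (econs y b) = ecat (emap nu (cst _ y)) (emap nu b).
  by rewrite consE emap_ecat.
(* The right-hand sides iota(al j) vanish under [nu], so [nu y1] satisfies the same conditions in C
   as [u], and their difference solves the homogeneous system. *)
have qu : sat (M := strC M) q (esub (cst _ u) (emap nu (cst _ y1))).
  apply/Hq => j Jj.
  have -> : ecat (esub (cst (strC M) u) (emap nu (cst _ y1))) (ezero (strC M) wB) =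
      esub (econs u (emap nu b)) (emap nu (econs y1 b)).
    by rewrite nucons -(esubxx aC (emap nu b)); apply: fext => -[].
  rewrite (evals_sub aC); apply: (ab_ppB aC); first exact: uJ.
  by rewrite -nuE; apply/(nu_ppP HM); exists (al j); exact: y1J.
have [d0 d0E] := nu_surj HM (esub (cst _ u) (emap nu (cst _ y1))).
move: qu; rewrite -d0E => /(@nu_ppP _ _ _ _ _ HM (PPfm ppq)) [a qa].
(* The preimage [d0] of u - nu y1 need not be a solution in B; subtracting iota(a) makes it one
   without changing its image. Adding [d] to [y1] gives the solution above [u]. *)
set d := esub d0 (emap iota a) in qa.
have nud : emap nu d = esub (cst _ u) (emap nu (cst _ y1)).
  rewrite -d0E -[in RHS](esubK aB d0 (emap iota a)) nuD (nu_iota HM).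
  by rewrite (eadde0 aC).
exists (gadd (d tt) y1).
  have : emap nu (eadd d (cst _ y1)) = cst _ u by rewrite nuD nud (esubK aC).
  by move=> /(congr1 (fun e => e tt)).
move=> j Jj.
have -> : econs (gadd (d tt) y1) b = eadd (ecat d (ezero (strB M) wB)) (econs y1 b).
  apply: fext => -[[]|i] //; exact/esym/(ab_add0 aB).
rewrite (evals_add aB) -[X in esub _ X](eadd0e aB) (esubDD aB) (esube0 aB).
by apply: (pp_add aB); [exact: (Hq _ _).1 qa j Jj|exact: y1J].
Qed.

(* To eliminate [exists y], guess the set [J] of indices [j] such that [nu (t j (y, b))] is in
   phi_j(C).  What remains is a condition on some [u = nu y] in C and the solvability of the
   congruences [t j (y, b) - iota (al j)] in phi_j(B) for [j] in [J], which is a p.p.-formula;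
   by [lift_solution] the two may be solved independently. *)
Lemma sep_exB1 wA wB wC s (P : triple wA (ctx_cons s wB) wC -> Prop) : separable P ->
  separable (fun x : triple wA wB wC => exists y, P (x.1.1, econs y x.1.2, x.2)).
Proof.
pose r (x : triple wA wB wC) (x' : triple wA (ctx_cons s wB) wC) :=
  exists y, x' = (x.1.1, econs y x.1.2, x.2).
move=> sP; apply: (@sep_ext _ _ _ _ _ _ _ _ _ (fun x => exists2 x', r x x' & P x')).
  by move=> x; split=> [[z Pz]|[_ [z ->] Pz]]; [eexists; [exists z|]|exists z].
apply: sep_exists sP => PA PC [I [phi [t [Q [dQ QP]]]]] [Q' [dQ' QP']].
(* A tuple [z] of A in the context [V] holds representatives of all the values
   [rho (t j (y, b))]. *)
have [V [v Hv]] := family_ctx (fun j => pp_ctx (sval (phi j))).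
pose xt j k := tvar (v j k).
pose piz (z : tup (strA M) V) : tup (strA' M) (quo_ctx XA phi) :=
  fun j => pi (evals (xt j) z).
have Q0 (J : pos I -> bool) := pp_system t xt J.
pose q J := projT1 (cid (Q0 J)).
have [ppq Hq] : (forall J, pp (q J)) /\ forall J (b : tup (strB M) wB) (z : tup (strB M) V),
    sat (q J) (ecat b z) <-> exists y, forall j, J j ->
      sat (sval (phi j)) (esub (evals (t j) (econs y b)) (evals (xt j) z)).
  by split=> J; case: (projT2 (cid (Q0 J))).
pose ncons (u : tup (strC' M) (ctx_const Sh1 (inl s))) (e : tup (strC' M) (ctx_map inl wB)) :
    tup (strC' M) (ctx_map inl (ctx_cons s wB)) :=
  fun i => match i with inl k => u k | inr k => e k end.
pose inphi j (e : tup (strC' M) (ctx_map inl (ctx_cons s wB))) :=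
  sat (M := strC M) (sval (phi j)) (evalsC (t j) e).
have nusE y b : nus (econs y b) = ncons (fun _ => nu y) (nus b).
  by apply: fext => -[[]|i].
pose SC (J : pos I -> bool) (x : triple wA wB wC) := exists u : tup (strC' M) (ctx_const Sh1 (inl s)),
  Q' (ecat x.2 (ncons u (nus x.1.2))) /\ forall j, J j <-> inphi j (ncons u (nus x.1.2)).
(* Outside [J] no congruence is imposed, but [rho] then has the default value pi(0), and the
   representative must reproduce it. *)
pose SA (J : pos I -> bool) (x : triple wA wB wC) :=
  exists z : tup (strA' M) (ctx_map (sort_A XA) V), [/\ Q (ecat x.1.1 (piz z)),
   forall j, ~~ J j -> pi (evals (xt j) (z : tup (strA M) V)) = pi (ezero (strA M) (pp_ctx (sval (phi j)))) &
   sat (M := strB M) (q J) (ecat x.1.2 (emap iota (z : tup (strA M) V)))].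
apply: (@sep_ext _ _ _ _ _ _ _ _ _ (fun x => exists J, SC J x /\ SA J x)); last first.
  apply: sep_exists_bool => J; apply: sep_and.
  - apply: sep_C; exists (fun e => exists u, Q' (ecat (lpart e) (ncons u (rpart e))) /\
      forall j, J j <-> inphi j (ncons u (rpart e))); split=> //.
    apply: dfn_ex; apply: dfn_and.
      by apply: dfn_comp dQ' _ => -[|[]]; variable.
    apply: dfn_forall_pos => j.
    have dj : dfn (fun e : tup (strC' M) (ctx_cat (ctx_const Sh1 (inl s))
        (ctx_cat wC (ctx_map inl wB))) => inphi j (ncons (lpart e) (rpart (rpart e)))).
      by apply: dfn_C => k; apply: term_fun_C => -[[]|]; [variable_path tt 5|variable].
    case: (J j); first by apply: dfn_ext dj => e; split=> [[H _]|] //; exact: H.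
    by apply: dfn_ext (dfn_not dj) => e; split=> [[_ H] /H|H] //; split=> // /H.
  - apply: (@sep_exA _ _ _ _ _ _ _ _ _ (fun x : triple (ctx_cat (ctx_map (sort_A XA) V) wA) wB wC =>
      [/\ Q (ecat (rpart x.1.1) (piz (lpart x.1.1))),
       forall j, ~~ J j -> pi (evals (xt j) (lpart x.1.1 : tup (strA M) V)) =
         pi (ezero (strA M) (pp_ctx (sval (phi j)))) &
       sat (M := strB M) (q J) (ecat x.1.2 (emap iota (lpart x.1.1 : tup (strA M) V)))])).
    apply: (@sep_ext _ _ _ _ _ _ _ _ _ (fun x : triple (ctx_cat (ctx_map (sort_A XA) V) wA) wB wC =>
      (Q (ecat (rpart x.1.1) (piz (lpart x.1.1))) /\
       forall j, ~~ J j -> pi (evals (xt j) (lpart x.1.1 : tup (strA M) V)) =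
         pi (ezero (strA M) (pp_ctx (sval (phi j))))) /\
       sat (M := strB M) (q J) (ecat x.1.2 (emap iota (lpart x.1.1 : tup (strA M) V))))).
      by move=> x; split=> [[]|[[]]].
    apply: sep_and; last first.
      exact: (@sep_pp _ _ _ _ _ HM HPhi _ _ _ _ _ (q J) (@Tvar _ wB)
        (fun i => @Tvar _ (ctx_cat (ctx_map (sort_A XA) V) wA) (inl i)) (ppq J)).
    apply: sep_A; apply: (@Adef_fst _ _ _ _ _ _ _ _ (fun a : tup (strA' M) (ctx_cat (ctx_map (sort_A XA) V) wA) =>
      Q (ecat (rpart a) (piz (lpart a))) /\
       forall j, ~~ J j -> pi (evals (xt j) (lpart a : tup (strA M) V)) =
         pi (ezero (strA M) (pp_ctx (sval (phi j)))))).
    have tpi j : @term_fun _ (strA' M) (ctx_cat (ctx_map (sort_A XA) V) wA) (sort_quo XA (phi j))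
        (fun a => pi (evals (xt j) (lpart a : tup (strA M) V))).
      by apply: term_fun_pi => k; apply: term_fun_A; variable.
    apply: dfn_and.
      by apply: dfn_comp dQ _ => -[|i]; [variable|exact: tpi].
    apply: dfn_forall_pos => j; apply: dfn_impl; first exact: dfn_const.
    by apply: dfn_eq (tpi j) _; apply: term_fun_pi => k; exact: (@term_fun_zero _ _ (inclA0 XA) (strA' M)).
move=> x; set b := x.1.2.
split=> [[_ [[y ->] /QP Qy /QP' Q'y]]|[J [[u [Q'u uJ]] [z [Qz z0 qz]]]]].
- rewrite /= -/b in Qy Q'y.
  have al0 j := ses_pi_surj HM (rho (evals (t j) (econs y b))).
  pose al j := projT1 (cid (al0 j)).
  have alE j : pi (al j) = rho (evals (t j) (econs y b)) := projT2 (cid (al0 j)).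
  have [z [zv _]] := Hv (car (strA M)) al.
  have zE j : evals (xt j) z = al j by apply: fext => k; rewrite /evals eval_tvar.
  have inphiE j : inphi j (ncons (fun _ => nu y) (nus b)) =
      sat (M := strC M) (sval (phi j)) (emap nu (evals (t j) (econs y b))).
    by rewrite /inphi -nusE -(nus_evals HM).
  exists (fun j => `[< inphi j (ncons (fun _ => nu y) (nus b)) >]); split.
    exists (fun _ => nu y); split; first by rewrite -nusE.
    by move=> j; split=> /asboolP.
  exists z; split.
  + suff -> : piz z = rhos t (econs y b) by [].
    by apply: fext => j; rewrite /piz zE alE.
  + move=> j /asboolPn; rewrite inphiE => nj.
    by rewrite zE alE (rho_out HM nj).
  + apply/Hq; exists y => j /asboolP; rewrite inphiE => jin.
    rewrite -(emap_evals (ses_iota_fun HM)) zE.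
    exact/(rho_in_iff HM _ jin).
- have [y1 y1J] := (Hq _ _ _).1 qz.
  have uE : u = fun _ => u tt by apply: fext => -[].
  have [y nuy yJ] : exists2 y, nu y = u tt & forall j, J j -> sat (sval (phi j))
      (esub (evals (t j) (econs y b)) (emap iota (evals (xt j) (z : tup (strA M) V)))).
    apply: (lift_solution (al := fun j => evals (xt j) (z : tup (strA M) V)) (y1 := y1)).
      move=> j /uJ; rewrite /inphi; congr (sat _ (evals _ _)).
      by apply: fext => -[[]|i].
    by move=> j /y1J; rewrite (emap_evals (ses_iota_fun HM)).
  have nuE : ncons u (nus b) = nus (econs y b) by rewrite nusE uE nuy.
  exists (x.1.1, econs y b, x.2); split; [by exists y|apply/QP|apply/QP'].
    suff -> : rhos t (econs y b) = piz z by [].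
    apply: fext => j; rewrite /rhos /piz; case Jj : (J j).
      exact/(rho_in HM)/yJ.
    rewrite z0 ?Jj //; apply: (rho_out HM) => jin.
    have /uJ : inphi j (ncons u (nus b)) by rewrite nuE /inphi -(nus_evals HM).
    by rewrite Jj.
  by rewrite /= -nuE.
Qed.

End Elimination.

(** * Elimination for arbitrary formulas of M *)

Section QuantifierElimination.
Context (L : ablang) (Phi : set (ppfm L)) (XA : ext (Lquo Phi)) (XC : ext L).
Context (M : structure (Lseq XA XC)) (HM : expanded_pure_ses M).
Context (HPhi : fundamental_system Phi (strB M)).
Local Notation iota := (@iota_map _ _ _ _ M).
Local Notation nu := (@nu_map _ _ _ _ M).
Local Notation rho := (@rho_map _ _ _ _ M).
Local Notation LA := (LA XA).
Local Notation LC := (LC XC).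
Local Notation triple := (triple M).
Implicit Types (wA : ctx (sorts LA)) (wB : ctx (sorts L)) (wC : ctx (sorts LC)).

Lemma sep_substB wA wB vB wC (tB : forall i, @term L vB (wB i))
    (P : triple wA wB wC -> Prop) :
  separable P -> separable (fun x : triple wA vB wC => P (x.1.1, evals tB x.1.2, x.2)).
Proof. exact: (@sep_subst _ _ _ _ _ HM _ _ _ _ _ _ (@Tvar _ wA) tB (@Tvar _ wC)). Qed.

Lemma sep_exB wA wB wC v (P : triple wA (ctx_cat v wB) wC -> Prop) : separable P ->
  separable (fun x : triple wA wB wC => exists z : tup (strB M) v, P (x.1.1, ecat z x.1.2, x.2)).
Proof.
case: v P => a; elim: a wB => [||b IHb c IHc] wB f P sP.
- pose r (i : pos (shp (ctx_cat (Ctx f) wB))) : @term L wB (ctx_cat (Ctx f) wB i) :=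
    match i with inl k => match k with end | inr k => Tvar k end.
  apply: sep_ext (sep_substB r sP) => x.
  have E (z : tup (strB M) (Ctx f)) : ecat z x.1.2 = evals r x.1.2 by apply: fext => -[[]|i].
  split=> [[z]|]; first by rewrite E.
  by rewrite -(E (fun i : void => match i with end)) => Px; eexists; exact: Px.
- pose r (i : pos (shp (ctx_cat (Ctx f) wB))) : @term L (ctx_cons (f tt) wB) (ctx_cat (Ctx f) wB i) :=
    match i return @term L (ctx_cons (f tt) wB) (ctx_cat (Ctx f) wB i) with
    | inl tt => @Tvar _ (ctx_cons (f tt) wB) (inl tt)
    | inr k => @Tvar _ (ctx_cons (f tt) wB) (inr k) end.
  apply: sep_ext (sep_exB1 HM HPhi (sep_substB r sP)) => x; rewrite /=.
  have E (z : tup (strB M) (Ctx f)) : ecat z x.1.2 = evals r (econs (z tt) x.1.2).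
    by apply: fext => -[[]|i].
  split=> [[z]|[y Py]]; first by rewrite E; exists (z tt).
  by exists (fun i => match i with tt => y end); rewrite E.
- pose v1 := Ctx (shp := b) (fun i => f (inl i)).
  pose v2 := Ctx (shp := c) (fun i => f (inr i)).
  pose W := ctx_cat v1 (ctx_cat v2 wB).
  pose r (i : pos (shp (ctx_cat (Ctx f) wB))) : @term L W (ctx_cat (Ctx f) wB i) :=
    match i return @term L W (ctx_cat (Ctx f) wB i) with
    | inl (inl k) => @Tvar _ W (inl k)
    | inl (inr k) => @Tvar _ W (inr (inl k))
    | inr k => @Tvar _ W (inr (inr k)) end.
  apply: sep_ext (IHc _ _ _ (IHb _ _ _ (sep_substB r sP))) => x; rewrite /=.
  have E (z1 : tup (strB M) v1) (z2 : tup (strB M) v2) :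
      evals r (ecat z1 (ecat z2 x.1.2)) =
      @ecat _ _ (Ctx f) wB (fun i : pos (ShU b c) => match i return car (strB M) (f i) with
        inl k => z1 k | inr k => z2 k end) x.1.2.
    by apply: fext => -[[i|i]|i].
  split=> [[z Pz]|[z2 [z1]]]; last by rewrite E => Pz; eexists; exact: Pz.
  exists (fun i => z (inr i)), (fun i => z (inl i)); rewrite E; move: Pz; congr P.
  by congr (_, _, _); apply: fext => -[[i|i]|i].
Qed.

(** Only terms inside one of the three languages: the symbols [iota], [nu] and [rho], which connect
    the sorts, are reached through graphs of terms, by unnesting. *)
Definition sterm wA wB wC (s : sorts (Lseq XA XC)) : Type :=
  match s with
  | InA s => @term LA wA s
  | InB s => @term L wB s
  | InC s => @term LC wC s
  end.

Definition seval wA wB wC (x : triple wA wB wC) s : sterm wA wB wC s -> car M s :=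
  match s return sterm wA wB wC s -> car M s with
  | InA s => fun t => eval (M := strA' M) x.1.1 t
  | InB s => fun t => eval (M := strB M) x.1.2 t
  | InC s => fun t => eval (M := strC' M) x.2 t
  end.

Definition ssub wA wB wC vA vB vC (tA : forall i, @term LA vA (wA i))
    (tB : forall i, @term L vB (wB i)) (tC : forall i, @term LC vC (wC i)) s :
    sterm wA wB wC s -> sterm vA vB vC s :=
  match s return sterm wA wB wC s -> sterm vA vB vC s with
  | InA s => fun t => tsub tA t
  | InB s => fun t => tsub tB t
  | InC s => fun t => tsub tC t
  end.

Lemma seval_ssub wA wB wC vA vB vC (tA : forall i, @term LA vA (wA i))
    (tB : forall i, @term L vB (wB i)) (tC : forall i, @term LC vC (wC i)) s
    (t : sterm wA wB wC s) (x : triple vA vB vC) :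
  seval x (ssub tA tB tC t) = seval (evals tA x.1.1, evals tB x.1.2, evals tC x.2) t.
Proof. by case: s t => s t; rewrite /= eval_tsub. Qed.

Definition swkA wA wB wC vA : forall s, sterm wA wB wC s -> sterm (ctx_cat vA wA) wB wC s :=
  @ssub _ _ _ (ctx_cat vA wA) _ _ (fun i => @Tvar _ (ctx_cat vA wA) (inr i)) (@Tvar _ wB) (@Tvar _ wC).
Definition swkB wA wB wC vB : forall s, sterm wA wB wC s -> sterm wA (ctx_cat vB wB) wC s :=
  @ssub _ _ _ _ (ctx_cat vB wB) _ (@Tvar _ wA) (fun i => @Tvar _ (ctx_cat vB wB) (inr i)) (@Tvar _ wC).
Definition swkC wA wB wC vC : forall s, sterm wA wB wC s -> sterm wA wB (ctx_cat vC wC) s :=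
  @ssub _ _ _ _ _ (ctx_cat vC wC) (@Tvar _ wA) (@Tvar _ wB) (fun i => @Tvar _ (ctx_cat vC wC) (inr i)).

Lemma seval_swkA wA wB wC vA (z : tup (strA' M) vA) (x : triple wA wB wC) s
    (t : sterm wA wB wC s) : seval (ecat z x.1.1, x.1.2, x.2) (swkA vA t) = seval x t.
Proof. by rewrite seval_ssub; case: x => -[]. Qed.
Lemma seval_swkB wA wB wC vB (z : tup (strB M) vB) (x : triple wA wB wC) s
    (t : sterm wA wB wC s) : seval (x.1.1, ecat z x.1.2, x.2) (swkB vB t) = seval x t.
Proof. by rewrite seval_ssub; case: x => -[]. Qed.
Lemma seval_swkC wA wB wC vC (z : tup (strC' M) vC) (x : triple wA wB wC) s
    (t : sterm wA wB wC s) : seval (x.1, ecat z x.2) (swkC vC t) = seval x t.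
Proof. by rewrite seval_ssub; case: x => -[]. Qed.

Definition sevals wA wB wC (w : ctx (sorts (Lseq XA XC)))
    (th : forall i, sterm wA wB wC (w i)) (x : triple wA wB wC) : tup M w :=
  fun i => seval x (th i).

Lemma sep_eq wA wB wC s (z z' : sterm wA wB wC s) :
  separable (fun x : triple wA wB wC => seval x z = seval x z').
Proof.
case: s z z' => s z z'.
- apply: sep_A; apply: (@Adef_fst _ _ _ _ _ _ _ _ (fun a : tup (strA' M) wA => eval a z = eval a z')).
  by apply: dfn_eq; [exists z|exists z'].
(* Equality in a sort of B is itself a p.p.-formula, here with an empty block of A-variables. *)
- pose v1 := ctx_const (ShU Sh1 Sh1) s; pose v2 := ctx_const Sh0 s.
  apply: sep_ext (@sep_pp _ _ _ _ _ HM HPhi wA wB wC v1 v2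
    (Feq (@Tvar _ (ctx_cat v1 v2) (inl (inl tt))) (@Tvar _ (ctx_cat v1 v2) (inl (inr tt))))
    (fun i => match i with inl _ => z | inr _ => z' end)
    (fun i : void => match i with end) erefl) => x.
  by [].
- apply: sep_C; exists (fun e => eval (lpart e) z = eval (lpart e) z'); split=> //.
  by apply: dfn_eq; apply: term_fun_eval; variable.
Qed.

Section Arguments.
Context (w : ctx (sorts (Lseq XA XC))).

Definition graph_separable s (t : @term (Lseq XA XC) w s) : Prop :=
  forall wA wB wC (th : forall i, sterm wA wB wC (w i)) (z : sterm wA wB wC s),
  separable (fun x : triple wA wB wC => eval (sevals th x) t = seval x z).

(** The arguments [t i] are replaced by fresh variables equated to them, which [sep_exA] then
    eliminates; nested terms are thereby treated one symbol at a time. *)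
Lemma sep_argsA wA wB wC v (t : forall i : pos (shp v), @term (Lseq XA XC) w (InA XC (v i)))
    (th : forall i, sterm wA wB wC (w i)) (R : triple wA wB wC -> tup (strA' M) v -> Prop) :
  (forall i, graph_separable (t i)) ->
  separable (fun x : triple (ctx_cat v wA) wB wC => R (rpart x.1.1, x.1.2, x.2) (lpart x.1.1)) ->
  separable (fun x => R x (fun i => eval (sevals th x) (t i))).
Proof.
move=> tS sR; pose y (i : pos (shp v)) : sterm (ctx_cat v wA) wB wC (InA XC (v i)) :=
  @Tvar _ (ctx_cat v wA) (inl i).
apply: sep_ext (sep_exA (sep_and (sep_forall_pos (fun i =>
  tS i _ _ _ (fun k => swkA v (th k)) (y i))) sR)) => x /=.
have E (z : tup (strA' M) v) : sevals (fun k => swkA v (th k)) (ecat z x.1.1, x.1.2, x.2) = sevals th x.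
  by apply: fext => k; exact: seval_swkA.
have X : (rpart (ecat (fun i => eval (sevals th x) (t i) : car (strA' M) (v i)) x.1.1), x.1.2, x.2) = x.
  by case: x {E} => -[].
split=> [Rx|[z [zE]]].
  exists (fun i => eval (sevals th x) (t i)); split; last by rewrite X.
  by move=> i; rewrite E.
suff -> : (fun i => eval (sevals th x) (t i)) = z by case: (x) => -[].
by apply: fext => i; rewrite -[LHS](congr1 (fun e => eval e (t i)) (E z)) zE.
Qed.

Lemma sep_argsB wA wB wC v (t : forall i : pos (shp v), @term (Lseq XA XC) w (InB XA XC (v i)))
    (th : forall i, sterm wA wB wC (w i)) (R : triple wA wB wC -> tup (strB M) v -> Prop) :
  (forall i, graph_separable (t i)) ->
  separable (fun x : triple wA (ctx_cat v wB) wC => R (x.1.1, rpart x.1.2, x.2) (lpart x.1.2)) ->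
  separable (fun x => R x (fun i => eval (sevals th x) (t i))).
Proof.
move=> tS sR; pose y (i : pos (shp v)) : sterm wA (ctx_cat v wB) wC (InB XA XC (v i)) :=
  @Tvar _ (ctx_cat v wB) (inl i).
apply: sep_ext (sep_exB (sep_and (sep_forall_pos (fun i =>
  tS i _ _ _ (fun k => swkB v (th k)) (y i))) sR)) => x /=.
have E (z : tup (strB M) v) : sevals (fun k => swkB v (th k)) (x.1.1, ecat z x.1.2, x.2) = sevals th x.
  by apply: fext => k; exact: seval_swkB.
have X : (x.1.1, rpart (ecat (fun i => eval (sevals th x) (t i) : car (strB M) (v i)) x.1.2), x.2) = x.
  by case: x {E} => -[].
split=> [Rx|[z [zE]]].
  exists (fun i => eval (sevals th x) (t i)); split; last by rewrite X.
  by move=> i; rewrite E.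
suff -> : (fun i => eval (sevals th x) (t i)) = z by case: (x) => -[].
by apply: fext => i; rewrite -[LHS](congr1 (fun e => eval e (t i)) (E z)) zE.
Qed.

Lemma sep_argsC wA wB wC v (t : forall i : pos (shp v), @term (Lseq XA XC) w (InC XA (v i)))
    (th : forall i, sterm wA wB wC (w i)) (R : triple wA wB wC -> tup (strC' M) v -> Prop) :
  (forall i, graph_separable (t i)) ->
  separable (fun x : triple wA wB (ctx_cat v wC) => R (x.1, rpart x.2) (lpart x.2)) ->
  separable (fun x => R x (fun i => eval (sevals th x) (t i))).
Proof.
move=> tS sR; pose y (i : pos (shp v)) : sterm wA wB (ctx_cat v wC) (InC XA (v i)) :=
  @Tvar _ (ctx_cat v wC) (inl i).
apply: sep_ext (sep_exC (sep_and (sep_forall_pos (fun i =>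
  tS i _ _ _ (fun k => swkC v (th k)) (y i))) sR)) => x /=.
have E (z : tup (strC' M) v) : sevals (fun k => swkC v (th k)) (x.1, ecat z x.2) = sevals th x.
  by apply: fext => k; exact: seval_swkC.
have X : (x.1, rpart (ecat (fun i => eval (sevals th x) (t i) : car (strC' M) (v i)) x.2)) = x.
  by case: x {E} => -[].
split=> [Rx|[z [zE]]].
  exists (fun i => eval (sevals th x) (t i)); split; last by rewrite X.
  by move=> i; rewrite E.
suff -> : (fun i => eval (sevals th x) (t i)) = z by case: (x) => -[].
by apply: fext => i; rewrite -[LHS](congr1 (fun e => eval e (t i)) (E z)) zE.
Qed.

End Arguments.

Lemma sep_graph w s (t : @term (Lseq XA XC) w s) : graph_separable t.
Proof.
elim: t => [i|u s' f t IH] wA wB wC th z; first exact: sep_eq.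
case: u s' / f t IH z => [u s' f|u s' f|u s' f|s'|s'|p] t IH z /=.
- apply: (@sep_argsA w wA wB wC u t th (fun x (y : tup (strA' M) u) =>
    @fint _ M (ctx_map (InA XC) u) _ (FA XC f) y = seval x z)) => //.
  have := @sep_eq (ctx_cat u wA) wB wC (InA XC s')
    (Tapp f (fun i => @Tvar _ (ctx_cat u wA) (inl i))) (swkA u z).
  by apply: sep_ext => x; rewrite /swkA seval_ssub.
- apply: (@sep_argsB w wA wB wC u t th (fun x (y : tup (strB M) u) =>
    @fint _ M (ctx_map (InB XA XC) u) _ (FB XA XC f) y = seval x z)) => //.
  have := @sep_eq wA (ctx_cat u wB) wC (InB XA XC s')
    (Tapp f (fun i => @Tvar _ (ctx_cat u wB) (inl i))) (swkB u z).
  by apply: sep_ext => x; rewrite /swkB seval_ssub.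
- apply: (@sep_argsC w wA wB wC u t th (fun x (y : tup (strC' M) u) =>
    @fint _ M (ctx_map (InC XA (XC := XC)) u) _ (FC XA f) y = seval x z)) => //.
  have := @sep_eq wA wB (ctx_cat u wC) (InC XA s')
    (Tapp f (fun i => @Tvar _ (ctx_cat u wC) (inl i))) (swkC u z).
  by apply: sep_ext => -[x xC]; rewrite /swkC seval_ssub; case: x.
- pose v := ctx_const Sh1 (sort_A XA s').
  apply: (@sep_argsA w wA wB wC v t th (fun x (y : tup (strA' M) v) =>
    @fint _ M _ _ (SyIota XA XC s') y = seval x z)) => //.
  have E (y : tup (strA' M) v) : @fint _ M _ _ (SyIota XA XC s') y = iota (y tt).
    by congr (fint _ _); apply: fext => -[].
  pose v1 := ctx_const Sh1 s'.
  have := @sep_pp _ _ _ _ _ HM HPhi (ctx_cat v wA) wB wC v1 v1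
    (Feq (@Tvar _ (ctx_cat v1 v1) (inr tt)) (@Tvar _ (ctx_cat v1 v1) (inl tt)))
    (fun _ => z) (fun i => @Tvar _ (ctx_cat v wA) (inl i)) erefl.
  by apply: sep_ext => x; rewrite E.
- pose v := ctx_const Sh1 s'.
  apply: (@sep_argsB w wA wB wC v t th (fun x (y : tup (strB M) v) =>
    @fint _ M _ _ (SyNu XA XC s') y = seval x z)) => //.
  have E (y : tup (strB M) v) : @fint _ M _ _ (SyNu XA XC s') y = nu (y tt).
    by congr (fint _ _); apply: fext => -[].
  apply: sep_C; exists (fun e : tup (strC' M) (ctx_cat wC (ctx_map inl (ctx_cat v wB))) =>
    rpart e (inl tt) = eval (lpart e) z); split=> [|x]; last by rewrite E.
  by apply: dfn_eq; [move: tt; variable|apply: term_fun_eval; variable].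
- pose v := pp_ctx (sval p).
  apply: (@sep_argsB w wA wB wC v t th (fun x (y : tup (strB M) v) =>
    @fint _ M _ _ (SyRho XA XC p) y = seval x z)) => //.
  apply: sep_A; exists Sh1, (fun _ => p), (fun _ i => @Tvar _ (ctx_cat v wB) (inl i)).
  exists (fun e : tup (strA' M) (ctx_cat wA (quo_ctx XA (fun _ : pos Sh1 => p))) =>
    rpart e tt = eval (lpart e) z); split=> //.
  by apply: dfn_eq; [move: tt; variable|apply: term_fun_eval; variable].
Qed.


(** One interface for quantifiers over the three kinds of sorts. The hypothesis speaks of any
    enlarged triple of contexts, [wk] being the weakening of terms and [f] the matching restriction
    of tuples. *)
Lemma sep_ex wA wB wC s (P : triple wA wB wC -> car M s -> Prop) :
  (forall vA vB vC (wk : forall s', sterm wA wB wC s' -> sterm vA vB vC s')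
     (f : triple vA vB vC -> triple wA wB wC) (z : sterm vA vB vC s),
     (forall s' t x, @seval _ _ _ x s' (wk s' t) = seval (f x) t) ->
     separable (fun x => P (f x) (seval x z))) ->
  separable (fun x => exists y, P x y).
Proof.
move=> H; case: s P H => s P H.
- pose v := ctx_const Sh1 s; pose z := @Tvar _ (ctx_cat v wA) (inl tt).
  have := sep_exA (H (ctx_cat v wA) wB wC (swkA v) (fun x => (rpart x.1.1, x.1.2, x.2)) z
    (fun _ t x => seval_ssub _ _ _ t x)).
  apply: sep_ext => -[[a b] c] /=.
  by split=> -[y Py]; [exists (fun _ => y)|exists (y tt)].
- pose v := ctx_const Sh1 s; pose z := @Tvar _ (ctx_cat v wB) (inl tt).
  have := sep_exB (H wA (ctx_cat v wB) wC (swkB v) (fun x => (x.1.1, rpart x.1.2, x.2)) z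
    (fun _ t x => seval_ssub _ _ _ t x)).
  apply: sep_ext => -[[a b] c] /=.
  by split=> -[y Py]; [exists (fun _ => y)|exists (y tt)].
- pose v := ctx_const Sh1 s; pose z := @Tvar _ (ctx_cat v wC) (inl tt).
  have := sep_exC (H wA wB (ctx_cat v wC) (swkC v) (fun x => (x.1.1, x.1.2, rpart x.2)) z
    (fun _ t x => seval_ssub _ _ _ t x)).
  apply: sep_ext => -[[a b] c] /=.
  by split=> -[y Py]; [exists (fun _ => y)|exists (y tt)].
Qed.

Theorem sep_sat w (p : @fm (Lseq XA XC) w) : forall wA wB wC
  (th : forall i, sterm wA wB wC (w i)),
  separable (fun x : triple wA wB wC => sat (M := M) p (sevals th x)).
Proof.
elim: p => {w} [w s t t'|w u r t|w p IHp q IHq|w p IHp|w s p IHp] wA wB wC th.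
- apply: (@sep_ext _ _ _ _ _ _ _ _ _
    (fun x => exists y, eval (sevals th x) t = y /\ eval (sevals th x) t' = y)) => [x|].
    by split=> [/= ->|[y [<- E]]]; [eexists|rewrite /= E].
  apply: sep_ex => vA vB vC wk f z fE.
  apply: sep_ext (sep_and (sep_graph t (fun k => wk _ (th k)) z)
    (sep_graph t' (fun k => wk _ (th k)) z)) => x.
  suff -> : sevals (fun k => wk _ (th k)) x = sevals th (f x) by [].
  by apply: fext => k; exact: fE.
- case: u / r t => [u r|u r|u r] t.
  + apply: (@sep_argsA w wA wB wC u t th (fun x (y : tup (strA' M) u) =>
      @rint _ (strA' M) u r y)) => [i|]; first exact: sep_graph.
    apply: sep_A; apply: (@Adef_fst _ _ _ _ _ _ _ _
      (fun a : tup (strA' M) (ctx_cat u wA) => rint r (lpart a))).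
    by left; exists (Frel r (fun i => @Tvar _ (ctx_cat u wA) (inl i))).
  + apply: (@sep_argsB w wA wB wC u t th (fun x (y : tup (strB M) u) =>
      @rint _ (strB M) u r y)) => [i|]; first exact: sep_graph.
    pose v2 : ctx (sorts L) := Ctx (shp := Sh0) (fun i : void => match i with end).
    exact: (@sep_pp _ _ _ _ _ HM HPhi wA (ctx_cat u wB) wC u v2
      (Frel r (fun i => @Tvar _ (ctx_cat u v2) (inl i)))
      (fun i => @Tvar _ (ctx_cat u wB) (inl i)) (fun i : void => match i with end) erefl).
  + apply: (@sep_argsC w wA wB wC u t th (fun x (y : tup (strC' M) u) =>
      @rint _ (strC' M) u r y)) => [i|]; first exact: sep_graph.
    apply: sep_C.
    exists (fun e : tup (strC' M) (ctx_cat (ctx_cat u wC) (ctx_map inl wB)) =>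
      rint r (lpart (lpart e))); split=> //.
    by left; exists (Frel r (fun i => @Tvar _ (ctx_cat (ctx_cat u wC) (ctx_map inl wB)) (inl (inl i)))).
- by apply: sep_ext (sep_and (IHp _ _ _ th) (IHq _ _ _ th)).
- by apply: sep_ext (sep_not (IHp _ _ _ th)).
- apply: (@sep_ex _ _ _ s (fun x y => sat p (econs y (sevals th x)))) => vA vB vC wk f z fE.
  pose th' (i : pos (shp (ctx_cons s w))) : sterm vA vB vC (ctx_cons s w i) :=
    match i with inl _ => z | inr k => wk _ (th k) end.
  apply: sep_ext (IHp _ _ _ th') => x.
  suff -> : sevals th' x = econs (seval x z) (sevals th (f x)) by [].
  by apply: fext => -[k|k] //; exact: fE.
Qed.

End QuantifierElimination.

(** * Indiscernible sequences in saturated structures *)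

Lemma nat_nonprincipal_ultrafilter : exists U : set_system nat, UltraFilter U /\
  forall m, U [set k | (m <= k)%N].
Proof.
pose F : set_system nat := fun A => exists m, forall k, (m <= k)%N -> A k.
have PF : ProperFilter F.
  apply: Build_ProperFilter_ex => [A [m /(_ m (leqnn m))]|]; first by exists m.
  split=> [|A B [m mA] [n nB]|A B AB [m mA]]; first by exists 0.
    exists (maxn m n) => k; rewrite geq_max => /andP[mk nk].
    by split; [exact: mA|exact: nB].
  by exists m => k /mA /AB.
have [U [UU FU]] := ultraFilterLemma PF; exists U; split=> // m.
by apply: FU; exists m.
Qed.

Section PowerTuples.
Context (L : lang) (M : structure L).

(** [epow] adds copies at the front, while a Morley sequence grows at the end: the last term is the
    one realized over all the others. *)
Fixpoint snoc (w : ctx (sorts L)) n : tup M (ctx_pow w n) -> tup M w -> tup M (ctx_pow w n.+1) :=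
  match n return tup M (ctx_pow w n) -> tup M w -> tup M (ctx_pow w n.+1) with
  | 0 => fun x y => ecat x y
  | n.+1 => fun x y => ecat (lpart x) (snoc (rpart x) y)
  end.

Lemma epow_snoc w (b : nat -> tup M w) n :
  @epow _ (car M) w b n.+1 = snoc (@epow _ (car M) w b n) (b n.+1).
Proof. by elim: n b => [//|n IHn] b; exact: (congr1 (ecat (b 0)) (IHn (fun k => b k.+1))). Qed.

Lemma epow_ext w (b c : nat -> tup M w) n : (forall k, (k <= n)%N -> b k = c k) ->
  @epow _ (car M) w b n = @epow _ (car M) w c n.
Proof.
elim: n b c => [|n IHn] b c bc /=; first exact: bc.
by rewrite bc // (IHn _ (fun k => c k.+1)) // => k kn; exact: bc.
Qed.

Lemma term_fun_snoc u w n (f : tup M u -> tup M (ctx_pow w n)) (g : tup M u -> tup M w) :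
  (forall i, term_fun (fun e => f e i)) -> (forall i, term_fun (fun e => g e i)) ->
  forall i, term_fun (fun e => snoc (f e) (g e) i).
Proof.
elim: n f => [|n IHn] f tf tg; first by case=> i; [exact: tf|exact: tg].
case=> i /=; first exact: (tf (inl i)).
by apply: (IHn (fun e => rpart (f e))) => // k; exact: (tf (inr k)).
Qed.

Lemma coords_epow (S : set (elt M)) w (b : nat -> tup M w) n :
  (forall k, (k <= n)%N -> coords (b k) `<=` S) -> coords (@epow _ (car M) w b n) `<=` S.
Proof.
elim: n b => [|n IHn] b bS; first exact: bS.
apply/coordsS => -[i|i]; first exact: (coordsS (b 0) S).1 (bS 0 _) i.
by apply: (coordsS _ S).1 i; apply: (IHn (fun k => b k.+1)) => k kn; exact: bS.
Qed.

End PowerTuples.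

Lemma countable_pos (a : ishape) T (f : pos a -> T) : countable (range f).
Proof.
elim: a f => [||b IHb c IHc] f.
- by apply: (@sub_countable _ _ _ set0); rewrite ?countable0 //; apply: subset_card_le => _ [[]].
- apply: (@sub_countable _ _ _ [set f tt]); rewrite ?countable1 //.
  by apply: subset_card_le => _ [[] _ <-].
- apply: (@sub_countable _ _ _ (\bigcup_(k in [set: bool])
      (if k then range (fun i => f (inl i)) else range (fun i => f (inr i))))).
    apply: subset_card_le => _ [[i|i] _ <-]; [exists true|exists false] => //;
    by exists i.
  apply: bigcup_countable => [|[] _]; by [exact: countableP|exact: IHb|exact: IHc].
Qed.

Lemma countable_coords_seq L (M : structure L) w (l : seq (tup M w)) :
  countable [set e | exists2 y, List.In y l & coords y e].
Proof.
elim: l => [|y l IHl].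
  by apply: (@sub_countable _ _ _ set0); rewrite ?countable0 //; apply: subset_card_le => e [].
apply: (@sub_countable _ _ _ (\bigcup_(k in [set: bool]) (if k then coords y
    else [set e | exists2 y, List.In y l & coords y e]))).
  apply: subset_card_le => e [z [<-|zl] ze]; first by exists true.
  by exists false => //; exists z.
by apply: bigcup_countable => [|[] _ //]; [exact: countableP|exact: countable_pos].
Qed.

Section Homogeneity.
Context (L : lang) (M : structure L).

Lemma sat_automorphism (g : forall s, car M s -> car M s) : automorphism g ->
  forall w (p : fm w) (e : tup M w), sat p (emap g e) <-> sat p e.
Proof.
move=> [gbij gf gr].
have gE w s (t : term w s) (e : tup M w) : eval (emap g e) t = g s (eval e t).
  elim: t => //= u s' f t IH; rewrite gf; congr (fint f _).
  by apply: fext => i; exact: IH.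
move=> w p; elim: p => {w} [w s t t'|w u r t|w p IHp q IHq|w p IHp|w s p IHp] e /=.
- by rewrite !gE; split=> [|->//]; apply: bij_inj.
- by rewrite -[X in _ <-> X]gr; suff -> : (fun i => eval (emap g e) (t i)) =
    emap g (fun i => eval e (t i)) by []; apply: fext => i; exact: gE.
- by rewrite IHp IHq.
- by rewrite IHp.
have E x : econs (g s x) (emap g e) = emap g (econs x e) by apply: fext => -[].
split=> -[x]; last by rewrite -IHp -E => Hx; exists (g s x).
by have [h _ gK] := gbij s; rewrite -(gK x) E IHp => Hx; exists (h x).
Qed.

Lemma Elt_cast s s' (x : car M s) (y : car M s') :
  Elt x = Elt y <-> exists E : s = s', eq_rect s (car M) x s' E = y.
Proof.
split=> [E|[E <-]]; last by case: _ / E.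
by exists (projT1_eq E); exact: (projT2_eq E).
Qed.

Lemma term_fun_cast w s s' (E : s = s') (f : tup M w -> car M s) :
  term_fun f -> term_fun (fun e => eq_rect s (car M) (f e) s' E).
Proof. by case: _ / E. Qed.

(** Coordinates of distinct sorts are never equal as elements, and on a common sort equality is
    atomic after a cast. *)
Lemma pdf_Elt_eq (S : set (elt M)) w (i j : pos (shp w)) :
  pdf S (fun x : tup M w => Elt (x i) = Elt (x j)).
Proof.
have [E|nE] := pselect (w i = w j).
  apply: (@pdf_ext _ _ _ _ _ (fun x => eq_rect (w i) (car M) (x i) (w j) E = x j)) => [x|].
    rewrite Elt_cast; split=> [[E' <-]|<-]; last by exists E.
    by rewrite (Prop_irrelevance E' E).
  by apply/pdf_dfn/dfn_eq; [apply: term_fun_cast; exists (Tvar i)|exists (Tvar j)].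
apply: (@pdf_ext _ _ _ _ _ (fun _ => False)); last exact/pdf_dfn/dfn_const.
by move=> x; split=> // /Elt_cast [].
Qed.

Lemma pdf_Elt_param (S : set (elt M)) w (i : pos (shp w)) (c : elt M) :
  S c -> pdf S (fun x : tup M w => Elt (x i) = c).
Proof.
case: c => s y Sy; pose v := ctx_const Sh1 s; pose z : tup M v := fun _ => y.
apply: (@pdf_inst _ _ _ w v (fun x => Elt (x (inl i)) = Elt (x (inr tt))) z).
  exact: pdf_Elt_eq.
exact/coordsS.
Qed.

Context (G : set (elt M)).

Definition same_type w (x y : tup M w) : Prop := forall D, pdf G D -> D x -> D y.

Lemma same_type_sym w (x y : tup M w) : same_type x y -> same_type y x.
Proof.
by move=> xy D dD Dy; apply: contrapT => /(xy _ (pdf_not dD)); apply.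
Qed.

(** Strong homogeneity wants total functions, so the map sends [d'] to [d] and is the identity
    elsewhere. A statement on elements of [G] and coordinates of [d'] is rewritten as one over [G]
    on [d'] alone, and equality of types transfers it to [d]. *)
Lemma elementary_map w (d' d : tup M w) : same_type d' d ->
  exists f, [/\ elementary_on (G `|` coords d') f, forall s (x : car M s), G (Elt x) -> f s x = x &
    emap f d' = d].
Proof.
move=> d'd.
(* The tuple [d'] may repeat elements; the image is well defined because equalities between
   coordinates belong to the type and so hold in [d] too. *)
have F0 (e : elt M) : exists y : car M (projT1 e),
    (forall i, Elt (d' i) = e -> Elt (d i) = Elt y) /\
    (~ (exists i, Elt (d' i) = e) -> y = projT2 e).
  have [[i <-]|ne] := pselect (exists i, Elt (d' i) = e).
    exists (d i); split=> [j ji|[]]; last by exists i.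
    exact: (d'd _ (pdf_Elt_eq G j i)).
  by exists (projT2 e); split=> // i ie; case: ne; exists i.
pose f s (x : car M s) : car M s := projT1 (cid (F0 (Elt x))).
have fd s (x : car M s) i : Elt (d' i) = Elt x -> Elt (d i) = Elt (f s x).
  exact: (projT2 (cid (F0 (Elt x)))).1.
have f0 s (x : car M s) : ~ (exists i, Elt (d' i) = Elt x) -> f s x = x.
  exact: (projT2 (cid (F0 (Elt x)))).2.
have Einj s (x y : car M s) : Elt x = Elt y -> x = y.
  by move=> /Elt_cast [E <-]; rewrite (Prop_irrelevance E erefl).
have fG s (x : car M s) : G (Elt x) -> f s x = x.
  move=> Gx; have [[i iE]|/f0//] := pselect (exists i, Elt (d' i) = Elt x).
  by apply: Einj; rewrite -(fd _ _ _ iE); exact: (d'd _ (pdf_Elt_param i Gx)).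
exists f; split=> //; last by apply: fext => i; apply: Einj; rewrite -(fd _ (d' i) i).
move=> v a p aS.
(* States that [z] is the j-th coordinate of [a] after replacing the coordinates of [d'] by those of
   [x]. *)
pose C j (x : tup M w) (z : elt M) :=
  (forall i, Elt (d' i) = Elt (a j) -> z = Elt (x i)) /\
  ((exists i, Elt (d' i) = Elt (a j)) \/ z = Elt (a j)).
pose D (x : tup M w) := exists y : tup M v, sat p y /\ forall j, C j x (Elt (y j)).
have dD : pdf G D.
  apply: (@pdf_ex _ _ _ _ _ (fun y x => sat p y /\ forall j, C j x (Elt (y j)))).
  apply: pdf_and; first by apply/pdf_dfn; apply: (@dfn_comp _ _ _ _ (sat p)); [exact: dfn_sat|variable].
  apply: pdf_forall_pos => j; apply: pdf_and; last first.
    have [ex|nex] := pselect (exists i, Elt (d' i) = Elt (a j)).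
      by apply: (@pdf_ext _ _ _ _ _ (fun _ => True)); [tauto|exact/pdf_dfn/dfn_const].
    apply: (@pdf_ext _ _ _ _ _ (fun x : tup M (ctx_cat v w) => Elt (x (inl j)) = Elt (a j))).
      by move=> x; rewrite /lpart; tauto.
    apply: pdf_Elt_param; have [//|[i _ iE]] := (coordsS a _).1 aS j.
    by case: nex; exists i.
  apply: pdf_forall_pos => i; apply: pdf_impl; first exact/pdf_dfn/dfn_const.
  exact: (@pdf_Elt_eq G (ctx_cat v w) (inl j) (inr i)).
have Dd' : D d' <-> sat p a.
  split=> [[y [py yE]]|pa].
    suff <- : y = a by [].
    apply: fext => j; apply: Einj; have [y1 [[i iE]|//]] := yE j.
    by rewrite (y1 i iE).
  exists a; split=> // j; split=> [i ->//|]; by right.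
have Dd : D d <-> sat p (emap f a).
  split=> [[y [py yE]]|pa].
    suff <- : y = emap f a by [].
    apply: fext => j; apply: Einj; have [y1 y2] := yE j.
    have [[i iE]|ni] := pselect (exists i, Elt (d' i) = Elt (a j)).
      by rewrite (y1 i iE) (fd _ _ _ iE).
    by case: y2 => // ->; rewrite /emap f0.
  exists (emap f a); split=> // j; split=> [i /fd ->//|].
  have [ex|ni] := pselect (exists i, Elt (d' i) = Elt (a j)); first by left.
  by right; rewrite /emap f0.
by rewrite -Dd -Dd'; split; [exact: same_type_sym d'd _ dD|exact: d'd].
Qed.

End Homogeneity.

(** * Indiscernible sequences from averages along an ultrafilter *)

Section Saturation.
Context (L : lang) (M : structure L) (T : Type) (K : set T) (G : set (elt M)).
Hypothesis Minh : forall v, inhabited (@fm L v).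
Hypothesis Msat : succ_saturated K M.
Hypothesis Mhom : succ_strongly_homogeneous K M.
Hypothesis GK : forall S : set (elt M), countable S -> G `|` S #<= K.

Lemma realize_family (P : set (elt M)) w (F : (tup M w -> Prop) -> Prop) :
  P #<= K -> (forall D, F D -> pdf P D) ->
  (forall n (D : 'I_n -> tup M w -> Prop), (forall i, F (D i)) -> exists x, forall i, D i x) ->
  exists x, forall D, F D -> D x.
Proof.
move=> PK Fpdf Ffip.
pose q : set (pfm M w) := [set p | pover P p /\ exists2 D, F D & forall x, psat p x <-> D x].
have [|n p pq|x xq] := Msat PK (q := q); first by move=> p [].
  have pD i := (pq i).2; pose D i := projT1 (cid2 (pD i)).
  have FD i : F (D i) by rewrite /D; case: (cid2 (pD i)).
  have pE i x : psat (p i) x <-> D i x by rewrite /D; case: (cid2 (pD i)).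
  by have [x xD] := Ffip n D FD; exists x => i; apply/pE.
exists x => D FD; have [p [pP pE]] := pdf_pfm Minh (Fpdf _ FD).
by apply/pE/xq; split=> //; exists D.
Qed.

Lemma realize (P : set (elt M)) w (F : (tup M w -> Prop) -> Prop) :
  P #<= K -> (forall D, F D -> pdf P D) -> F (fun _ => True) ->
  (forall D E, F D -> F E -> F (fun x => D x /\ E x)) -> (forall D, F D -> exists x, D x) ->
  exists x, forall D, F D -> D x.
Proof.
move=> PK Fpdf FT FI Fx; apply: (realize_family PK Fpdf) => n D FD; apply: Fx.
elim: n D FD => [|n IHn] D FD.
  by have -> : (fun x => forall i, D i x) = fun _ => True
    by apply: funext => x; apply/propext; split=> // _ [].
have -> : (fun x => forall i, D i x) =
    (fun x => D ord0 x /\ forall i, D (lift ord0 i) x).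
  apply: funext => x; apply/propext; split=> [H|[H0 H] i]; first by split.
  by case: (unliftP ord0 i) => [k ->|->].
by apply: FI => //; apply: IHn => i; exact: FD.
Qed.

Section Average.
Context (w : ctx (sorts L)) (a : nat -> tup M w) (U : set_system nat).
Hypothesis UU : UltraFilter U.
Hypothesis Uinf : forall m, U [set k | (m <= k)%N].

Let base : set (elt M) := G `|` \bigcup_k coords (a k).
Let coords_seq (l : seq (tup M w)) : set (elt M) :=
  [set e | exists2 y, List.In y l & coords y e].

Lemma base_card l : base `|` coords_seq l #<= K.
Proof.
rewrite /base -setUA; apply: GK.
have cs : countable (coords_seq l) := countable_coords_seq l.
apply: (@sub_countable _ _ _ (\bigcup_(k in [set: bool])
    (if k then \bigcup_k coords (a k) else coords_seq l))).
  by apply: subset_card_le => e [ae|le]; [exists true|exists false].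
apply: bigcup_countable => [|[] _ //]; first exact: countableP.
by apply: bigcup_countable => [|k _]; [exact: countableP|exact: countable_pos].
Qed.

Lemma average_realized l : exists x,
  forall D, pdf (base `|` coords_seq l) D -> U [set k | D (a k)] -> D x.
Proof.
have [||D E [dD UD] [dE UE]|D [_ UD]|x xF] := realize
  (F := fun D => pdf (base `|` coords_seq l) D /\ U [set k | D (a k)]) (base_card l).
- by move=> D [].
- by split; [exact/pdf_dfn/dfn_const|exact: filterT].
- by split; [exact: pdf_and|exact: filterI].
- by have [k Dk] := filter_ex UD; exists (a k).
by exists x => D dD UD; exact: xF.
Qed.

Let next l : tup M w := projT1 (cid (average_realized l)).
Let nextP l D : pdf (base `|` coords_seq l) D -> U [set k | D (a k)] -> D (next l).
Proof. exact: (projT2 (cid (average_realized l))). Qed.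

Fixpoint history n : seq (tup M w) :=
  match n with 0 => [::] | n.+1 => next (history n) :: history n end.

(* The average type of [a] is finitely satisfiable in [a], hence invariant over [base]: its
   Morley sequences are indiscernible, and no appeal to Ramsey's theorem is needed. *)
Definition morley n : tup M w := next (history n).

Let upto n := base `|` coords_seq (history n).

Lemma morley_upto k n : (k < n)%N -> coords (morley k) `<=` upto n.
Proof.
move=> kn e ke; right; exists (morley k) => //.
elim: n kn => // n IHn; rewrite ltnS leq_eqVlt => /orP[/eqP ->|/IHn]; first by left.
by right.
Qed.

(** An ultrafilter decides each definable set, so the average type is complete. *)
Lemma morleyP n D : pdf (upto n) D -> D (morley n) <-> U [set k | D (a k)].
Proof.
move=> dD; split=> [Dn|]; last exact: nextP.
have [//|nD] := in_ultra_setVsetC [set k | D (a k)] UU.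
by have := nextP (pdf_not dD) nD; rewrite -/(morley n).
Qed.

Let base_upto n : base `<=` upto n. Proof. by move=> e; left. Qed.

Let coords_a k : coords (a k) `<=` base.
Proof. by move=> e ke; right; exists k. Qed.

Lemma pdf_snoc_last n (S : set (elt M)) (D : tup M (ctx_pow w n.+1) -> Prop) x :
  pdf S D -> coords x `<=` S -> pdf S (fun y => D (snoc x y)).
Proof.
move=> dD xS.
apply: (@pdf_inst _ _ _ _ _ (fun e : tup M (ctx_cat w (ctx_pow w n)) =>
  D (snoc (rpart e) (lpart e)))) xS.
by apply: pdf_comp dD _; apply: term_fun_snoc; variable.
Qed.

Lemma pdf_snoc_init n (S : set (elt M)) (D : tup M (ctx_pow w n.+1) -> Prop) y :
  pdf S D -> coords y `<=` S -> pdf S (fun x => D (snoc x y)).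
Proof.
move=> dD yS.
apply: (@pdf_inst _ _ _ _ _ (fun e : tup M (ctx_cat (ctx_pow w n) w) =>
  D (snoc (lpart e) (rpart e)))) yS.
by apply: pdf_comp dD _; apply: term_fun_snoc; variable.
Qed.

(** By [morleyP] the last term can be traded for terms [a l] of the original sequence, which are
    parameters in [base]; the condition left on the earlier terms is over [base], and the induction
    applies to it. *)
Lemma morley_indiscernible n (D : tup M (ctx_pow w n) -> Prop) : pdf base D ->
  forall i j : nat -> nat, {homo i : x y / (x < y)%N} -> {homo j : x y / (x < y)%N} ->
    D (@epow _ (car M) w (morley \o i) n) <-> D (@epow _ (car M) w (morley \o j) n).
Proof.
elim: n D => [|n IHn] D dD i j ii jj.
  by rewrite !(morleyP (pdf_mono (base_upto _) dD)).
have step k : {homo k : x y / (x < y)%N} ->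
    D (@epow _ (car M) w (morley \o k) n.+1) <->
    U [set l | D (snoc (@epow _ (car M) w (morley \o k) n) (a l))].
  move=> kk; rewrite epow_snoc; apply: (@morleyP _ (fun y => D (snoc _ y))).
  apply: pdf_snoc_last; first exact: pdf_mono (base_upto _) dD.
  apply: coords_epow => m mn; apply: morley_upto; exact: kk.
rewrite !step //.
suff -> : [set l | D (snoc (@epow _ (car M) w (morley \o i) n) (a l))] =
          [set l | D (snoc (@epow _ (car M) w (morley \o j) n) (a l))] by [].
apply/seteqP; split=> l /=; apply: (iffLR (IHn (fun x => D (snoc x (a l))) _ _ _ _ _)) => //;
  exact: pdf_snoc_init.
Qed.

(** The last term of a Morley tuple is replaced first, by some [a k], and each earlier term can then
    be taken with a larger index: this is why patterns pass from [a] to [morley] along decreasing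
    indices. *)
Definition decreasing_upto n (i : nat -> nat) :=
  forall x y, (x < y)%N -> (y <= n)%N -> (i y < i x)%N.

Lemma morley_EM n (D : tup M (ctx_pow w n) -> Prop) m : pdf base D ->
  (forall i, decreasing_upto n i -> (m <= i n)%N -> D (@epow _ (car M) w (a \o i) n)) ->
  D (@epow _ (car M) w morley n).
Proof.
elim: n D m => [|n IHn] D m dD Da.
  apply/(morleyP (pdf_mono (base_upto _) dD)); apply: filterS (Uinf m) => k mk.
  by apply: (Da (fun _ => k)) mk => x y xy; rewrite leqn0 => /eqP y0; rewrite y0 in xy.
rewrite epow_snoc; apply/(@morleyP _ (fun y => D (snoc _ y))).
  apply: pdf_snoc_last; first exact: pdf_mono (base_upto _) dD.
  by apply: coords_epow => k kn; exact: morley_upto.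
apply: filterS (Uinf m) => k mk /=.
(* The bound k + 1 forces the indices of the earlier terms above [k]. *)
apply: (IHn (fun x => D (snoc x (a k))) k.+1); first exact: pdf_snoc_init.
move=> i di ki; pose i' x := if (x <= n)%N then i x else k.
have -> : snoc (@epow _ (car M) w (a \o i) n) (a k) = @epow _ (car M) w (a \o i') n.+1.
  rewrite epow_snoc /= {2}/i' ltnn; congr (snoc _ _).
  by apply: epow_ext => x xn; rewrite /= /i' xn.
apply: Da; last by rewrite /i' ltnn.
move=> x y xy yn; rewrite /i'; have xn : (x <= n)%N by rewrite -ltnS; exact: leq_trans yn.
rewrite xn; case: (leqP y n) => [yn'|ny]; first exact: di.
apply: leq_trans ki _; move: xn; rewrite leq_eqVlt => /orP[/eqP -> //|xn].
exact/ltnW/di.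
Qed.

End Average.

(** The first term of the Morley sequence only has the type of [d] over [G]; an automorphism over
    [G] moves it to [d]. It need not fix the [a k], but parameter-free patterns survive. *)
Theorem indiscernible_extraction w (d : tup M w) (a : nat -> tup M w) :
  (forall k, same_type G d (a k)) ->
  exists b : nat -> tup M w, [/\ b 0 = d, indiscernible G b &
    forall n (D : tup M (ctx_pow w n) -> Prop), dfn D ->
      (forall i, decreasing_upto n i -> D (@epow _ (car M) w (a \o i) n)) ->
      D (@epow _ (car M) w b n)].
Proof.
move=> da; have [U [UU Uinf]] := nat_nonprincipal_ultrafilter.
pose c := morley a UU.
have d0 : same_type G (c 0) d.
  apply: same_type_sym => D dD Dd; apply/(@morleyP _ a U UU 0).
    by apply: pdf_mono dD => e Ge; left; left.
  by apply: filterS (Uinf 0) => k _; exact: da.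
have [f [fel fG fd]] := elementary_map d0.
have [|g [gaut gf]] := Mhom _ fel; first by apply: GK; exact: countable_pos.
have gG s (x : car M s) : G (Elt x) -> g s x = x.
  by move=> Gx; rewrite gf ?fG //; left.
have epowg i n : @epow _ (car M) w ((fun k => emap g (c k)) \o i) n =
    emap g (@epow _ (car M) w (c \o i) n).
  elim: n i => [//|n IHn] i.
  by apply: fext => -[k|k] //; exact: (congr1 (fun e => e k) (IHn (fun k => i k.+1))).
exists (fun k => emap g (c k)); split.
- rewrite -fd; apply: fext => i; apply: gf; right; by exists i.
- move=> n v p e eG i j ii jj; rewrite !epowg.
  have eE : e = emap g e by apply: fext => k; rewrite /emap gG //; exact: (coordsS e G).1 eG k.
  have E x : ecat (emap g x) e = emap g (ecat x e) by rewrite emap_ecat -eE.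
  rewrite !E !(sat_automorphism gaut).
  apply: (@morley_indiscernible _ a U UU n (fun x => sat p (ecat x e))) => //.
  apply: pdf_inst; first exact/pdf_dfn/dfn_sat.
  by move=> y /eG; left.
- move=> n D dD aD; have := epowg id n; rewrite /= => ->.
  have := @morley_EM _ a U UU Uinf n D 0 (pdf_dfn _ dD) (fun i di _ => aD i di).
  by have [p pE] := dfn_fm (Minh _) dD; rewrite -!pE (sat_automorphism gaut).
Qed.

End Saturation.

(** * Dividing and imaginaries *)

Section Dividing.
Context (L : lang) (M : structure L).

Lemma indiscernible_pdf (P : set (elt M)) w (b : nat -> tup M w) : indiscernible P b ->
  forall n (D : tup M (ctx_pow w n) -> Prop), pdf P D ->
  forall i j : nat -> nat, {homo i : x y / (x < y)%N} -> {homo j : x y / (x < y)%N} ->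
    D (@epow _ (car M) w (b \o i) n) <-> D (@epow _ (car M) w (b \o j) n).
Proof.
move=> bI n D [v [c [Q [cP [[p pE]|[B QB]] DE]]]] i j ii jj; rewrite !DE.
  by rewrite -!pE; exact: bI.
by rewrite !QB.
Qed.

Lemma indiscernible_term (P : set (elt M)) w (b : nat -> tup M w) : indiscernible P b ->
  forall D, pdf P D -> forall k, D (b k) <-> D (b 0).
Proof.
move=> bI D dD k; apply: (@indiscernible_pdf _ _ _ bI 0 D dD (fun x => x + k)%N id) => // x y.
by rewrite ltn_add2r.
Qed.

(** The instance at [b 0] belongs to tp(m/Q), so an inconsistent initial segment would witness
    dividing. A predicate of the constant kind in [dfn] may have no formula, but there [m] itself is
    a solution. *)
Lemma not_divides_consistent (U Q P : set (elt M)) : ~ set_tp_divides U Q P ->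
  forall wm wd (m : tup M wm) (F : tup M (ctx_cat wm wd) -> Prop) (b : nat -> tup M wd),
    coords m `<=` U -> coords (b 0) `<=` Q -> dfn F -> F (ecat m (b 0)) ->
    indiscernible P b -> forall n, exists x, forall k, (k <= n)%N -> F (ecat x (b k)).
Proof.
move=> ndiv wm wd m F b mU bQ [[p pE]|[B FB]] Fm bI n; last first.
  by exists m => k _; apply/FB; exact: (FB _).1 Fm.
apply: contrapT => incons; apply: ndiv; exists wm, m; split=> //.
exists (Pfm p (b 0)); split.
  exists 1, (fun _ => Pfm p (b 0)); split=> [_|x /(_ ord0) //].
  by split=> //; rewrite /psat /= pE.
exists b; split=> // cons; apply: incons.
have [i|x xP] := cons n.+1 (fun i : 'I_n.+1 => Pfm p (b i)); first by exists i.
by exists x => k kn; rewrite -pE; exact: (xP (Ordinal (kn : (k < n.+1)%N))).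
Qed.

End Dividing.

Fixpoint epow_map S S' (car : S -> Type) (car' : S' -> Type) (w : ctx S) (w' : ctx S')
    (F : env car w -> env car' w') n : env car (ctx_pow w n) -> env car' (ctx_pow w' n) :=
  match n return env car (ctx_pow w n) -> env car' (ctx_pow w' n) with
  | 0 => F
  | n.+1 => fun x => ecat (F (lpart x)) (epow_map F (rpart x))
  end.

Lemma epow_map_epow S S' (car : S -> Type) (car' : S' -> Type) (w : ctx S) (w' : ctx S')
    (F : env car w -> env car' w') (b : nat -> env car w) n :
  epow_map F (@epow _ car w b n) = @epow _ car' w' (fun k => F (b k)) n.
Proof.
by elim: n b => [//|n IHn] b; exact: (congr1 (ecat (F (b 0))) (IHn (fun k => b k.+1))).
Qed.

(** Parameters [c] from [P] may enter the term functions: this allows translations by elements over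
    Gamma without losing indiscernibility. *)
Lemma indiscernible_reduct L' L (h : lmap L' L) (M : structure L) (P : set (elt M)) w
    (b : nat -> tup M w) w' v (c : tup M v) (f : tup M (ctx_cat w v) -> tup (reduct h M) w') :
  indiscernible P b -> coords c `<=` P ->
  (forall i, @term_fun _ M (ctx_cat w v) (h (w' i)) (fun e => f e i)) ->
  indiscernible [set x : elt (reduct h M) | P (red_elt x)] (fun k => f (ecat (b k) c)).
Proof.
move=> bI cP tf n v' p c' c'P i j ii jj.
pose N := reduct h M.
pose D (X : tup M (ctx_pow w n)) := sat (M := N) p (ecat (epow_map (fun x => f (ecat x c)) X) c').
have DE k : D (@epow _ (car M) w (b \o k) n) <->
    sat p (ecat (@epow _ (car N) w' ((fun k => f (ecat (b k) c)) \o k) n) c').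
  by rewrite /D epow_map_epow.
rewrite -!DE; apply: (indiscernible_pdf bI) => //.
have tpm m u (X : tup M u -> tup M (ctx_pow w m)) (d : tup M u -> tup M v) :
    (forall k, term_fun (fun e => X e k)) -> (forall k, term_fun (fun e => d e k)) ->
    forall k, @term_fun _ M u (h (ctx_pow w' m k))
      (fun e => epow_map (fun x => f (ecat x (d e))) (X e) k).
  elim: m X => [|m IHm] X tX td; last first.
    case=> k /=; last by apply: (IHm (fun e => rpart (X e))) => // l; exact: (tX (inr l)).
    by apply: (term_fun_comp (tf k)) => -[l|l]; [exact: (tX (inl l))|exact: td].
  by move=> k; apply: (term_fun_comp (tf k)) => -[l|l]; [exact: tX|exact: td].
apply: (@pdf_inst _ _ _ (ctx_pow w n) v (fun e =>
  sat (M := N) p (ecat (epow_map (fun x => f (ecat x (rpart e))) (lpart e)) c'))) => //.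
apply: (@pdf_inst _ _ _ (ctx_cat (ctx_pow w n) v) (ctx_map h v') (fun e =>
  sat (M := N) p (ecat (epow_map (fun x => f (ecat x (rpart (lpart e)))) (lpart (lpart e)))
    (rpart e)))); last by apply/coordsS => k; exact: (coordsS c' _).1 c'P k.
apply/pdf_dfn/(@dfn_reduct _ _ h M _ (sat p)); first exact: dfn_sat.
case=> k; last by move: k; variable.
by apply: tpm; variable.
Qed.

(** * Formulas of M^eq read on real tuples *)

Section Imaginaries.
Context (L : lang) (M : structure L).

(* A description of an element of M^eq by terms in real variables. *)
Definition rep (w : ctx (sorts L)) (s : sorts (Leq M)) : Type :=
  match s with inl s => term w s | inr E => forall k, @term L w (eqctx E k) end.

Definition repval w (e : tup M w) s : rep w s -> car (Meq M) s :=
  match s return rep w s -> car (Meq M) s with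
  | inl s => fun t => eval e t
  | inr E => fun t => class_of (E := E) (fun k => eval e (t k))
  end.

Definition rsub (w u : ctx (sorts L)) (t : forall i : pos (shp w), @term L u (w i)) s : rep w s -> rep u s :=
  match s return rep w s -> rep u s with
  | inl _ => fun r => tsub t r
  | inr _ => fun r k => tsub t (r k)
  end.

Lemma repval_rsub (w u : ctx (sorts L)) (t : forall i : pos (shp w), @term L u (w i)) s (r : rep w s) (e : tup M u) :
  repval e (rsub t r) = repval (fun i => eval e (t i)) r.
Proof.
case: s r => [s|E] r /=; first exact: eval_tsub.
by congr class_of; apply: fext => k; exact: eval_tsub.
Qed.

Lemma class_of_eq (E : Defs.eqrel M) (x y : tup M (eqctx E)) :
  class_of (E := E) x = class_of (E := E) y <-> E x y.
Proof.
split=> [/(congr1 (@sval _ _))/= H|Exy].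
  have : [set z | E y z] y by exact: eqr_refl.
  by rewrite -H.
apply: eq_exist; apply/seteqP; split=> z /=; last exact: eqr_trans.
exact/eqr_trans/eqr_sym.
Qed.

Lemma class_of_surj (E : Defs.eqrel M) (X : eqclass E) : exists x, X = class_of (E := E) x.
Proof. by case: X => X [x XE]; exists x; exact: eq_exist. Qed.

(** No function symbol of M^eq takes an imaginary argument, so a term is a real term, an imaginary
    variable, or the class of a tuple of real terms. *)
Lemma rep_term w' w s (t : @term (Leq M) w s) (th : forall i, rep w' (w i)) :
  exists r : rep w' s, forall e : tup M w',
    repval e r = eval (M := Meq M) (fun i => repval e (th i)) t.
Proof.
elim: t => [i|u s' f t IH]; first by exists (th i).
pose r i := projT1 (cid (IH i)).
have rE i e : repval e (r i) = eval (M := Meq M) (fun i => repval e (th i)) (t i).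
  exact: (projT2 (cid (IH i))).
case: u s' / f t {IH} r rE => [u s' f|u s' f] t r rE.
  exists (Tapp f r) => e /=; congr (fint f _).
  by apply: fext => i; exact: rE.
case: u s' / f t r rE => E t r rE.
exists r => e /=; congr class_of.
by apply: fext => i; exact: rE.
Qed.

(** A quantifier over classes becomes one over representatives, and equality of classes becomes the
    formula that defines the relation. *)
Lemma rep_fm w (p : @fm (Leq M) w) : forall w' (th : forall i, rep w' (w i)),
  exists q : fm w', forall e : tup M w',
    sat q e <-> sat (M := Meq M) p (fun i => repval e (th i)).
Proof.
elim: p => {w} [w s t t'|w u r t|w p IHp q IHq|w p IHp|w s p IHp] w' th.
- have [[r rE] [r' rE']] := (rep_term t th, rep_term t' th).
  case: s t t' r rE r' rE' => [s|E] t t' r rE r' rE'.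
    by exists (Feq r r') => e /=; rewrite -rE -rE'.
  have [p pE] := eqr_def E.
  pose t2 (i : pos (shp (ctx_cat (eqctx E) (eqctx E)))) : term w' (ctx_cat (eqctx E) (eqctx E) i) :=
    match i with inl k => r k | inr k => r' k end.
  have [q [_ qE]] := fm_subst p t2.
  exists q => e; rewrite qE /= -rE -rE' /= class_of_eq pE.
  suff -> : ecat (fun k => eval e (r k)) (fun k => eval e (r' k)) =
    fun i => eval e (t2 i) by [].
  by apply: fext => -[].
- case: u / r t => [u r t|u []].
  pose r' i := projT1 (cid (rep_term (t i) th)).
  exists (Frel r r') => e /=.
  suff -> : (fun i => eval e (r' i)) =
    fun i => eval (M := Meq M) (fun i => repval e (th i)) (t i) by [].
  by apply: fext => i; exact: (projT2 (cid (rep_term (t i) th))).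
- by have [[p' Hp] [q' Hq]] := (IHp w' th, IHq w' th); exists (Fand p' q') => e /=; rewrite Hp Hq.
- by have [p' Hp] := IHp w' th; exists (Fnot p') => e /=; rewrite Hp.
case: s p IHp => [s|E] p IHp.
  pose W := ctx_cons s w'.
  pose wk : forall s', rep w' s' -> rep W s' := rsub (fun i => @Tvar _ W (inr i)).
  pose th' (i : pos (shp (ctx_cons (inl s) w))) : rep W (ctx_cons (inl s) w i) :=
    match i return rep W (ctx_cons (inl s) w i) with
    | inl tt => @Tvar _ W (inl tt) | inr k => wk _ (th k) end.
  have [q qE] := IHp W th'; exists (Fex q) => e /=.
  have E x : (fun i => repval (econs x e) (th' i)) =
      @econs _ (car (Meq M)) (inl s) w x (fun i => repval e (th i)).
    by apply: fext => -[[]|k] //=; exact: repval_rsub.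
  by split=> -[x] Hx; exists x; move: Hx; rewrite qE E.
pose W := ctx_cat (eqctx E) w'.
pose wk : forall s', rep w' s' -> rep W s' := rsub (fun i => @Tvar _ W (inr i)).
pose th' (i : pos (shp (ctx_cons (inr E) w))) : rep W (ctx_cons (inr E) w i) :=
  match i return rep W (ctx_cons (inr E) w i) with
  | inl tt => fun k => @Tvar _ W (inl k) | inr k => wk _ (th k) end.
have [q qE] := IHp W th'; have [q' [_ q'E]] := fm_exs q; exists q' => e; rewrite q'E /=.
have thE x : (fun i => repval (ecat x e : tup M W) (th' i)) =
    @econs _ (car (Meq M)) (inr E) w (class_of (E := E) x) (fun i => repval e (th i)).
  by apply: fext => -[[]|k] //=; exact: repval_rsub.
split=> [[x Hx]|[X]].
  by exists (class_of (E := E) x); move: Hx; rewrite qE thE.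
by have [x ->] := class_of_surj X => Hx; exists x; rewrite qE thE.
Qed.

Lemma rep_ctx (w : ctx (sorts (Leq M))) : exists (w' : ctx (sorts L)) (th : forall i, rep w' (w i)),
  forall d : tup (Meq M) w, exists e : tup M w', (fun i => repval e (th i)) = d.
Proof.
pose W i : ctx (sorts L) := match w i with inl s => ctx_const Sh1 s | inr E => eqctx E end.
have [V [x Hx]] := family_ctx W.
pose r s (W0 := match s with inl s => ctx_const Sh1 s | inr E => eqctx E end) :
    (forall k, varof V (W0 k)) -> rep V s :=
  match s return (forall k, varof V (match s with inl s => ctx_const Sh1 s
    | inr E => eqctx E end k)) -> rep V s with
  | inl s => fun y => tvar (y tt) | inr E => fun y k => tvar (y k) end.
have rE s (y : forall k, varof V (match s with inl s => ctx_const Sh1 s | inr E => eqctx E end k)) :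
  forall d : car (Meq M) s, exists e0 : tup M (match s with inl s => ctx_const Sh1 s | inr E => eqctx E end),
  forall e : tup M V, (fun k => vget e (y k)) = e0 -> repval e (r s y) = d.
  case: s y => [s|E] y d.
    by exists (fun _ => d) => e /(congr1 (fun f => f tt)) /=; rewrite eval_tvar.
  have [z ->] := class_of_surj d; exists z => e <- /=; congr class_of.
  by apply: fext => k; rewrite eval_tvar.
exists V, (fun i => r _ (x i)) => d.
pose e0 i := projT1 (cid (rE _ (x i) (d i))).
have [e [eE _]] := Hx _ e0; exists e; apply: fext => i.
by apply: (projT2 (cid (rE _ (x i) (d i)))); apply: fext => k; exact: eE.
Qed.

Lemma real_elt_inj (x y : elt M) : real_elt x = real_elt y -> x = y.
Proof.
pose f (z : elt (Meq M)) : option (elt M) :=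
  match z with existT s c => match s return car (Meq M) s -> option (elt M) with
  | inl s => fun c => Some (@Elt _ M s c) | inr E => fun _ => None end c end.
by case: x => s x; case: y => s' y /(congr1 f) [].
Qed.

(** A context whose sorts are all real equals some [ctx_map inl w'] only propositionally; an
    induction principle avoids transporting tuples along that equality. *)
Lemma real_tuple_ind (S : set (elt M)) (P : forall w, tup (Meq M) w -> Prop) :
  (forall w' (c : tup M w'), coords c `<=` S -> P (ctx_map inl w') c) ->
  forall w (c : tup (Meq M) w), coords c `<=` @real_elt _ M @` S -> P w c.
Proof.
move=> HP w; case: w => a f c cS.
have H i : exists s, f i = inl s.
  by have [[s x] _ /(congr1 (@projT1 _ _)) /= <-] := (coordsS c _).1 cS i; exists s.
pose g i := projT1 (cid (H i)).
have fE : f = fun i => inl (g i) by apply: fext => i; exact: (projT2 (cid (H i))).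
case: _ / (esym fE) c cS => c cS.
apply: (HP (Ctx g) c); apply/coordsS => i /=.
by have [x Sx /(@real_elt_inj x (@Elt _ M (g i) (c i))) <-] := (coordsS c _).1 cS i.
Qed.

Lemma dfn_rep w w' (Q : tup (Meq M) w -> Prop) (g : tup M w' -> tup (Meq M) w) : dfn Q ->
  (forall i, exists r : rep w' (w i), forall e, g e i = repval e r) -> dfn (fun e => Q (g e)).
Proof.
move=> [[p pE]|[b Qb]] gr; last by right; exists b => e; rewrite Qb.
have [q qE] := rep_fm p (fun i => projT1 (cid (gr i))).
left; exists q => e; rewrite qE -pE.
suff -> : g e = fun i => repval e (projT1 (cid (gr i))) by [].
by apply: fext => i; exact: (projT2 (cid (gr i))).
Qed.

Lemma pdf_real (S : set (elt M)) w w' (D : tup (Meq M) w -> Prop)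
    (g : tup M w' -> tup (Meq M) w) :
  pdf (dcl (@real_elt _ M @` S)) D ->
  (forall i, exists r : rep w' (w i), forall e, g e i = repval e r) ->
  pdf S (fun e => D (g e)).
Proof.
move=> /pdf_dcl [v [c [Q [cS dQ DE]]]] gr.
move: v c cS Q dQ DE; apply: real_tuple_ind => v c cS Q dQ DE.
exists v, c, (fun e => Q (@ecat _ (car (Meq M)) w (ctx_map inl v) (g (lpart e)) (rpart e))).
split=> //; apply: dfn_rep dQ _ => -[i|i]; last by exists (@Tvar _ (ctx_cat w' v) (inr i)).
have [r rE] := gr i.
exists (rsub (fun k => @Tvar _ (ctx_cat w' v) (inl k)) r) => e.
by rewrite repval_rsub -rE.
Qed.

Lemma sat_real w (p : fm w) (e : tup M w) :
  @sat L (reduct (expand_incl _) (Meq M)) w p e <-> sat p e.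
Proof. by case: M p e. Qed.

Lemma dfn_real w (Q : tup M w -> Prop) : dfn Q -> @dfn _ (Meq M) (ctx_map inl w) Q.
Proof.
move=> [[p pE]|[b Qb]]; last by right; exists b.
apply: (@dfn_reduct _ _ (expand_incl _) (Meq M) w Q (ctx_map inl w) id); last by variable.
by left; exists p => e; rewrite sat_real pE.
Qed.

Lemma pdf_real_lift (S : set (elt M)) w (D : tup M w -> Prop) :
  pdf S D -> @pdf _ (Meq M) (@real_elt _ M @` S) (ctx_map inl w) D.
Proof.
move=> [v [c [Q [cS dQ DE]]]]; exists (ctx_map inl v), c.
exists (fun e : tup (Meq M) (ctx_cat (ctx_map inl w) (ctx_map inl v)) =>
  Q (@ecat _ (car M) w v (lpart e) (rpart e))); split=> //.
  by apply/coordsS => i; exists (Elt (c i)); first exact: (coordsS c _).1 cS i.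
by apply: (dfn_comp (dfn_real dQ)) => -[]; variable.
Qed.

(** The shapes [empty_shape n] have no positions but differ from one another, and [nesting] tells
    them apart; they yield infinitely many sorts of M^eq with one element. *)
Fixpoint nesting (a : ishape) : nat := match a with ShU _ c => (nesting c).+1 | _ => 0 end.

Fixpoint empty_shape n : ishape := match n with 0 => Sh0 | n.+1 => ShU Sh0 (empty_shape n) end.

Lemma nesting_empty_shape n : nesting (empty_shape n) = n.
Proof. by elim: n => //= n ->. Qed.

Lemma pos_empty_shape n : pos (empty_shape n) -> False.
Proof. by elim: n => [[]|n IHn] [[]|]. Qed.

Definition empty_ctx (n : nat) : ctx (sorts L) :=
  Ctx (shp := empty_shape n) (fun i => match @pos_empty_shape _ i with end).

Lemma trivial_relation_def (Minh : forall v, inhabited (@fm L v)) n :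
  exists p : fm (ctx_cat (empty_ctx n) (empty_ctx n)),
    forall x y : tup M (empty_ctx n), True <-> sat p (ecat x y).
Proof.
by have [p pE] := dfn_fm (Minh (ctx_cat (empty_ctx n) (empty_ctx n))) (@dfn_const _ M _ True); exists p => x y; rewrite pE.
Qed.

(* The sorts of M^eq of these relations have one element each, hence every definably
   closed subset of M^eq is infinite. *)
Definition trivial_relation (Minh : forall v, inhabited (@fm L v)) n : Defs.eqrel M :=
  @EqRel _ M (empty_ctx n) (fun _ _ => True) (fun _ => I) (fun _ _ _ => I)
    (fun _ _ _ _ _ => I) (trivial_relation_def Minh n).

Lemma countable_union_card (Minh : forall v, inhabited (@fm L v)) (D : set (elt (Meq M)))
    (S : set (elt M)) : D = dcl D -> countable S ->
  [set x | D (real_elt x)] `|` S #<= D.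
Proof.
move=> DD /countable_injP [g ginj].
have [[x0 _]|nox] := pselect (exists x : elt M, True); last first.
  by apply: (@card_le_trans _ _ _ set0); [apply: subset_card_le => x; case: nox; exists x|exact: card_ge0].
pose E n := trivial_relation Minh n.
pose e0 n : tup M (eqctx (E n)) := fun i => match @pos_empty_shape _ i with end.
have starD n : D (@Elt _ (Meq M) (inr (E n)) (class_of (E := E n) (e0 n))).
  rewrite DD.
  pose w0 : ctx (sorts (Leq M)) := Ctx (shp := Sh0) (fun i : void => match i with end).
  pose W : ctx (sorts (Leq M)) := ctx_cons (inr (E n)) w0.
  exists w0, (fun i : void => match i with end), (Feq (@Tvar (Leq M) W (inl tt)) (@Tvar (Leq M) W (inl tt))).
  split=> [_ [[]]|y]; split=> // _; have [z ->] := class_of_surj y.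
  exact/class_of_eq.
pose fs n : elt M := match pselect (exists s, S s /\ g s = n) with
  | left h => projT1 (cid h) | right _ => x0 end.
(* Maps [D] onto a set containing the union: real elements are kept, and the element of the n-th
   one-point sort goes to the member of [S] numbered [n], or to the filler [x0]. *)
pose f (y : elt (Meq M)) : elt M :=
  match y with existT s c => match s return car (Meq M) s -> elt M with
  | inl s => fun c => @Elt _ M s c
  | inr E => fun _ => fs (nesting (shp (eqctx E))) end c end.
apply: (@card_le_trans _ _ _ (f @` D)); last exact: card_image_le.
apply: subset_card_le => x [Dx|Sx]; first by exists (real_elt x) => //; case: x Dx.
exists (@Elt _ (Meq M) (inr (E (g x))) (class_of (E := E (g x)) (e0 (g x)))) => //=.
rewrite nesting_empty_shape /fs; case: pselect => [h|[]]; last by exists x.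
by have [Sh gh] := projT2 (cid h); apply: ginj => //; exact/mem_set.
Qed.

End Imaginaries.

Section Closed.
Context (L : lang) (M : structure L).

Lemma dcl_func_closed (D : set (elt (Meq M))) : D = dcl D -> func_closed [set x | D (real_elt x)].
Proof.
move=> DD u s f a aD; rewrite /= DD.
pose W : ctx (sorts (Defs.Leq M)) := ctx_cons (inl s) (ctx_map inl u).
exists (ctx_map inl u), a, (Feq (@Tvar (Defs.Leq M) W (inl tt))
  (@Tapp (Defs.Leq M) W (ctx_map inl u) (inl s) (@Efunc L _ u s f)
    (fun i => @Tvar (Defs.Leq M) W (inr i)))).
split=> [|y]; last by split.
by apply/coordsS => i; exact: (coordsS a _).1 aD i.
Qed.

Lemma generated_closed (X : set (elt M)) : func_closed (generated X) /\ X `<=` generated X.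
Proof.
split=> [u s f a aX V [Vf XV]|]; last exact: sub_gen_smallest.
by apply: (Vf _ _ f) => x /aX /(_ V (conj Vf XV)).
Qed.

End Closed.

(** * Dividing passes from a stably embedded reduct to M^eq *)

Section Lift.
Context (L0 L : lang) (h : lmap L0 L) (M : structure L).

Definition eq_incl : lmap L0 (Defs.Leq M) := lcomp h (expand_incl _).

Lemma rep_epow_map w n (i : pos (shp (ctx_pow (ctx_map eq_incl w) n))) :
  exists r : rep (M := M) (ctx_map h (ctx_pow w n)) (ctx_pow (ctx_map eq_incl w) n i),
    forall X : tup (reduct h M) (ctx_pow w n),
      @epow_map _ _ (car (reduct h M)) (car (Meq M)) w (ctx_map eq_incl w) (fun x => x) n X i =
      @repval _ M (ctx_map h (ctx_pow w n)) X _ r.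
Proof.
elim: n i => [|n IHn] i; first by exists (@Tvar _ (ctx_map h w) i).
case: i => i; first by exists (@Tvar _ (ctx_map h (ctx_pow w n.+1)) (inl i)).
have [r rE] := IHn i.
exists (@rsub _ M (ctx_map h (ctx_pow w n)) (ctx_map h (ctx_pow w n.+1))
  (fun k => @Tvar _ (ctx_map h (ctx_pow w n.+1)) (inr k)) _ r) => X.
by rewrite repval_rsub; exact: rE.
Qed.

Context (U Delta Gamma : set (elt (Meq M))).
Let G : set (elt M) := [set x | Gamma (real_elt x)].
Hypothesis Gamma_real : Gamma = dcl (@real_elt _ M @` G).
(* The reduct is stably embedded, and its induced structure over [G] is the one over the
   elements of [G] in the reduct. *)
Hypothesis embedded : forall w (D : tup M (ctx_map h w) -> Prop),
  pdf G D -> @pdf _ (reduct h M) [set x | G (red_elt x)] w D.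

(** A formula over Gamma becomes one over [G] by [Gamma_real], then one of the reduct by [embedded]:
    M^eq sees no more on the sequence than the reduct does. *)
Lemma indiscernible_lift w (b : nat -> tup (reduct h M) w) :
  indiscernible [set x : elt (reduct h M) | G (red_elt x)] b ->
  @indiscernible _ (Meq M) Gamma (ctx_map eq_incl w) b.
Proof.
move=> bI n v p c cG i j ii jj.
pose F (X : tup (reduct h M) (ctx_pow w n)) : tup (Meq M) (ctx_pow (ctx_map eq_incl w) n) :=
  @epow_map _ _ (car (reduct h M)) (car (Meq M)) w (ctx_map eq_incl w) (fun x => x) n X.
have FE k : @epow _ (car (Meq M)) (ctx_map eq_incl w) (b \o k) n =
    F (@epow _ (car (reduct h M)) w (b \o k) n) by rewrite /F epow_map_epow.
rewrite !FE; apply: (indiscernible_pdf bI (D := fun X => sat p (ecat (F X) c))) => //.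
apply: embedded; apply: (@pdf_real _ M G _ (ctx_map h (ctx_pow w n)) (fun Y => sat p (ecat Y c))).
  by rewrite -/G -Gamma_real; apply: pdf_inst cG; exact/pdf_dfn/dfn_sat.
exact: rep_epow_map.
Qed.

Lemma lift_fm w v (q : @fm L0 (ctx_cat w v)) :
  exists q' : @fm (Defs.Leq M) (ctx_cat (ctx_map eq_incl w) (ctx_map eq_incl v)),
  forall (x : tup (reduct h M) w) (y : tup (reduct h M) v),
    @sat _ (Meq M) _ q' (@ecat _ (car (Meq M)) (ctx_map eq_incl w) (ctx_map eq_incl v) x y) <->
    sat q (ecat x y).
Proof.
pose W : ctx (sorts (Defs.Leq M)) := ctx_cat (ctx_map eq_incl w) (ctx_map eq_incl v).
pose t (i : pos (shp (ctx_cat w v))) : @term (Defs.Leq M) W (eq_incl (ctx_cat w v i)) :=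
  match i return @term (Defs.Leq M) W (eq_incl (ctx_cat w v i)) with
  | inl i => @Tvar (Defs.Leq M) W (inl i) | inr i => @Tvar (Defs.Leq M) W (inr i) end.
have [q' qE] := @definable_inst _ _ eq_incl (Meq M) _ q W t; exists q' => x y.
rewrite qE; suff -> : (fun i => eval (M := Meq M)
  (@ecat _ (car (Meq M)) (ctx_map eq_incl w) (ctx_map eq_incl v) x y) (t i)) =
  @ecat _ (car (reduct h M)) w v x y by [].
by apply: fext => -[].
Qed.

Lemma divides_lift : set_tp_divides
    [set x : elt (reduct h M) | U (real_elt (red_elt x))]
    [set x : elt (reduct h M) | Delta (real_elt (red_elt x))]
    [set x : elt (reduct h M) | Gamma (real_elt (red_elt x))] ->
  set_tp_divides U Delta Gamma.
Proof.
move=> [w [u [uU [r [[n [p [pu pr]]] [b [b0 bI ncons]]]]]]].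
pose lp (q : pfm (reduct h M) w) : pfm (Meq M) (ctx_map eq_incl w) :=
  @Pfm _ (Meq M) (ctx_map eq_incl w) (ctx_map eq_incl (pvar q)) (projT1 (cid (lift_fm (pfml q))))
    (ppar q).
have lpE q x : psat (lp q) x <-> psat q x by exact: (projT2 (cid (lift_fm (pfml q)))).
exists (ctx_map eq_incl w), u; split.
  by apply/coordsS => i; exact: (coordsS u _).1 uU i.
exists (lp r); split.
  exists n, (fun i => lp (p i)); split=> [i|x xp]; last first.
    by apply/lpE/pr => i; apply/lpE.
  have [pD pui] := pu i; split; last exact/lpE.
  by apply/coordsS => k; exact: (coordsS (ppar (p i)) _).1 pD k.
exists b; split=> //; first exact: indiscernible_lift.
move=> cons; apply: ncons => m q qb.
have [|x xq] := cons m (fun i => lp (q i)).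
  by move=> i; have [k _ <-] := qb i; exists k.
by exists x => i; apply/lpE.
Qed.

End Lift.

(** * Stable embeddedness of A^* and C^* *)

Section Embedded.
Context (L : ablang) (Phi : set (ppfm L)) (XA : ext (Lquo Phi)) (XC : ext L).
Context (M : structure (Lseq XA XC)).
Local Notation LA := (LA XA).
Local Notation LC := (LC XC).
Local Notation triple := (triple M).
Implicit Types (wA : ctx (sorts LA)) (wB : ctx (sorts L)) (wC : ctx (sorts LC)).

Lemma partsE (D : set (elt (Meq M))) : parts D = [set x | D (real_elt x)].
Proof.
apply/seteqP; split=> [x [[[y Dy <-]|[y Dy <-]]|[y Dy <-]] //|[[s|s|s] x] Dx].
- by left; left; exists (@Elt _ (strA' M) s x).
- by left; right; exists (@Elt _ (strB M) s x).
- by right; exists (@Elt _ (strC' M) s x).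
Qed.

Definition in_triple (S : set (elt M)) wA wB wC (x : triple wA wB wC) : Prop :=
  [/\ forall i, S (@Elt _ M (InA XC (wA i)) (x.1.1 i)),
      forall i, S (@Elt _ M (InB XA XC (wB i)) (x.1.2 i)) &
      forall i, S (@Elt _ M (InC XA (wC i)) (x.2 i))].

(** Distributes the coordinates of a tuple among the three kinds of sorts, so that quantifier
    elimination, stated for triples, applies to any tuple of M. *)
Lemma triple_ctx (w : ctx (sorts (Lseq XA XC))) :
  exists wA wB wC (th : forall i, sterm wA wB wC (w i)),
  forall e : tup M w, exists x : triple wA wB wC, sevals th x = e /\
    forall S : set (elt M), coords e `<=` S -> in_triple S x.
Proof.
pose noctx T : ctx T := Ctx (shp := Sh0) (fun i : void => match i with end).
pose WA i : ctx (sorts LA) := match w i with InA s => ctx_const Sh1 s | _ => noctx _ end.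
pose WB i : ctx (sorts L) := match w i with InB s => ctx_const Sh1 s | _ => noctx _ end.
pose WC i : ctx (sorts LC) := match w i with InC s => ctx_const Sh1 s | _ => noctx _ end.
have [VA [xA HA]] := family_ctx WA; have [VB [xB HB]] := family_ctx WB.
have [VC [xC HC]] := family_ctx WC.
pose th s : (forall k, varof VA (match s with InA s => ctx_const Sh1 s | _ => noctx _ end k)) ->
    (forall k, varof VB (match s with InB s => ctx_const Sh1 s | _ => noctx _ end k)) ->
    (forall k, varof VC (match s with InC s => ctx_const Sh1 s | _ => noctx _ end k)) ->
    sterm VA VB VC s :=
  match s return (forall k, varof VA (match s with InA s => ctx_const Sh1 s | _ => noctx _ end k)) ->
    (forall k, varof VB (match s with InB s => ctx_const Sh1 s | _ => noctx _ end k)) ->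
    (forall k, varof VC (match s with InC s => ctx_const Sh1 s | _ => noctx _ end k)) ->
    sterm VA VB VC s with
  | InA s => fun y _ _ => tvar (y tt)
  | InB s => fun _ y _ => tvar (y tt)
  | InC s => fun _ _ y => tvar (y tt) end.
exists VA, VB, VC, (fun i => th (w i) (xA i) (xB i) (xC i)) => e.
pose fA s (c : car M s) : tup (strA' M) (match s with InA s => ctx_const Sh1 s | _ => noctx _ end) :=
  match s return car M s -> tup (strA' M) (match s with InA s => ctx_const Sh1 s | _ => noctx _ end)
  with InA s => fun c _ => c | InB _ => fun _ (i : void) => match i with end
  | InC _ => fun _ (i : void) => match i with end end c.
pose fB s (c : car M s) : tup (strB M) (match s with InB s => ctx_const Sh1 s | _ => noctx _ end) :=
  match s return car M s -> tup (strB M) (match s with InB s => ctx_const Sh1 s | _ => noctx _ end)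
  with InB s => fun c _ => c | InA _ => fun _ (i : void) => match i with end
  | InC _ => fun _ (i : void) => match i with end end c.
pose fC s (c : car M s) : tup (strC' M) (match s with InC s => ctx_const Sh1 s | _ => noctx _ end) :=
  match s return car M s -> tup (strC' M) (match s with InC s => ctx_const Sh1 s | _ => noctx _ end)
  with InC s => fun c _ => c | InA _ => fun _ (i : void) => match i with end
  | InB _ => fun _ (i : void) => match i with end end c.
have [a [aE aF]] := HA (car (strA' M)) (fun i => fA _ (e i)).
have [b [bE bF]] := HB (car (strB M)) (fun i => fB _ (e i)).
have [c [cE cF]] := HC (car (strC' M)) (fun i => fC _ (e i)).
exists (a, b, c); split.
  apply: fext => i; rewrite /sevals; move: (aE i) (bE i) (cE i).
  rewrite /WA /WB /WC; move: (xA i) (xB i) (xC i); rewrite /WA /WB /WC.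
  by case: (w i) (e i) => s d /= yA yB yC EA EB EC; rewrite eval_tvar ?EA ?EB ?EC.
move=> S eS; split=> k.
- have := aF k; rewrite /WA => -[i [l E]].
  have := (coordsS e S).1 eS i.
  move: l E; case: (w i) (e i) => s d l; try by case: l.
  move=> E; suff -> : @Elt _ M (InA XC (VA k)) (a k) = @Elt _ M (InA XC s) d by [].
  exact: (congr1 (fun z : elt (strA' M) => red_elt (h := inclA XA XC) (M := M) z) E).
- have := bF k; rewrite /WB => -[i [l E]].
  have := (coordsS e S).1 eS i.
  move: l E; case: (w i) (e i) => s d l; try by case: l.
  move=> E; suff -> : @Elt _ M (InB XA XC (VB k)) (b k) = @Elt _ M (InB XA XC s) d by [].
  exact: (congr1 (fun z : elt (strB M) => red_elt (h := inclB XA XC) (M := M) z) E).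
- have := cF k; rewrite /WC => -[i [l E]].
  have := (coordsS e S).1 eS i.
  move: l E; case: (w i) (e i) => s d l; try by case: l.
  move=> E; suff -> : @Elt _ M (InC XA (VC k)) (c k) = @Elt _ M (InC XA (XC := XC) s) d by [].
  exact: (congr1 (fun z : elt (strC' M) => red_elt (h := inclC XA XC) (M := M) z) E).
Qed.

Section ClosedSet.
Context (G : set (elt M)) (Gfc : func_closed G).

Lemma closed_evalB wB (b : tup (strB M) wB) s (t : term wB s) :
  (forall i, G (@Elt _ M (InB XA XC (wB i)) (b i))) -> G (@Elt _ M (InB XA XC s) (eval b t)).
Proof.
move=> bG; elim: t => [i|u s' f t IH] //.
apply: (Gfc (FB XA XC f) (a := fun i => eval b (t i))); exact/coordsS.
Qed.

Lemma closed_nu s (b : car (strB M) s) :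
  G (@Elt _ M (InB XA XC s) b) -> G (@Elt _ M (InC XA (inl s)) (nu_map b)).
Proof. by move=> bG; apply: (Gfc (SyNu XA XC s)); apply/coordsS. Qed.

Lemma closed_rho p (b : tup (strB M) (pp_ctx (sval p))) :
  (forall i, G (@Elt _ M (InB XA XC (pp_ctx (sval p) i)) (b i))) ->
  G (@Elt _ M (InA XC (sort_quo XA p)) (rho_map b)).
Proof. by move=> bG; apply: (Gfc (SyRho XA XC p)); apply/coordsS. Qed.

Definition inA : set (elt (strA' M)) := [set x | G (red_elt x)].
Definition inC : set (elt (strC' M)) := [set x | G (red_elt x)].

(** Once the other arguments are fixed, the C^*-part of each disjunct is a mere truth value, and the
    new parameters of the A^*-part are values of [rho], which stay in [G] as it is closed under
    functions. *)
Lemma sep_pdfA w wA wB wC (P : triple (ctx_cat w wA) wB wC -> Prop) (x : triple wA wB wC) :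
  in_triple G x -> separable P -> pdf inA (fun a : tup (strA' M) w => P (ecat a x.1.1, x.1.2, x.2)).
Proof.
move=> [xA xB xC]; move: P; apply: dnf_ind => [P P' PP'|b|P P' dP dP'|P P'].
- by apply: pdf_ext => a; rewrite PP'.
- exact/pdf_dfn/dfn_const.
- apply: pdf_ext (pdf_not (pdf_and (pdf_not dP) (pdf_not dP'))) => a.
  rewrite not_andE !notE; tauto.
move=> [I [phi [t [Q [dQ QP]]]]] [Q' [_ QP']].
apply: (pdf_ext (E := fun a => Q (ecat (ecat a x.1.1) (rhos t x.1.2)) /\
    Q' (ecat x.2 (nus x.1.2)))) => [a|]; first by rewrite QP QP'.
apply: pdf_and; last exact/pdf_dfn/dfn_const.
apply: (@pdf_inst _ _ _ _ _ (fun e => Q (ecat e (rhos t x.1.2)))) => //.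
  apply: pdf_inst; first exact: pdf_dfn.
  apply/coordsS => j; apply: closed_rho => k; exact: closed_evalB.
by apply/coordsS.
Qed.

Lemma sep_pdfC w wA wB wC (P : triple wA wB (ctx_cat w wC) -> Prop) (x : triple wA wB wC) :
  in_triple G x -> separable P -> pdf inC (fun c : tup (strC' M) w => P (x.1, ecat c x.2)).
Proof.
move=> [xA xB xC]; move: P; apply: dnf_ind => [P P' PP'|b|P P' dP dP'|P P'].
- by apply: pdf_ext => a; rewrite PP'.
- exact/pdf_dfn/dfn_const.
- apply: pdf_ext (pdf_not (pdf_and (pdf_not dP) (pdf_not dP'))) => a.
  rewrite not_andE !notE; tauto.
move=> [I [phi [t [Q [_ QP]]]]] [Q' [dQ' QP']].
apply: (pdf_ext (E := fun c => Q (ecat x.1.1 (rhos t x.1.2)) /\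
    Q' (ecat (ecat c x.2) (nus x.1.2)))) => [c|]; first by rewrite QP QP'.
apply: pdf_and; first exact/pdf_dfn/dfn_const.
apply: (@pdf_inst _ _ _ _ _ (fun e => Q' (ecat e (nus x.1.2)))) => //.
  apply: pdf_inst; first exact: pdf_dfn.
  by apply/coordsS => j; exact: closed_nu.
by apply/coordsS.
Qed.

Hypothesis HM : expanded_pure_ses M.
Hypothesis HPhi : fundamental_system Phi (strB M).

Lemma embeddedA w (D : tup M (ctx_map (inclA XA XC) w) -> Prop) :
  pdf G D -> @pdf _ (strA' M) inA w D.
Proof.
move=> [v [c [Q [cG [[q qE]|[b bE]] DE]]]]; last first.
  by apply: pdf_dfn; right; exists b => e; rewrite DE bE.
have [vA [vB [vC [th H]]]] := triple_ctx v.
have [x [xc xG]] := H c; have {}xG := xG _ cG.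
pose wk (i : pos (shp v)) : sterm (ctx_cat w vA) vB vC (v i) := swkA w (th i).
pose th' (i : pos (shp (ctx_cat (ctx_map (inclA XA XC) w) v))) :
    sterm (ctx_cat w vA) vB vC (ctx_cat (ctx_map (inclA XA XC) w) v i) :=
  match i with inl k => @Tvar _ (ctx_cat w vA) (inl k) | inr k => wk k end.
apply: pdf_ext (sep_pdfA xG (sep_sat HM HPhi q th')) => a.
rewrite DE -qE.
suff -> : sevals th' (ecat a x.1.1, x.1.2, x.2) =
  @ecat _ (car M) (ctx_map (inclA XA XC) w) v a c by [].
apply: fext => -[k|k] //; rewrite -xc.
exact: seval_swkA.
Qed.

Lemma embeddedC w (D : tup M (ctx_map (inclC XA XC) w) -> Prop) :
  pdf G D -> @pdf _ (strC' M) inC w D.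
Proof.
move=> [v [c [Q [cG [[q qE]|[b bE]] DE]]]]; last first.
  by apply: pdf_dfn; right; exists b => e; rewrite DE bE.
have [vA [vB [vC [th H]]]] := triple_ctx v.
have [x [xc xG]] := H c; have {}xG := xG _ cG.
pose wk (i : pos (shp v)) : sterm vA vB (ctx_cat w vC) (v i) := swkC w (th i).
pose th' (i : pos (shp (ctx_cat (ctx_map (inclC XA XC) w) v))) :
    sterm vA vB (ctx_cat w vC) (ctx_cat (ctx_map (inclC XA XC) w) v i) :=
  match i with inl k => @Tvar _ (ctx_cat w vC) (inl k) | inr k => wk k end.
apply: pdf_ext (sep_pdfC xG (sep_sat HM HPhi q th')) => a.
rewrite DE -qE.
suff -> : sevals th' (x.1, ecat a x.2) =
  @ecat _ (car M) (ctx_map (inclC XA XC) w) v a c by [].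
apply: fext => -[k|k] //; rewrite -xc.
exact: seval_swkC.
Qed.

End ClosedSet.
End Embedded.

Fixpoint epow_all S (car : S -> Type) (w : ctx S) (F : env car w -> Prop) n :
    env car (ctx_pow w n) -> Prop :=
  match n return env car (ctx_pow w n) -> Prop with
  | 0 => F
  | n.+1 => fun X => F (lpart X) /\ epow_all F (rpart X)
  end.

Lemma epow_allP S (car : S -> Type) (w : ctx S) (F : env car w -> Prop) n b :
  epow_all F (@epow _ car w b n) <-> forall k, (k <= n)%N -> F (b k).
Proof.
elim: n b => [|n IHn] b.
  by split=> [Fb k|]; [rewrite leqn0 => /eqP ->|apply].
split=> [[F0 /(IHn (fun k => b k.+1)) H] [|k] // /H //|H].
by split; [exact: (H 0)|apply/(IHn (fun k => b k.+1)) => k kn; exact: H].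
Qed.

Lemma dfn_epow_all L (M : structure L) u v w n (F : tup M (ctx_cat v w) -> Prop)
    (g : tup M u -> tup M v) (X : tup M u -> tup M (ctx_pow w n)) : dfn F ->
  (forall i, term_fun (fun e => g e i)) -> (forall i, term_fun (fun e => X e i)) ->
  dfn (fun e => epow_all (fun y => F (ecat (g e) y)) (X e)).
Proof.
move=> dF tg; elim: n X => [|n IHn] X tX; first by apply: dfn_comp dF _ => -[].
apply: dfn_and.
  by apply: dfn_comp dF _ => -[i|i]; [exact: tg|exact: (tX (inl i))].
by apply: (IHn (fun e => rpart (X e))) => i; exact: (tX (inr i)).
Qed.

(** * Real sequences from dividing and from non-algebraic classes *)

Section RealSequences.
Context (L : lang) (M : structure L) (Gamma Delta : set (elt (Meq M))).
Let G : set (elt M) := [set x | Gamma (real_elt x)].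
Hypothesis Minh : forall v, inhabited (@fm L v).
Hypothesis Msat : succ_saturated Delta M.
Hypothesis Mhom : succ_strongly_homogeneous Delta M.
Hypothesis GD : forall S : set (elt M), countable S -> G `|` S #<= Delta.

(** A finite inconsistent subset sits inside the first n + 1 terms, and indiscernibility carries the
    inconsistency to every increasing choice of indices. *)
Lemma inconsistent_increasing w (r : pfm (Meq M) w) (e : nat -> tup (Meq M) (pvar r)) :
  indiscernible Gamma e -> ~ consistent (range (fun k => Pfm (pfml r) (e k))) ->
  exists n, forall i, {homo i : x y / (x < y)%N} ->
    ~ exists x, forall k, (k <= n)%N -> sat (pfml r) (ecat x (e (i k))).
Proof.
move=> eI ncons.
have [m [p [pr np]]] : exists m (p : 'I_m -> pfm (Meq M) w),
    (forall i, range (fun k => Pfm (pfml r) (e k)) (p i)) /\ ~ exists x, forall i, psat (p i) x.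
  apply: contrapT => H; apply: ncons => m p pr; apply: contrapT => np; apply: H.
  by exists m, p.
pose k i := projT1 (cid2 (pr i)).
have kE i : Pfm (pfml r) (e (k i)) = p i by rewrite /k; case: (cid2 (pr i)).
pose n := \max_(i < m) k i; exists n => i ii [x xi].
apply: np.
have D0 : dfn (fun Y : tup (Meq M) (ctx_pow (pvar r) n) =>
    exists x : tup (Meq M) w, epow_all (fun y => sat (pfml r) (ecat x y)) Y).
  by apply: dfn_ex; apply: (@dfn_epow_all _ (Meq M) _ w (pvar r) n (sat (pfml r)) (fun e => lpart e)
      (fun e => rpart e)); [exact: dfn_sat|variable|variable].
have := indiscernible_pdf eI (pdf_dfn Gamma D0) ii (j := id) (fun _ _ h => h).
case=> + _; case; first by exists x; apply/epow_allP.
move=> x' /epow_allP xk; exists x' => j; rewrite -kE; apply: xk.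
exact: leq_bigmax.
Qed.

(** The sequence [e] is replaced by real tuples [a k] of the type of [d] over [G] such that P(x, a
    k) implies the formula at [e k]. An indiscernible sequence is extracted from [a]; it inherits
    the inconsistency, which holds along every decreasing choice of indices. *)
Lemma dividing_sequence w wd (P : tup M (ctx_cat w wd) -> Prop) (d : tup M wd)
    (r : pfm (Meq M) (ctx_map inl w)) : dfn P ->
  (forall x, P (ecat x d) -> psat r x) -> fm_divides Gamma r ->
  exists b : nat -> tup M wd, [/\ b 0 = d, indiscernible G b &
    exists n, forall x, ~ forall k, (k <= n)%N -> P (ecat x (b k))].
Proof.
move=> dP Pr [e [e0 eI ncons]].
have [n incons] := inconsistent_increasing eI ncons.
have [v [th thE]] := rep_ctx (pvar r).
pose R k (y : tup M wd) := forall x : tup M w, P (ecat x y) -> sat (pfml r) (@ecat _ (car (Meq M)) (ctx_map inl w) _ x (e k)).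
have ea k : exists y, same_type G d y /\ R k y.
  have [c cE] := thE (e k).
  pose S := G `|` coords c.
  have SD : S #<= Delta by apply: GD; exact: countable_pos.
  have dR : pdf S (R k).
    apply: (@pdf_ext _ _ _ _ _ (fun y => forall x : tup M w, P (ecat x y) ->
      sat (pfml r) (@ecat _ (car (Meq M)) (ctx_map inl w) _ x (fun i => repval c (th i))))).
      by move=> y; rewrite cE.
    apply: (@pdf_inst _ _ _ _ v (fun z => forall x : tup M w, P (ecat x (lpart z)) ->
      sat (pfml r) (@ecat _ (car (Meq M)) (ctx_map inl w) _ x
        (fun i => repval (rpart z) (th i))))); last by move=> y; right.
    apply/pdf_dfn/(@dfn_all _ _ _ _ (fun x z => P (ecat x (lpart z)) ->
      sat (pfml r) (@ecat _ (car (Meq M)) (ctx_map inl w) _ x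
        (fun i => repval (rpart z) (th i))))).
    apply: dfn_impl; first by apply: dfn_comp dP _ => -[]; variable.
    apply: (@dfn_rep _ M _ _ (sat (pfml r)) (fun z : tup M (ctx_cat w (ctx_cat wd v)) =>
      @ecat _ (car (Meq M)) (ctx_map inl w) _ (lpart z) (fun i => repval (rpart (rpart z)) (th i))));
      first exact: dfn_sat.
    case=> i.
      by exists (@Tvar _ (ctx_cat w (ctx_cat wd v)) (inl i)).
    exists (@rsub _ M _ _ (fun j => @Tvar _ (ctx_cat w (ctx_cat wd v)) (inr (inr j))) _ (th i)) => z.
    by rewrite repval_rsub.
  (* The filter generated by the type of [d] over [G] and the condition [R k]. *)
  pose F D := pdf S D /\ exists D0 : tup M wd -> Prop,
    [/\ pdf G D0, D0 d & forall y, D0 y -> R k y -> D y].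
  have [||D E [dD [D0 [d0 D0d H0]]] [dE [E0 [dE0 E0d HE0]]]|D [dD [D0 [d0 D0d H0]]]|y yF] :=
    realize Minh Msat (F := F) SD.
  - by move=> D [].
  - split; first exact/pdf_dfn/dfn_const.
    by exists (fun _ => True); split=> //; exact/pdf_dfn/dfn_const.
  - split; first exact: pdf_and.
    exists (fun y => D0 y /\ E0 y); split=> // [|y [D0y E0y] Rky]; first exact: pdf_and.
    by split; [exact: H0|exact: HE0].
  - suff [y [D0y Rky]] : exists y, D0 y /\ R k y by exists y; exact: H0.
    (* The tuple [d] witnesses this condition at [e 0]; being over Gamma, the condition passes to
       [e k]. *)
    pose K (z : tup (Meq M) (pvar r)) := exists y : tup M wd, D0 y /\
      forall x : tup M w, P (@ecat _ (car M) w wd x y) -> sat (pfml r) (@ecat _ (car (Meq M)) (ctx_map inl w) _ x z).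
    suff dK : pdf Gamma K.
      apply/(indiscernible_term eI dK k); exists d; split=> // x Px.
      by rewrite e0; exact: Pr.
    apply: (@pdf_ex _ (Meq M) Gamma (pvar r) (ctx_map inl wd) (fun (y : tup (Meq M) (ctx_map inl wd)) z => D0 y /\
      forall x : tup M w, P (@ecat _ (car M) w wd x y) -> sat (pfml r) (@ecat _ (car (Meq M)) (ctx_map inl w) _ x z))).
    apply: pdf_and.
      apply: (@pdf_comp _ (Meq M) _ _ (ctx_map inl wd) D0); last by variable.
      apply: pdf_mono (pdf_real_lift d0) => _ [y Gy <-]; exact: Gy.
    apply: (@pdf_all _ (Meq M) Gamma _ (ctx_map inl w) (fun (x : tup (Meq M) (ctx_map inl w)) (z : tup (Meq M) (ctx_cat (ctx_map inl wd) (pvar r))) =>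
      P (@ecat _ (car M) w wd x (lpart z)) -> sat (pfml r) (@ecat _ (car (Meq M)) (ctx_map inl w) _ x (rpart z)))).
    apply: pdf_impl; apply: pdf_dfn.
      by apply: (dfn_comp (dfn_real dP)) => -[]; variable.
    apply: (@dfn_comp _ (Meq M) (ctx_cat (ctx_map inl w) (ctx_cat (ctx_map inl wd) (pvar r))) _
      (sat (pfml r)) (fun e => ecat (lpart e) (rpart (rpart e)))); first exact: dfn_sat.
    by case; variable.
  exists y; split=> [D dD Dd|].
    apply: yF; split; first by apply: pdf_mono dD => z; left.
    by exists D.
  by apply: yF; split=> //; exists (fun _ => True); split=> //; exact/pdf_dfn/dfn_const.
pose a k := projT1 (cid (ea k)).
have [aT aR] : (forall k, same_type G d (a k)) /\ forall k, R k (a k).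
  by split=> k; case: (projT2 (cid (ea k))).
have [b [b0 bI bEM]] := indiscernible_extraction Minh Msat Mhom GD aT.
exists b; split=> //; exists n => x xb.
have dD : dfn (fun Y : tup M (ctx_pow wd n) => ~ exists x, epow_all (fun y => P (ecat x y)) Y).
  apply/dfn_not/dfn_ex.
  by apply: (@dfn_epow_all _ M _ w wd n P (fun e => lpart e) (fun e => rpart e)) => //; variable.
apply: (bEM _ _ dD); last by exists x; apply/epow_allP.
move=> i di [x' /epow_allP xa].
(* Read backwards, the decreasing indices increase up to [n]; the values beyond [n] only serve to
   make [i'] increasing on all naturals. *)
pose i' k := if (k <= n)%N then i (n - k)%N else (i 0 + k)%N.
apply: (incons i').
  move=> k l kl; rewrite /i'; case: (leqP l n) => [ln|nl].
    have kn : (k <= n)%N by exact: leq_trans (ltnW kl) ln.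
    rewrite kn; apply: di; last exact: leq_subr.
    by rewrite ltn_sub2l // (leq_trans kl).
  case: (leqP k n) => kn; last by rewrite ltn_add2l.
  apply: (@leq_ltn_trans (i 0)); last by rewrite -[X in (X < _)%N]addn0 ltn_add2l (leq_ltn_trans _ nl).
  have [->//|] := posnP (n - k)%N.
  by move=> /di /(_ (leq_subr _ _)) /ltnW.
exists x' => k kn; rewrite /i' kn.
by apply: aR; apply: xa; exact: leq_subr.
Qed.

(** As the class of [d] is not algebraic, finitely many classes never cover a set in the type of [d]
    over [G]; this gives infinitely many pairwise inequivalent realizations, from which the sequence
    is extracted. *)
Lemma infinite_class_sequence (E : Defs.eqrel M) (d : tup M (eqctx E)) :
  ~ acl Gamma (@Elt _ (Meq M) (inr E) (class_of d)) ->
  exists b : nat -> tup M (eqctx E), [/\ b 0 = d, indiscernible G b & ~ E (b 0) (b 1)].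
Proof.
move=> nacl.
have [q qE] := eqr_def E.
have dE : dfn (fun e : tup M (ctx_cat (eqctx E) (eqctx E)) => E (lpart e) (rpart e)).
  by left; exists q => e; rewrite qE ecat_parts.
have next (l : seq (tup M (eqctx E))) : exists y, same_type G d y /\ forall z, List.In z l -> ~ E z y.
  pose S : set (elt M) := G `|` [set e | exists2 y, List.In y l & coords y e].
  pose R y := forall z, List.In z l -> ~ E z y.
  have SD : S #<= Delta by apply: GD; exact: countable_coords_seq.
  have dR : pdf S R.
    have lS z : List.In z l -> coords z `<=` S by move=> zl e ez; right; exists z.
    rewrite /R; move: lS; move: (S) => S'; elim: (l) => [|z0 l' IHl] lS.
      by apply: (@pdf_ext _ _ _ _ _ (fun _ => True)) => //; exact/pdf_dfn/dfn_const.
    apply: (@pdf_ext _ _ _ _ _ (fun y => ~ E z0 y /\ forall z, List.In z l' -> ~ E z y)).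
      move=> y; split=> [H|[H0 H] z [<-|]] //; last exact: H.
      by split=> [|z zl]; apply: H; [left|right].
    apply: pdf_and; last by apply: IHl => z zl; apply: lS; right.
    apply: (@pdf_not _ _ _ _ (fun y => E z0 y)).
    apply: (@pdf_inst _ _ _ _ _ (fun e => E (rpart e) (lpart e))); last by apply: lS; left.
    by apply/pdf_dfn; apply: (dfn_comp (g := fun e => ecat (rpart e) (lpart e)) dE) => -[]; variable.
  pose F D := pdf S D /\ exists D0 : tup M (eqctx E) -> Prop,
    [/\ pdf G D0, D0 d & forall y, D0 y -> R y -> D y].
  have [||D D' [dD [D0 [d0 D0d H0]]] [dD' [D0' [d0' D0d' H0']]]|D [dD [D0 [d0 D0d H0]]]|y yF] :=
    realize Minh Msat (F := F) SD.
  - by move=> D [].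
  - split; first exact/pdf_dfn/dfn_const.
    by exists (fun _ => True); split=> //; exact/pdf_dfn/dfn_const.
  - split; first exact: pdf_and.
    exists (fun y => D0 y /\ D0' y); split=> // [|y [D0y D0y'] Ry]; first exact: pdf_and.
    by split; [exact: H0|exact: H0'].
  (* Otherwise [D0] meets only classes of members of [l], and the classes meeting [D0] form a finite
     set over Gamma that contains the class of [d]. *)
  - apply: contrapT => nD; apply: nacl.
    have D0l y : D0 y -> exists2 z, List.In z l & class_of z = class_of (E := E) y.
      move=> D0y; apply: contrapT => H; apply: nD; exists y; apply: H0 => // z zl Ezy.
      by apply: H; exists z => //; exact/class_of_eq.
    pose c1 : ctx (sorts (Defs.Leq M)) := ctx_const Sh1 (inr E).
    pose D1 (Y : tup (Meq M) c1) := exists y : tup M (eqctx E), D0 y /\ Y tt = class_of y.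
    have [v [c [Q [cG dQ QD]]]] : pdf Gamma D1.
      apply: (@pdf_ex _ (Meq M) Gamma c1 (ctx_map inl (eqctx E)) (fun (y : tup (Meq M) (ctx_map inl (eqctx E))) Y =>
        D0 y /\ Y tt = class_of (E := E) y)).
      apply: pdf_and.
        apply: (@pdf_comp _ (Meq M) _ _ (ctx_map inl (eqctx E)) D0); last by variable.
        by apply: pdf_mono (pdf_real_lift d0) => _ [y Gy <-]; exact: Gy.
      apply/pdf_dfn/dfn_eq; first by move: tt; variable.
      exists (@Tapp (Defs.Leq M) (ctx_cat (ctx_map inl (eqctx E)) c1) (ctx_map inl (eqctx E)) (inr E)
        (@Exfunc _ (@Ext L (Defs.eqrel M) (@proj_func L M) (fun _ => void)) _ _ (Proj E))
        (fun i => @Tvar (Defs.Leq M) (ctx_cat (ctx_map inl (eqctx E)) c1) (inl i))).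
      by [].
    have inh : inhabited (@fm (Defs.Leq M) (ctx_cat c1 v)).
      by constructor; apply: (Feq (@Tvar (Defs.Leq M) (ctx_cat c1 v) (inl tt))
        (@Tvar (Defs.Leq M) (ctx_cat c1 v) (inl tt))).
    have [f fE] := dfn_fm inh dQ; exists v, c, f; split=> //.
      by apply/fE/(QD (fun _ => class_of d)); exists d.
    apply: (@sub_finite_set _ _ [set class_of (E := E) z | z in [set z | List.In z l]]).
      move=> Y /fE/(QD (fun _ => Y)) [y [D0y ->]].
      by have [z zl <-] := D0l y D0y; exists z.
    apply: finite_image; elim: (l) => [|z l' IHl]; first by apply: sub_finite_set (finite_set0 _).
    apply: (@sub_finite_set _ _ ([set z] `|` [set z | List.In z l'])).
      by move=> z' [->|]; [left|right].
    by rewrite finite_setU; split=> //; exact: finite_set1.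
  exists y; split=> [D dD Dd|].
    apply: (yF D); split; first by apply: pdf_mono dD => z; left.
    by exists D.
  apply: (yF R); split=> //; exists (fun _ => True); split=> //; exact/pdf_dfn/dfn_const.
pose nx l := projT1 (cid (next l)).
pose fix history n := match n with 0 => [::] | n.+1 => nx (history n) :: history n end.
pose a n := nx (history n).
have [aT aN] : (forall k, same_type G d (a k)) /\ forall k z, List.In z (history k) -> ~ E z (a k).
  by split=> k; case: (projT2 (cid (next (history k)))).
have aE i j : (i < j)%N -> ~ E (a i) (a j).
  move=> ij; apply: aN; elim: j ij => // j IHj; rewrite ltnS leq_eqVlt => /orP[/eqP->|/IHj]; first by left.
  by right.
have [b [b0 bI bEM]] := indiscernible_extraction Minh Msat Mhom GD aT.
exists b; split=> //.
apply: (bEM 1 (fun Y : tup M (ctx_cat (eqctx E) (eqctx E)) => ~ E (lpart Y) (rpart Y))).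
  exact: dfn_not.
move=> i di /= Eij; apply: (aE (i 1) (i 0)); first exact: di.
exact: eqr_sym.
Qed.

End RealSequences.

(** * Separating variables from parameters *)

Section TermFunctions.
Context (L : ablang) (Phi : set (ppfm L)) (XA : ext (Lquo Phi)) (XC : ext L).
Context (M : structure (Lseq XA XC)).
Local Notation LA := (LA XA).
Local Notation LC := (LC XC).
Local Notation triple := (triple M).

Lemma term_fun_seval u wA wB wC (g : tup M u -> triple wA wB wC) s (t : sterm wA wB wC s) :
  (forall i, @term_fun _ M u (InA XC (wA i)) (fun e => (g e).1.1 i)) ->
  (forall i, @term_fun _ M u (InB XA XC (wB i)) (fun e => (g e).1.2 i)) ->
  (forall i, @term_fun _ M u (InC XA (wC i)) (fun e => (g e).2 i)) ->
  term_fun (fun e => seval (g e) t).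
Proof.
move=> gA gB gC; case: s t => s t /=.
- by apply: (@term_fun_reduct _ _ (inclA XA XC) M wA s (fun a => eval a t)) => //; exists t.
- by apply: (@term_fun_reduct _ _ (inclB XA XC) M wB s (fun b => eval b t)) => //; exists t.
- by apply: (@term_fun_reduct _ _ (inclC XA XC) M wC s (fun c => eval c t)) => //; exists t.
Qed.

Definition jctx (wA : ctx (sorts LA)) (wB : ctx (sorts L)) (wC : ctx (sorts LC)) :
    ctx (sorts (Lseq XA XC)) :=
  ctx_cat (ctx_map (inclA XA XC) wA) (ctx_cat (ctx_map (inclB XA XC) wB) (ctx_map (inclC XA XC) wC)).

Definition join wA wB wC (x : triple wA wB wC) : tup M (jctx wA wB wC) :=
  @ecat _ (car M) (ctx_map (inclA XA XC) wA) _ x.1.1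
    (@ecat _ (car M) (ctx_map (inclB XA XC) wB) (ctx_map (inclC XA XC) wC) x.1.2 x.2).

Definition unjoin wA wB wC (e : tup M (jctx wA wB wC)) : triple wA wB wC :=
  (lpart e, lpart (rpart e), rpart (rpart e)).

Lemma joinK wA wB wC (x : triple wA wB wC) : unjoin (join x) = x.
Proof. by case: x => -[]. Qed.

Definition tcat wA wB wC vA vB vC (x : triple wA wB wC) (y : triple vA vB vC) :
    triple (ctx_cat wA vA) (ctx_cat wB vB) (ctx_cat wC vC) :=
  (ecat x.1.1 y.1.1, ecat x.1.2 y.1.2, ecat x.2 y.2).

Definition sleft wA wB wC vA vB vC (s : sorts (Lseq XA XC)) (t : sterm wA wB wC s) :
    sterm (ctx_cat wA vA) (ctx_cat wB vB) (ctx_cat wC vC) s :=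
  ssub (fun i => @Tvar _ (ctx_cat wA vA) (inl i)) (fun i => @Tvar _ (ctx_cat wB vB) (inl i))
    (fun i => @Tvar _ (ctx_cat wC vC) (inl i)) t.
Definition sright wA wB wC vA vB vC (s : sorts (Lseq XA XC)) (t : sterm vA vB vC s) :
    sterm (ctx_cat wA vA) (ctx_cat wB vB) (ctx_cat wC vC) s :=
  ssub (fun i => @Tvar _ (ctx_cat wA vA) (inr i)) (fun i => @Tvar _ (ctx_cat wB vB) (inr i))
    (fun i => @Tvar _ (ctx_cat wC vC) (inr i)) t.

Lemma seval_sleft wA wB wC vA vB vC (x : triple wA wB wC) (y : triple vA vB vC) s
    (t : sterm wA wB wC s) : seval (tcat x y) (sleft vA vB vC t) = seval x t.
Proof. by rewrite seval_ssub; case: x => -[]. Qed.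
Lemma seval_sright wA wB wC vA vB vC (x : triple wA wB wC) (y : triple vA vB vC) s
    (t : sterm vA vB vC s) : seval (tcat x y) (sright wA wB wC t) = seval y t.
Proof. by rewrite seval_ssub; case: y => -[]. Qed.

(** One disjunct of the eliminated form holds at the given point; being sufficient for [Q], it alone
    replaces [Q]. *)
Lemma dfn_split (HM : expanded_pure_ses M) (HPhi : fundamental_system Phi (strB M))
    wA wB wC vA vB vC (Q : tup M (ctx_cat (jctx wA wB wC) (jctx vA vB vC)) -> Prop)
    (x : triple wA wB wC) (y : triple vA vB vC) : dfn Q -> Q (ecat (join x) (join y)) ->
  exists (PA PC : triple (ctx_cat wA vA) (ctx_cat wB vB) (ctx_cat wC vC) -> Prop),
    [/\ Adef PA, Cdef PC, PA (tcat x y), PC (tcat x y) &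
      forall x' y', PA (tcat x' y') -> PC (tcat x' y') -> Q (ecat (join x') (join y'))].
Proof.
move=> [[q qE]|[b bE]] Qxy; last first.
  exists (fun _ => True), (fun _ => True); split=> //; [exact: Adef_const|exact: Cdef_const|].
  by move=> x' y' _ _; apply/bE; exact: (bE _).1 Qxy.
pose thj uA uB uC (i : pos (shp (jctx uA uB uC))) : sterm uA uB uC (jctx uA uB uC i) :=
  match i return sterm uA uB uC (jctx uA uB uC i) with
  | inl i => @Tvar _ uA i | inr (inl i) => @Tvar _ uB i | inr (inr i) => @Tvar _ uC i end.
have thjE uA uB uC (z : triple uA uB uC) i : seval z (thj uA uB uC i) = join z i.
  by case: i => [i|[i|i]].
pose th (i : pos (shp (ctx_cat (jctx wA wB wC) (jctx vA vB vC)))) :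
    sterm (ctx_cat wA vA) (ctx_cat wB vB) (ctx_cat wC vC) (ctx_cat (jctx wA wB wC) (jctx vA vB vC) i) :=
  match i with inl i => sleft vA vB vC (thj _ _ _ i) | inr i => sright wA wB wC (thj _ _ _ i) end.
have thE x' y' : sevals th (tcat x' y') = ecat (join x') (join y').
  by apply: fext => -[i|i]; rewrite /sevals /th ?seval_sleft ?seval_sright thjE.
have [l [lAC lE]] := sep_sat HM HPhi q th.
have := (lE (tcat x y)).1; rewrite thE qE => /(_ Qxy) [[PA PC] [ql PAx PCx]].
have [APA CPC] := lAC _ ql; exists PA, PC; split=> // x' y' PAx' PCx'.
by rewrite -qE -thE; apply/lE; exists (PA, PC).
Qed.

End TermFunctions.

Section QuotientSum.
Context (L : ablang) (Phi : set (ppfm L)) (XA : ext (Lquo Phi)) (XC : ext L).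
Context (M : structure (Lseq XA XC)) (HM : expanded_pure_ses M).
Local Notation LA := (LA XA).
Local Notation pi := (@pi_map _ _ _ _ M).

Definition qlift (p : {p | Phi p}) (z : car (strA' M) (sort_quo XA p)) : tup (strA M) (pp_ctx (sval p)) :=
  projT1 (cid (ses_pi_surj HM z)).

Lemma qliftK p z : pi (@qlift p z) = z.
Proof. exact: (projT2 (cid (ses_pi_surj HM z))). Qed.

(** The group law of A/phi(A), for which the quotient sorts carry no prescribed symbol; [qaddE]
    shows that the choice of representatives is immaterial. *)
Definition qadd (p : {p | Phi p}) (z z' : car (strA' M) (sort_quo XA p)) :
  car (strA' M) (sort_quo XA p) := pi (eadd (qlift z) (qlift z')).

Lemma qaddE p (a a' : tup (strA M) (pp_ctx (sval p))) : qadd (pi a) (pi a') = pi (eadd a a').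
Proof.
apply/(ses_pi_ker HM); rewrite (esubDD (ses_abA HM)).
by apply: (pp_add (ses_abA HM)); apply/(ses_pi_ker HM); exact: qliftK.
Qed.

(** The shape of the values of [rho] at a sum: additive at the indices in [J], the default pi(0) at
    the others. *)
Definition qsum (I : ishape) (phi : pos I -> {p | Phi p}) (J : pos I -> Prop)
    (r s : tup (strA' M) (quo_ctx XA phi)) : tup (strA' M) (quo_ctx XA phi) :=
  fun j => if pselect (J j) then qadd (r j) (s j) else pi (ezero (strA M) (pp_ctx (sval (phi j)))).

(** The chosen representatives need not be definable, but any others do as well: they are quantified
    over in A. *)
Lemma dfn_qsum (I : ishape) (phi : pos I -> {p | Phi p}) (J : pos I -> Prop)
    (v w : ctx (sorts LA)) (Q : tup (strA' M) (ctx_cat w (quo_ctx XA phi)) -> Prop)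
    (x : tup (strA' M) v -> tup (strA' M) w) (r s : tup (strA' M) v -> tup (strA' M) (quo_ctx XA phi)) :
  dfn Q -> (forall i, term_fun (fun e => x e i)) -> (forall i, term_fun (fun e => r e i)) ->
  (forall i, term_fun (fun e => s e i)) -> dfn (fun e => Q (ecat (x e) (qsum J (r e) (s e)))).
Proof.
move=> dQ tx tr ts.
pose W j : ctx (sorts LA) := ctx_map (sort_A XA) (pp_ctx (sval (phi j))).
pose sum (al al' : forall j, tup (strA' M) (W j)) : tup (strA' M) (quo_ctx XA phi) := fun j =>
  if pselect (J j) then pi (eadd (al j : tup (strA M) _) (al' j))
  else pi (ezero (strA M) (pp_ctx (sval (phi j)))).
pose B e (al al' : forall j, tup (strA' M) (W j)) := (forall j, pi (al j) = r e j) /\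
  (forall j, pi (al' j) = s e j) /\ Q (ecat (x e) (sum al al')).
apply: (@dfn_ext _ _ _ _ (fun e => exists al, exists al', B e al al')).
  move=> e; split=> [Qe|[al [al' [alr [als Qs]]]]].
    exists (fun j => qlift (r e j)), (fun j => qlift (s e j)).
    by split=> [j|]; [exact: qliftK|split=> [j|]; [exact: qliftK|exact: Qe]].
  suff -> : qsum J (r e) (s e) = sum al al' by [].
  apply: fext => j; rewrite /sum /qsum.
  by case: pselect => // Jj; rewrite -alr -als qaddE.
apply: (@dfn_ex_family _ (strA' M) v I W (fun al e => exists al', B e al al')) => u f g tf tg.
apply: (@dfn_ex_family _ (strA' M) u I W (fun al' e => B (g e) (f e) al')) => u' f' g' tf' tg'.
have tpi j (h : tup (strA' M) u' -> tup (strA M) (pp_ctx (sval (phi j)))) :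
    (forall k, @term_fun _ (strA' M) u' (sort_A XA (pp_ctx (sval (phi j)) k)) (fun e => h e k)) ->
    @term_fun _ (strA' M) u' (sort_quo XA (phi j)) (fun e => pi (h e)) := @term_fun_pi _ _ _ _ M u' (phi j) h.
have tfg j k : term_fun (fun e => f (g' e) j k) by exact: (term_fun_comp (tf j k)).
have tg2 i : term_fun (fun e => g (g' e) i) by exact: (term_fun_comp (tg i)).
apply: dfn_and; first apply: dfn_forall_pos => j.
  by apply: dfn_eq; [exact: tpi (tfg j)|exact: (term_fun_comp (tr j))].
apply: dfn_and; first apply: dfn_forall_pos => j.
  by apply: dfn_eq; [exact: tpi (tf' j)|exact: (term_fun_comp (ts j))].
apply: dfn_comp dQ _ => -[i|j]; first exact: (term_fun_comp (tx i)).
rewrite /= /sum; case: pselect => Jj.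
  by apply: tpi => k; apply: (@term_fun_add _ _ (inclA0 XA) (strA' M)); [exact: tfg|exact: tf'].
by apply: tpi => k; exact: (@term_fun_zero _ _ (inclA0 XA) (strA' M)).
Qed.

End QuotientSum.

Section Link.
Context (L : ablang) (Phi : set (ppfm L)) (XA : ext (Lquo Phi)) (XC : ext L).
Context (M : structure (Lseq XA XC)) (HM : expanded_pure_ses M).
Context (HPhi : fundamental_system Phi (strB M)).
Local Notation rho := (@rho_map _ _ _ _ M).

(* The compatibility between the values [z = nu y] and [r j = rho (t j y - x j z0)] that is
   needed to recover [y] is a condition on [r] in A^* and a condition on [z] in C^*. *)
Lemma link_split (wB V : ctx (sorts L)) (I : ishape) (phi : pos I -> {p | Phi p})
    (t : forall j k, @term L wB (pp_ctx (sval (phi j)) k))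
    (x : forall j k, @term L V (pp_ctx (sval (phi j)) k)) (y : tup (strB M) wB) (z0 : tup (strB M) V) :
  exists (PA PC : triple M (quo_ctx XA phi) V (ctx_map inl wB) -> Prop),
    let r y : tup (strA' M) (quo_ctx XA phi) := fun j => rho (esub (evals (t j) y) (evals (x j) z0)) in
    [/\ Adef PA, Cdef PC, PA (r y, z0, nus y), PC (r y, z0, nus y) &
      forall r' z', PA (r', z0, z') -> PC (r', z0, z') -> exists y', nus y' = z' /\ r y' = r'].
Proof.
(* The parameter [z0] is kept as a B-variable, so that [sep_exB] eliminates [y] alone; the disjunct
   that holds at the given [y] provides [PA] and [PC]. *)
pose P (e : triple M (quo_ctx XA phi) (ctx_cat wB V) (ctx_map inl wB)) :=
  (forall i, e.2 i = nu_map (lpart e.1.2 i)) /\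
  (forall j, e.1.1 j = rho (esub (evals (t j) (lpart e.1.2)) (evals (x j) (rpart e.1.2)))).
have sP : separable P.
  apply: sep_and; apply: sep_forall_pos => i.
    apply: sep_C; exists (fun e : tup (strC' M) (ctx_cat (ctx_map inl wB) (ctx_map inl (ctx_cat wB V))) =>
      lpart e i = rpart e (inl i)); split=> //.
    by apply: dfn_eq; variable_path i 5.
  pose s k : @term L (ctx_cat wB V) (pp_ctx (sval (phi i)) k) :=
    tsubtract (tsub (fun l => @Tvar _ (ctx_cat wB V) (inl l)) (t i k))
      (tsub (fun l => @Tvar _ (ctx_cat wB V) (inr l)) (x i k)).
  apply: sep_A; exists Sh1, (fun _ => phi i), (fun _ => s).
  exists (fun e : tup (strA' M) (ctx_cat (quo_ctx XA phi) (quo_ctx XA (fun _ : pos Sh1 => phi i))) =>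
    lpart e i = rpart e tt); split=> [|e].
    by apply: dfn_eq; [variable_path i 5|variable_path tt 5].
  rewrite /rhos /=.
  suff -> : evals s e.1.2 = esub (evals (t i) (lpart e.1.2)) (evals (x i) (rpart e.1.2)) by [].
  by apply: fext => k; rewrite /evals /s eval_tsubtract !eval_tsub.
have [l [lAC lE]] := sep_exB HM HPhi sP.
pose r y : tup (strA' M) (quo_ctx XA phi) := fun j => rho (esub (evals (t j) y) (evals (x j) z0)).
have [|[PA PC] [ql PAy PCy]] := (lE (r y, z0, nus y)).1; first by exists y.
have [APA CPC] := lAC _ ql; exists PA, PC; split=> // r' z' PA' PC'.
have [|y' [y'z y'r]] := (lE (r', z0, z')).2; first by exists (PA, PC).
by exists y'; split; apply: fext => j; apply/esym; [exact: y'z|exact: y'r].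
Qed.

End Link.

Section Cosets.
Context (L : ablang) (Phi : set (ppfm L)) (XA : ext (Lquo Phi)) (XC : ext L).
Context (M : structure (Lseq XA XC)) (HM : expanded_pure_ses M).
Context (Gamma Delta : set (elt (Meq M))) (V : set (elt M)).
Let G : set (elt M) := [set x | Gamma (real_elt x)].
Hypothesis Minh : forall v, inhabited (@fm (Lseq XA XC) v).
Hypothesis Msat : succ_saturated Delta M.
Hypothesis Mhom : succ_strongly_homogeneous Delta M.
Hypothesis GD : forall S : set (elt M), countable S -> G `|` S #<= Delta.
Hypothesis nC : ~ set_tp_divides (partC (@real_elt _ M @` V)) (partC Delta) (partC Gamma).

(** If the coset of [d] were not algebraic, an indiscernible sequence of representatives would begin
    with two distinct cosets; as the condition x - d in phi(C), which [m] satisfies, does not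
    divide, some point would lie in both. *)
Lemma coset_in_acl (p : ppfm L) (m d : tup (strC M) (pp_ctx p)) :
  (forall i, V (@Elt _ M (InC XA (inl (pp_ctx p i))) (m i))) ->
  (forall i, Delta (real_elt (@Elt _ M (InC XA (inl (pp_ctx p i))) (d i)))) ->
  sat p (esub m d) ->
  acl Gamma (@Elt _ (Meq M) (inr (C_coset HM p)) (@class_of _ M (C_coset HM p) d)).
Proof.
move=> mV dD pmd; apply: contrapT.
move=> /(infinite_class_sequence Minh Msat Mhom GD) [b [b0 bI b01]].
pose c : ctx (sorts (LC XC)) := ctx_map inl (pp_ctx p).
pose F (e : tup (strC' M) (ctx_cat c c)) := sat (M := strC M) p (esub (lpart e : tup (strC M) (pp_ctx p)) (rpart e)).
have dF : dfn F.
  apply: dfn_C => i; apply: (@term_fun_add _ _ (inclC0 XC) (strC' M)); first by variable_path i 5.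
  by apply: (@term_fun_opp _ _ (inclC0 XC) (strC' M)); variable_path i 5.
pose v0 : ctx (sorts (Lseq XA XC)) := Ctx (shp := Sh0) (fun i : void => match i with end).
pose c0 : tup M v0 := fun i : void => match i with end.
have bI' : indiscernible (partC Gamma) (b : nat -> tup (strC' M) c).
  apply: (@indiscernible_reduct _ _ (inclC XA XC) M G _ b c v0 c0 (fun e => lpart e)) => //.
    by move=> _ [[]].
  by variable.
have := @not_divides_consistent _ (strC' M) _ _ _ nC c c m F b _ _ dF _ bI' 1.
case=> [||| x xF].
- by apply/coordsS => i; exists (@Elt _ M (InC XA (inl (pp_ctx p i))) (m i)).
- by rewrite b0; apply/coordsS.
- by rewrite b0.
apply: b01; have [x0 x1] := (xF 0 erefl, xF 1 erefl).
exact: (same_coset_trans (ses_abC HM) (same_coset_sym (ses_abC HM) x0) x1).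
Qed.

End Cosets.

Section TermSplitting.
Context (L : ablang) (w v u : ctx (sorts L)).
Context (t : forall k : pos (shp u), @term L (ctx_cat w v) (u k)).

Definition tpadr (i : pos (shp (ctx_cat w v))) : @term L w (ctx_cat w v i) :=
  match i with inl i => @Tvar _ w i | inr i => tzero w (v i) end.
Definition tpadl (i : pos (shp (ctx_cat w v))) : @term L v (ctx_cat w v i) :=
  match i with inl i => tzero v (w i) | inr i => @Tvar _ v i end.
Definition tleft k : @term L w (u k) := tsub tpadr (t k).
Definition tright k : @term L v (u k) := tsub tpadl (t k).

Lemma evals_split (N : structure L) (x : tup N w) (y : tup N v) : abelian N ->
  evals t (ecat x y) = eadd (evals tleft x) (evals tright y).
Proof.
move=> abN; rewrite (ecat_zero abN) (evals_add abN) /tleft /tright !evals_tsub.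
have -> : evals tpadr x = ecat x (ezero N v) by apply: fext => -[i|i]; [|exact: eval_tzero].
by have -> : evals tpadl y = ecat (ezero N w) y by apply: fext => -[i|i]; [exact: eval_tzero|].
Qed.

End TermSplitting.

(** * From the two reducts back to M *)

Section Converse.
Context (L : ablang) (Phi : set (ppfm L)) (XA : ext (Lquo Phi)) (XC : ext L).
Context (M : structure (Lseq XA XC)) (HM : expanded_pure_ses M).
Context (HPhi : fundamental_system Phi (strB M)).
Context (Gamma Delta : set (elt (Meq M))) (V : set (elt M)).
Let G : set (elt M) := [set x | Gamma (real_elt x)].
Let D : set (elt M) := [set x | Delta (real_elt x)].
Hypothesis Msat : succ_saturated Delta M.
Hypothesis Mhom : succ_strongly_homogeneous Delta M.
Hypothesis GammaDelta : Gamma `<=` Delta.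
Hypothesis Gamma_dcl : Gamma = dcl Gamma.
Hypothesis Delta_dcl : Delta = dcl Delta.
Hypothesis Delta_real : Delta = dcl (@real_elt _ M @` D).
Hypothesis acl_coset : forall p : ppfm L, Phi p -> forall X : eqclass (C_coset HM p),
  acl Gamma (@Elt _ (Meq M) (inr (C_coset HM p)) X) ->
  exists beta : tup (strB M) (pp_ctx p),
    (forall i, G (@Elt _ M (InB XA XC (pp_ctx p i)) (beta i))) /\
    sval X (emap (@nu_map _ _ _ _ M) beta).
Hypothesis Vfc : func_closed V.
Hypothesis GV : G `<=` V.
Let U := @real_elt _ M @` V.
Hypothesis nA : ~ set_tp_divides (partA U) (partA Delta) (partA Gamma).
Hypothesis nC : ~ set_tp_divides (partC U) (partC Delta) (partC Gamma).
Local Notation iota := (@iota_map _ _ _ _ M).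
Local Notation nu := (@nu_map _ _ _ _ M).
Local Notation rho := (@rho_map _ _ _ _ M).
Local Notation LA := (LA XA).
Local Notation LC := (LC XC).
Local Notation inphi phi j e := (sat (M := strC M) (sval (phi j)) e).

(* The coset of [tleft (t j) (nu b)] is also that of an element over Delta.  As the type in C^*
   does not divide, it is algebraic over Gamma, hence represented by some [be j] over Gamma. *)
Lemma coset_representatives wB dB (I : ishape) (phi : pos I -> {p | Phi p})
    (t : forall j k, @term L (ctx_cat wB dB) (pp_ctx (sval (phi j)) k))
    (b : tup (strB M) wB) (d : tup (strB M) dB) :
  (forall v, inhabited (@fm (Lseq XA XC) v)) ->
  (forall i, V (@Elt _ M (InB XA XC (wB i)) (b i))) ->
  (forall i, D (@Elt _ M (InB XA XC (dB i)) (d i))) ->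
  exists be : forall j, tup (strB M) (pp_ctx (sval (phi j))),
    forall j, (forall i, G (@Elt _ M (InB XA XC (pp_ctx (sval (phi j)) i)) (be j i))) /\
    (inphi phi j (emap nu (evals (t j) (ecat b d))) ->
     inphi phi j (esub (evals (tleft (t j)) (emap nu b)) (emap nu (be j)))).
Proof.
move=> Minh bV dD.
have GD (S : set (elt M)) : countable S -> G `|` S #<= Delta.
  move=> /(countable_union_card Minh Delta_dcl); apply: card_le_trans.
  by apply: subset_card_le => x [/GammaDelta|]; [left|right].
have aC := ses_abC HM.
have DD := dcl_func_closed Delta_dcl; have GG := dcl_func_closed Gamma_dcl.
suff H j : exists be : tup (strB M) (pp_ctx (sval (phi j))),
    (forall i, G (@Elt _ M (InB XA XC (pp_ctx (sval (phi j)) i)) (be i))) /\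
    (inphi phi j (emap nu (evals (t j) (ecat b d))) ->
     inphi phi j (esub (evals (tleft (t j)) (emap nu b)) (emap nu be))).
  by exists (fun j => projT1 (cid (H j))) => j; exact: (projT2 (cid (H j))).
have [Jj|nJ] := pselect (inphi phi j (emap nu (evals (t j) (ecat b d)))); last first.
  exists (ezero (strB M) _); split=> // i.
  by apply: (GG _ _ (FB XA XC (sy_zero (pp_ctx (sval (phi j)) i))) (fun k : void => match k with end)) => _ [[]].
pose m := evals (tleft (t j)) (emap nu b); pose e := eopp (evals (tright (t j)) (emap nu d)).
have me : esub m e = emap nu (evals (t j) (ecat b d)).
  rewrite (emap_evals (ses_nu_fun HM)) emap_ecat (evals_split _ _ _ aC).
  by rewrite /esub /e (eoppK aC).
have [|||be [beG Xbe]] := acl_coset (svalP (phi j))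
  (coset_in_acl HM Minh Msat Mhom GD nC (p := sval (phi j)) (m := m) (d := e) _ _ _).
- move=> i; have -> : m = emap nu (evals (tleft (t j)) b) by rewrite (emap_evals (ses_nu_fun HM)).
  by apply: (closed_nu Vfc); exact: closed_evalB.
- move=> i; have -> : e = emap nu (eopp (evals (tright (t j)) d)).
    by rewrite (emap_opp (ses_abB HM) aC (ses_nu_fun HM)) (emap_evals (ses_nu_fun HM)).
  apply: (closed_nu DD).
  apply: (DD _ _ (FB XA XC (sy_opp (pp_ctx (sval (phi j)) i))) (fun _ => eval d (tright (t j) i))).
  by apply/coordsS => l; exact: (closed_evalB DD).
- by rewrite me.
exists be; split=> // _; rewrite -(esub_trans aC _ e); apply: (pp_add aC); last exact: Xbe.
by rewrite me.
Qed.


Lemma term_funB u w s (t : @term L w s) (g : tup M u -> tup (strB M) w) :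
  (forall i, @term_fun _ M u (InB XA XC (w i)) (fun e => g e i)) ->
  @term_fun _ M u (InB XA XC s) (fun e => eval (M := strB M) (g e) t).
Proof. by apply: (@term_fun_reduct _ _ (inclB XA XC) M w s (fun b => eval b t)); exists t. Qed.

Lemma term_fun_rho u p (g : tup M u -> tup (strB M) (pp_ctx (sval p))) :
  (forall i, @term_fun _ M u (InB XA XC (pp_ctx (sval p) i)) (fun e => g e i)) ->
  @term_fun _ M u (InA XC (sort_quo XA p)) (fun e => rho (g e)).
Proof.
exact: (@term_fun_app _ M u (ctx_map (InB XA XC) (pp_ctx (sval p))) _ (SyRho XA XC p) g).
Qed.

Lemma term_fun_nu u s (g : tup M u -> car (strB M) s) :
  @term_fun _ M u (InB XA XC s) g -> @term_fun _ M u (InC XA (inl s)) (fun e => nu (g e)).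
Proof.
move=> tg.
exact: (@term_fun_app _ M u (ctx_const Sh1 (InB XA XC s)) _ (SyNu XA XC s) (fun e _ => g e)).
Qed.

Lemma closed_addB (S : set (elt M)) s (x x' : car (strB M) s) : func_closed S ->
  S (@Elt _ M (InB XA XC s) x) -> S (@Elt _ M (InB XA XC s) x') ->
  S (@Elt _ M (InB XA XC s) (gadd x x')).
Proof.
move=> Sfc Sx Sx'; pose a (i : pos (ShU Sh1 Sh1)) := match i with inl _ => x | inr _ => x' end.
by apply: (Sfc (ctx_const (ShU Sh1 Sh1) (InB XA XC s)) _ (FB XA XC (sy_add s)) a); apply/coordsS => -[].
Qed.

Lemma closed_oppB (S : set (elt M)) s (x : car (strB M) s) : func_closed S ->
  S (@Elt _ M (InB XA XC s) x) -> S (@Elt _ M (InB XA XC s) (gopp x)).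
Proof.
move=> Sfc Sx.
by apply: (Sfc (ctx_const Sh1 (InB XA XC s)) _ (FB XA XC (sy_opp s)) (fun _ => x)); apply/coordsS.
Qed.

(* For [j] in [J], [rho (t j (e, e'))] is the sum of [rho (tleft e - be j)], which belongs to
   A^*(U) when [e] is in U, and of [rho (be j + tright e')], which belongs to A^*(Delta) when
   [e'] is in Delta: this is what separates the variables from the parameters. *)
Lemma not_divides_of_parts : ~ set_tp_divides U Delta Gamma.
Proof.
move=> [W0 [v [vU [r [[n [p [pv pr]]] div]]]]].
have Minh u : inhabited (@fm (Lseq XA XC) u).
  have [w' [th _]] := rep_ctx (ctx_cat W0 (pvar r)).
  by have [q _] := rep_fm (pfml r) th; exact: fm_inhabited q.
have GD (S : set (elt M)) : countable S -> G `|` S #<= Delta.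
  move=> /(countable_union_card Minh Delta_dcl); apply: card_le_trans.
  by apply: subset_card_le => x [/GammaDelta|]; [left|right].
have [aB aC] := (ses_abB HM, ses_abC HM).
have DD := dcl_func_closed Delta_dcl; have GG := dcl_func_closed Gamma_dcl.
move: W0 v vU r p pv pr div; apply: real_tuple_ind => W v vV r p pv pr div.
(* [Q] is the conjunction of the finitely many formulas of the type that imply the dividing one,
   with parameters brought down to real elements of Delta. *)
have [wd0 [d0 [Q [dD dQ QE]]]] : pdf D (fun x : tup M W => forall i, psat (p i) (x : tup (Meq M) (ctx_map inl W))).
  apply: (@pdf_real _ M D (ctx_map inl W) W (fun x => forall i, psat (p i) x) id).
    by rewrite -Delta_real; apply: pdf_forall_ord => i; apply: psat_pdf; exact: (pv i).1.
  by move=> i; exists (@Tvar _ W i).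
have [wA [wB [wC [th Hth]]]] := triple_ctx M W; have [xv [xvE xvV]] := Hth v.
have [dA [dB [dC [thd Hthd]]]] := triple_ctx M wd0; have [xd [xdE xdD]] := Hthd d0.
have {}xvV := xvV V vV; have {}xdD := xdD D dD.
have tunjoin uA uB uC s (t : sterm uA uB uC s) w (f : tup M w -> tup M (jctx uA uB uC)) :
    (forall i, term_fun (fun e => f e i)) -> term_fun (fun e => seval (unjoin (f e)) t).
  move=> tf; apply: term_fun_seval => i.
  - exact: (tf (inl i)).
  - exact: (tf (inr (inl i))).
  - exact: (tf (inr (inr i))).
pose P1 (e : tup M (ctx_cat W (jctx dA dB dC))) :=
  Q (ecat (lpart e) (sevals thd (unjoin (rpart e)))).
have dP1 : dfn P1.
  apply: dfn_comp dQ _ => -[i|i]; first by variable_path i 5.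
  by apply: tunjoin; variable.
have [|b [b0 bI [m incons]]] := dividing_sequence Minh Msat Mhom GD (d := join xd) dP1 _ div.
  by move=> x; rewrite /P1 /rpart /lpart /= joinK xdE => Px; apply: pr; exact/QE.
pose y k := unjoin (b k).
have y0 : y 0 = xd by rewrite /y b0 joinK.
pose Q2 (e : tup M (ctx_cat (jctx wA wB wC) (jctx dA dB dC))) :=
  Q (ecat (sevals th (unjoin (lpart e))) (sevals thd (unjoin (rpart e)))).
have dQ2 : dfn Q2.
  by apply: dfn_comp dQ _ => -[i|i]; apply: tunjoin; variable.
have Q2E x z : Q2 (ecat (join x) (join z)) <-> Q (ecat (sevals th x) (sevals thd z)).
  by rewrite /Q2 /lpart /rpart /= !joinK.
have Q2v : Q2 (ecat (join xv) (join xd)).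
  by apply/Q2E; rewrite xvE xdE; apply/QE => i; exact: (pv i).2.
have [PA [PC [[I [phi [t [QA [dQA QAE]]]]] [QC [dQC QCE]] PAv PCv PQ]]] :=
  dfn_split HM HPhi dQ2 Q2v.
have [vAV vBV vCV] := xvV; have [dAD dBD dCD] := xdD.
pose J j := inphi phi j (emap nu (evals (t j) (ecat xv.1.2 xd.1.2))).
have [be beP] := coset_representatives t Minh vBV dBD.
(* One tuple [z0] over Gamma holds all the [be j], ready to be appended to every term of the
   sequence. *)
have [V0 [x0 Hx0]] := family_ctx (fun j => pp_ctx (sval (phi j))).
have [z0 [z0E z0F]] := Hx0 (car (strB M)) be.
pose xt j k := tvar (x0 j k).
have xtE j : evals (xt j) z0 = be j by apply: fext => k; rewrite /evals eval_tvar.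
have z0G i : G (@Elt _ M (InB XA XC (V0 i)) (z0 i)).
  have [j [k E]] := z0F i.
  suff -> : @Elt _ M (InB XA XC (V0 i)) (z0 i) = @Elt _ M (InB XA XC _) (be j k) by exact: (beP j).1.
  exact: (congr1 (fun z : elt (strB M) => red_elt (h := inclB XA XC) (M := M) z) E).
have z0D i : D (@Elt _ M (InB XA XC (V0 i)) (z0 i)) by exact/GammaDelta/z0G.
pose tl j k := tleft (t j) k; pose tr j k := tright (t j) k.
have [LkA [LkC []]] := link_split HM HPhi tl xt xv.1.2 z0.
pose rr (e : tup (strB M) wB) : tup (strA' M) (quo_ctx XA phi) :=
  fun j => rho (esub (evals (tl j) e) (evals (xt j) z0)).
move=> [I' [phi' [t' [SA [dSA SAE]]]]] [SC [dSC SCE]] /SAE SAv /SCE SCv link.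
rewrite -/(rr _) /= in SAv; rewrite /= in SCv.
(* The extra variables are the values rho(tl e - be); the extra parameters are rho(be + tr e') and
   the values of [rho] at terms in [z0] from the gluing condition. *)
pose mA := ctx_cat wA (quo_ctx XA phi).
pose pA := ctx_cat dA (ctx_cat (quo_ctx XA phi) (quo_ctx XA phi')).
pose FA (e : tup (strA' M) (ctx_cat mA pA)) :=
  QA (ecat (ecat (lpart (lpart e)) (lpart (rpart e)))
    (qsum HM J (rpart (lpart e)) (lpart (rpart (rpart e))))) /\
  SA (ecat (rpart (lpart e)) (rpart (rpart (rpart e)))).
have dFA : dfn FA.
  apply: dfn_and; last by apply: dfn_comp dSA _ => -[]; variable.
  apply: (@dfn_qsum _ _ _ _ _ HM _ _ _ _ _ QA (fun e : tup (strA' M) (ctx_cat mA pA) =>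
    ecat (lpart (lpart e)) (lpart (rpart e)))) => //; [case; variable|variable|variable].
pose fA (e : tup M (ctx_cat (jctx dA dB dC) (ctx_map (inclB XA XC) V0))) : tup (strA' M) pA :=
  ecat (unjoin (lpart e)).1.1
    (ecat ((fun j => rho (eadd (evals (xt j) ((rpart e : tup M (ctx_map (inclB XA XC) V0)) : tup (strB M) V0)) (evals (tr j) (unjoin (lpart e)).1.2)))
           : tup (strA' M) (quo_ctx XA phi))
          (rhos t' ((rpart e : tup M (ctx_map (inclB XA XC) V0)) : tup (strB M) V0))).
pose bz k := @ecat _ (car M) (jctx dA dB dC) (ctx_map (inclB XA XC) V0) (b k) z0.
pose bA k := fA (bz k).
have bAI : indiscernible (partA Gamma) bA.
  apply: (@indiscernible_reduct _ _ (inclA XA XC) M G _ b pA (ctx_map (inclB XA XC) V0) z0 fA) => //.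
    exact/coordsS.
  case=> [i|[j|j]]; first by variable_path i 5.
    apply: term_fun_rho => k; apply: (@term_fun_add _ _ (inclB XA XC) M); apply: term_funB; variable.
  by apply: term_fun_rho => k; apply: term_funB; variable.
pose mC := ctx_cat wC (ctx_map inl wB).
pose pC : ctx (sorts LC) := ctx_cat dC (ctx_cat (ctx_map inl dB) (ctx_map inl V0)).
(* Non-membership outside [J] is recorded too: along the whole sequence [rho] must be additive at
   the same indices and take its default value at the others. *)
pose FC (e : tup (strC' M) (ctx_cat mC pC)) :=
  let z : tup (strC M) wB := rpart (lpart e) in
  let ze : tup (strC M) dB := lpart (rpart (rpart e)) in
  let g : tup (strC M) V0 := rpart (rpart (rpart e)) in
  QC (@ecat _ _ _ (ctx_map inl (ctx_cat wB dB)) (ecat (lpart (lpart e)) (lpart (rpart e)))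
        (@ecat _ (car (strC M)) wB dB z ze)) /\
  SC (@ecat _ _ (ctx_map inl wB) (ctx_map inl V0) z g) /\
  (forall j, (J j -> inphi phi j (esub (evals (tl j) z) (evals (xt j) g)) /\
                      inphi phi j (eadd (evals (xt j) g) (evals (tr j) ze))) /\
              (~ J j -> ~ inphi phi j (evals (t j) (ecat z ze)))).
have dFC : dfn FC.
  apply: dfn_and; first by apply: dfn_comp dQC _ => -[[]|[]]; variable.
  apply: dfn_and; first by apply: dfn_comp dSC _ => -[]; variable.
  apply: dfn_forall_pos => j; apply: dfn_and; apply: dfn_impl; do ?exact: dfn_const.
    apply: dfn_and; apply: dfn_C => k; apply: (@term_fun_add _ _ (inclC0 XC) (strC' M)).
    - by apply: term_fun_C; variable.
    - by apply: (@term_fun_opp _ _ (inclC0 XC) (strC' M)); apply: term_fun_C; variable.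
    - by apply: term_fun_C; variable.
    - by apply: term_fun_C; variable.
  by apply/dfn_not/dfn_C => k; apply: term_fun_C => -[]; variable.
pose fC (e : tup M (ctx_cat (jctx dA dB dC) (ctx_map (inclB XA XC) V0))) : tup (strC' M) pC :=
  ecat (unjoin (lpart e)).2 (ecat (nus (unjoin (lpart e)).1.2) (nus ((rpart e : tup M (ctx_map (inclB XA XC) V0)) : tup (strB M) V0))).
pose bC k := fC (bz k).
have bCI : indiscernible (partC Gamma) bC.
  apply: (@indiscernible_reduct _ _ (inclC XA XC) M G _ b pC (ctx_map (inclB XA XC) V0) z0 fC) => //.
    exact/coordsS.
  by case=> [i|[j|j]]; [variable_path i 5| |]; apply: term_fun_nu; variable_path j 5.
have tE j (e : tup (strB M) wB) (e' : tup (strB M) dB) :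
    evals (t j) (ecat e e') = eadd (evals (tl j) e) (evals (tr j) e') := evals_split _ _ _ aB.
have tCE j (e : tup (strC M) wB) (e' : tup (strC M) dB) :
    evals (t j) (ecat e e') = eadd (evals (tl j) e) (evals (tr j) e') := evals_split _ _ _ aC.
pose near (e : tup (strB M) wB) (e' : tup (strB M) dB) := forall j,
  (J j -> inphi phi j (esub (evals (tl j) (emap nu e)) (evals (xt j) (emap nu z0))) /\
          inphi phi j (eadd (evals (xt j) (emap nu z0)) (evals (tr j) (emap nu e')))) /\
  (~ J j -> ~ inphi phi j (evals (t j) (ecat (emap nu e) (emap nu e')))).
have nuE := emap_evals (ses_nu_fun HM).
have nuxt j : evals (xt j) (emap nu z0) = emap nu (be j) by rewrite -nuE xtE.
have rhosE e e' : near e e' ->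
    qsum HM J (rr e) (fun j => rho (eadd (be j) (evals (tr j) e'))) = rhos t (ecat e e').
  move=> H; apply: fext => j; have [HJ HN] := H j; rewrite /qsum.
  case: pselect => Jj; last first.
    apply/esym/(rho_out HM); rewrite nuE emap_ecat; exact: HN.
  have [H1 H2] := HJ Jj; apply: esym; rewrite /rhos.
  have -> : evals (t j) (ecat e e') =
      eadd (esub (evals (tl j) e) (be j)) (eadd (be j) (evals (tr j) e')).
    by rewrite tE (eaddA aB) (esubK aB).
  apply: (rho_add HM); rewrite ?qliftK ?/rr ?xtE //.
    by rewrite (emap_sub aB aC (ses_nu_fun HM)) nuE -nuxt.
  by rewrite (emap_add (ses_nu_fun HM)) nuE -nuxt.
have near0 : near xv.1.2 xd.1.2.
  move=> j; split=> [Jj|nJ]; last by rewrite -emap_ecat -nuE.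
  have H1 : inphi phi j (esub (evals (tl j) (emap nu xv.1.2)) (evals (xt j) (emap nu z0))).
    by rewrite nuxt; exact: (beP j).2 Jj.
  split=> //; apply/(pp_addr aC _ H1); rewrite (eaddC aC) (eaddA aC) (esubK aC) -tCE.
  by rewrite -emap_ecat -nuE.
have QAy (x : triple M wA wB wC) k : near x.1.2 (y k).1.2 ->
    QA (ecat (ecat x.1.1 (lpart (bA k))) (qsum HM J (rr x.1.2) (lpart (rpart (bA k))))) <->
    PA (tcat x (y k)).
  move=> xy; rewrite QAE /= -(rhosE _ _ xy).
  suff -> : lpart (rpart (bA k)) = fun j => rho (eadd (be j) (evals (tr j) (y k).1.2)) by [].
  by apply: fext => j; rewrite -xtE.
have QCy (x : triple M wA wB wC) k :
    QC (@ecat _ _ _ (ctx_map inl (ctx_cat wB dB)) (ecat x.2 (lpart (bC k)))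
        (@ecat _ (car (strC M)) wB dB (nus x.1.2) (lpart (rpart (bC k))))) <->
    PC (tcat x (y k)).
  by rewrite QCE /= /nus emap_ecat.
have FAv : FA (ecat (ecat xv.1.1 (rr xv.1.2)) (bA 0)).
  by split; [apply/QAy; rewrite y0|exact: SAv].
have FCv : FC (ecat (ecat xv.2 (nus xv.1.2)) (bC 0)).
  split; first by apply/QCy; rewrite y0.
  split; first exact: SCv.
  by move: near0; rewrite /near -y0.
have bA0 : bA 0 = ecat xd.1.1 (ecat ((fun j => rho (eadd (evals (xt j) z0) (evals (tr j) xd.1.2)))
    : tup (strA' M) (quo_ctx XA phi)) (rhos t' z0)) by rewrite -y0.
have [||xA xAF] := not_divides_consistent nA (m := ecat xv.1.1 (rr xv.1.2)) _ _ dFA FAv bAI m.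
- apply/coordsS => -[i|j].
    by exists (@Elt _ M (InA XC (wA i)) (xv.1.1 i)).
  exists (@Elt _ M (InA XC (sort_quo XA (phi j))) (rr xv.1.2 j)) => //.
  apply: (closed_rho Vfc) => k.
  apply: (closed_addB Vfc); first exact: closed_evalB.
  by apply: (closed_oppB Vfc); apply: closed_evalB => // i; exact: GV.
- apply/coordsS => -[i|[j|j]].
  + by rewrite bA0; exact: dAD.
  + rewrite bA0; apply: (closed_rho DD) => k.
    by apply: (closed_addB DD); exact: (closed_evalB DD).
  + by rewrite bA0; apply: (closed_rho DD) => k; exact: (closed_evalB DD).
have bC0 : bC 0 = ecat xd.2 (ecat (nus xd.1.2) (nus z0)) by rewrite -y0.
have [||xC xCF] := not_divides_consistent nC (m := ecat xv.2 (nus xv.1.2)) _ _ dFC FCv bCI m.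
- apply/coordsS => -[i|j].
    by exists (@Elt _ M (InC XA (wC i)) (xv.2 i)).
  exists (@Elt _ M (InC XA (inl (wB j))) (nus xv.1.2 j)) => //.
  exact: (closed_nu Vfc).
- apply/coordsS => -[i|[j|j]].
  + by rewrite bC0; exact: dCD.
  + by rewrite bC0; apply: (closed_nu DD); exact: dBD.
  + by rewrite bC0; apply: (closed_nu DD); exact: z0D.
(* [SA] and [SC] involve [z0] but not the term of the sequence, so index 0 suffices and the same [e]
   serves every [k]. *)
have [||e [eC eA]] := link (rpart xA) (rpart xC).
- by apply/SAE; have [_] := xAF 0 erefl.
- by apply/SCE; have [_ []] := xCF 0 erefl.
pose x : triple M wA wB wC := (lpart xA, e, lpart xC).
apply: (incons (sevals th x)) => k km.
suff /Q2E : Q2 (ecat (join x) (join (y k))) by [].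
have [Ak _] := xAF k km; have [Ck [_ nk]] := xCF k km.
have nek : near x.1.2 (y k).1.2 by rewrite /near -/(nus x.1.2) eC; exact: nk.
apply: PQ.
  by apply/(QAy x k nek); move: Ak; rewrite /= -eA.
by apply/QCy; rewrite eC.
Qed.

End Converse.

Theorem corollary5p6p5 (L : ablang) (Phi : set (ppfm L))
  (XA : ext (Lquo Phi)) (XC : ext L) (M : structure (Lseq XA XC))
  (HM : expanded_pure_ses M)
  (HPhi : fundamental_system Phi (strB M))
  (Gamma Delta : set (elt (Meq M)))
  (HGD : Gamma `<=` Delta)
  (HG : Gamma = dcl Gamma)
  (HD : Delta = dcl Delta)
  (Hsat : succ_saturated Delta M)
  (Hhom : succ_strongly_homogeneous Delta M)
  (w : ctx (sorts (Lseq XA XC))) (u : tup M w)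
  (H1 : forall p : ppfm L, Phi p ->
     forall X : eqclass (C_coset HM p),
     acl Gamma (@Elt _ (Meq M) (inr (C_coset HM p)) X) ->
     Gamma (@Elt _ (Meq M) (inr (C_coset HM p)) X))
  (H2 : Delta = dcl (@real_elt _ M @` parts Delta))
  (H3 : Gamma = dcl (@real_elt _ M @` parts Gamma))
  (H3' : forall p : ppfm L, Phi p ->
     forall X : eqclass (C_coset HM p),
     Gamma (@Elt _ (Meq M) (inr (C_coset HM p)) X) ->
     exists beta : tup (strB M) (pp_ctx p),
       coords beta `<=` partB Gamma /\ sval X (emap (@nu_map _ _ _ _ M) beta)) :
  let U := @real_elt _ M @` generated (coords u `|` parts Gamma) in
  ~ set_tp_divides U Delta Gamma <->
  ~ set_tp_divides (partA U) (partA Delta) (partA Gamma) /\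
  ~ set_tp_divides (partC U) (partC Delta) (partC Gamma).
Proof.
move=> U.
have [Vfc XV] := generated_closed (coords u `|` parts Gamma).
have GG := dcl_func_closed HG.
rewrite partsE in H2; have H3r := H3; rewrite partsE in H3r.
split=> [ndiv|[nA nC]].
  split=> div; apply: ndiv.
    exact: (divides_lift H3r (embeddedA GG HM HPhi) div).
  exact: (divides_lift H3r (embeddedC GG HM HPhi) div).
(* A coset algebraic over Gamma belongs to Gamma by [H1], and then has a representative over Gamma
   by [H3']. *)
apply: (not_divides_of_parts HPhi Hsat Hhom HGD HG HD H2 _ Vfc _ nA nC) => [p Pp X aclX|x Gx].
  have [be [beG Xbe]] := H3' p Pp X (H1 p Pp X aclX); exists be; split=> // i.
  exact: (coordsS be _).1 beG i.
by apply: XV; right; rewrite partsE.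
Qed.
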